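(* Let $\Theta\subset\mathbb{R}^m$ be compact and let $\theta^*\in\Theta$ be the true parameter of the model described in the context. Assume: (1) $(\varepsilon_k)_{k\in\mathbb{N}}$ is a sequence of i.i.d. random variables in $\mathbb{R}^d$. (2) If $\theta\in\Theta$ is such that $\Psi(S_\theta(t),t)=\Psi(S_{\theta^*}(t),t)$ for almost every $t\in[0,1]$, then $\theta=\theta^*$. (3) For all $t\in[0,1]$ and all $\theta\in\Theta$, $\mathbb{E}\{\Psi[S_\theta(t)+\varepsilon_1,t]\}=\Psi[S_\theta(t),t]$. (4) The map $t\mapsto \mathbb{E}(\Psi[S_{\theta^*}(t)+\varepsilon_1,t])^2$ is a finite continuous function on $[0,1]$; $\sup_{t\in[0,1]}\mathbb{E}\{(\Psi[S_{\theta^*}(t)+\varepsilon_1,t])^2 1_{(\Psi[S_{\theta^*}(t)+\varepsilon_1,t])^2>M}\}\to 0$ as $M\to+\infty$; and $(t,\theta)\mapsto\Psi[S_\theta(t),t]$ is a finite continuous function on $[0,1]\times\Theta$. (5) There exists a neighborhood $U\subset\Theta$ of $\theta^*$ in $\mathbb{R}^m$ such that for all $t\in[0,1]$, $\theta\mapsto\Psi[S_\theta(t),t]$ possesses two derivatives on $U$ that are continuous as functions of $(\theta,t)$ over $U\times[0,1]$. Define $$I_R(\theta)=\int_0^1\nabla_\theta\Psi[S_\theta(t),t]\,\nabla_\theta\Psi[S_\theta(t),t]^T\,dt,$$ $$I_\Psi(\theta)=\int_0^1\mathbb{E}\left\{\Psi[S_{\theta^*}(t)+\varepsilon_1,t]-\Psi[S_\theta(t),t]\right\}^2\nabla_\theta\Psi[S_\theta(t),t]\,\nabla_\theta\Psi[S_\theta(t),t]^T\,dt$$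 for $\theta\in U$, and suppose that $I_R(\theta^* )$ is non singular. Let $\overline{\theta}_n$ be any minimizer over $\Theta$ of $M_n(\theta)=\frac1n\sum_{k=1}^n(Y_k-\Psi[S_\theta(t_k),t_k])^2$. Then $$\sqrt n(\overline{\theta}_n-\theta^* )=I_R(\theta^* )^{-1}\frac1{\sqrt n}\sum_{k=1}^n\left\{\Psi[S_{\theta^*}(t_k)+\varepsilon_k,t_k]-\Psi[S_{\theta^*}(t_k),t_k]+V_k\right\}\nabla_\theta\Psi[S_{\theta^*}(t_k),t_k]+o_{\mathbb{P}_{\theta^*}}(1).$$ In particular, $\sqrt n(\overline{\theta}_n-\theta^* )$ converges in distribution to $\mathcal{N}(0,I_M^{-1}(\theta^* ))$, where $$I_M^{-1}(\theta^* )=I_R^{-1}(\theta^* )\left[I_\Psi(\theta^* )+\sigma^2I_R(\theta^* )\right]I_R^{-1}(\theta^* ).$$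
   Context: Model: $(t,\theta)\mapsto S_\theta(t)$ is a known map from $[0,1]\times\Theta$ to $\mathbb{R}^d$, $(x,t)\mapsto\Psi(x,t)$ is a known function from $\mathbb{R}^d\times[0,1]$ to $\mathbb{R}$. For each $n$, the observation times are $t_k=k/n$, $k=1,\dots,n$, and one observes only $Y_1,\dots,Y_n$, where $$X_k=S_{\theta^*}(t_k)+\varepsilon_k,\qquad Y_k=\Psi(X_k,t_k)+V_k .$$ $(\varepsilon_k)_{k\in\mathbb{N}}$ is a sequence of random variables in $\mathbb{R}^d$ (trajectory noise); $(V_k)_{k\in\mathbb{N}}$ is a sequence of i.i.d. centered real random variables with known density $g$ and finite variance $\sigma^2$, independent of $(\varepsilon_k)_{k\in\mathbb{N}}$. $\mathbb{P}_{\theta^*}$ denotes probability under the true parameter, $o_{\mathbb{P}_{\theta^*}}(1)$ a sequence converging to $0$ in $\mathbb{P}_{\theta^*}$-probability, and $\nabla_\theta$ the gradient (column vector) in $\theta$. *)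

(* Defs.v *)
(* MathComp-Analysis, over an abstract [R : realType]; the vectors of R^n are
   column vectors ['cV[R]_n]. *)
From HB Require Import structures.
From mathcomp Require Import all_boot all_order all_algebra.
From mathcomp Require Import finmap.
From mathcomp Require Import all_classical all_reals all_analysis.

Set Implicit Arguments.
Unset Strict Implicit.
Unset Printing Implicit Defensive.

Import Order.TTheory GRing.Theory Num.Theory.
Import numFieldNormedType.Exports.

Local Open Scope classical_set_scope.
Local Open Scope ring_scope.

(* R^n with its Borel sigma-algebra; the carrier is convertible to 'cV[R]_n.
   The norm of 'cV[R]_n is the sup norm, which induces the usual topology. *)
Notation borelCV R n := (g_sigma_algebraType (@open 'cV[R]_n)).

Section independence.
Context {dT d1 : measure_display} {T : measurableType dT}
  {T1 : measurableType d1} {R : realType}.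

Definition mutually_independent (P : probability T R)
    (X : nat -> {RV P >-> T1}) : Prop :=
  forall (J : {fset nat}) (B : nat -> set T1),
    (forall k, measurable (B k)) ->
    P (\bigcap_(k in [set` J]) (X k @^-1` B k)) =
    (\prod_(k <- J) P (X k @^-1` B k))%E.

Definition identically_distributed (P : probability T R)
    (X : nat -> {RV P >-> T1}) : Prop :=
  forall (j k : nat) (B : set T1), measurable B ->
    distribution P (X j) B = distribution P (X k) B.

Definition iid (P : probability T R) (X : nat -> {RV P >-> T1}) : Prop :=
  mutually_independent X /\ identically_distributed X.

End independence.

Definition sigma_of_sequence {dT d1 : measure_display}
    {T : measurableType dT} {T1 : measurableType d1} (X : nat -> T -> T1) :
    set (set T) :=
  <<s \bigcup_k preimage_set_system [set: T] (X k) measurable >>.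

Definition independent_sequences {dT d1 d2 : measure_display}
    {T : measurableType dT} {T1 : measurableType d1} {T2 : measurableType d2}
    {R : realType} (P : probability T R)
    (X : nat -> {RV P >-> T1}) (Y : nat -> {RV P >-> T2}) : Prop :=
  forall A B : set T,
    sigma_of_sequence (fun k => X k : T -> T1) A ->
    sigma_of_sequence (fun k => Y k : T -> T2) B ->
    P (A `&` B) = (P A * P B)%E.

Definition has_density {dT : measure_display} {T : measurableType dT}
    {R : realType} (P : probability T R) (X : {RV P >-> R}) (g : R -> R) :
    Prop :=
  [/\ measurable_fun [set: R] g, (forall x, 0 <= g x) &
      forall B : set R, measurable B ->
        distribution P X B = (\int[lebesgue_measure]_(x in B) (g x)%:E)%E].

Definition cvg_in_probability {dT : measure_display} {T : measurableType dT}
    {R : realType} (P : probability T R) {n : nat}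
    (Z : nat -> T -> 'cV[R]_n) (z : 'cV[R]_n) : Prop :=
  forall e : R, 0 < e ->
    P [set w | e <= `|Z k w - z|] @[k --> \oo] --> 0%E.

Definition cvg_in_distribution {dT : measure_display} {T : measurableType dT}
    {R : realType} (P : probability T R) {n : nat}
    (Z : nat -> T -> 'cV[R]_n) (mu : probability (borelCV R n) R) : Prop :=
  forall h : 'cV[R]_n -> R, continuous h ->
    (exists M : R, forall x, `|h x| <= M) ->
    ('E_P[h \o Z k])%E @[k --> \oo] --> (\int[mu]_x (h x)%:E)%E.

(* Real Gaussian law parametrized by its variance v >= 0, degenerate when v = 0;
   the case split is needed because [normal_prob m 0] is a uniform law. *)
Definition gaussian1 (R : realType) (c v : R) (B : set R) : \bar R :=
  if v == 0 then \d_c B else normal_prob c (Num.sqrt v) B.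

(* N(c, Sigma): every linear functional x |-> u^T x has law
   N(u^T c, u^T Sigma u). *)
Definition is_multinormal (R : realType) (n : nat)
    (mu : probability (borelCV R n) R) (c : 'cV[R]_n) (Sigma : 'M[R]_n) :
    Prop :=
  forall (u : 'cV[R]_n) (B : set R), measurable B ->
    mu [set x : 'cV[R]_n | B ((u^T *m x) 0 0)] =
    gaussian1 ((u^T *m c) 0 0) ((u^T *m Sigma *m u) 0 0) B.

Definition gradient (R : realType) (m : nat) (f : 'cV[R]_m -> R)
    (theta : 'cV[R]_m) : 'cV[R]_m :=
  \col_i 'D_(delta_mx i 0) f theta.

Definition hessian (R : realType) (m : nat) (f : 'cV[R]_m -> R)
    (theta : 'cV[R]_m) : 'M[R]_m :=
  \matrix_(i, j) 'D_(delta_mx j 0) (fun x => gradient f x i 0) theta.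

(* Functions defined on a product of [0, 1] or Theta are represented by total
   functions; only their values on the stated domains are constrained. *)
Section model.
Context {R : realType} {d m : nat}.
Variables (Psi : 'cV[R]_d -> R -> R) (S : 'cV[R]_m -> R -> 'cV[R]_d).

Definition signal (t : R) (theta : 'cV[R]_m) : R := Psi (S theta t) t.

Definition obs_time (n k : nat) : R := k%:R / n%:R.

Definition info_R (theta : 'cV[R]_m) : 'M[R]_m :=
  \matrix_(i, j) (\int[lebesgue_measure]_(t in `[0, 1])
    ((gradient (signal t) theta *m (gradient (signal t) theta)^T) i j)).

Context {dT : measure_display} {T : measurableType dT} {P : probability T R}.
Variables (eps : nat -> {RV P >-> borelCV R d}) (V : nat -> {RV P >-> R}).
Variable thetas : 'cV[R]_m.

Definition noisy_signal (k : nat) (t : R) (theta : 'cV[R]_m) (w : T) : R :=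
  Psi (S theta t + (eps k w : 'cV[R]_d)) t.

Definition trajectory (n k : nat) (w : T) : 'cV[R]_d :=
  S thetas (obs_time n k) + (eps k w : 'cV[R]_d).

Definition observation (n k : nat) (w : T) : R :=
  Psi (trajectory n k w) (obs_time n k) + V k w.

Definition contrast (n : nat) (theta : 'cV[R]_m) (w : T) : R :=
  n%:R^-1 * \sum_(1 <= k < n.+1)
    (observation n k w - signal (obs_time n k) theta) ^+ 2.

Definition info_Psi (theta : 'cV[R]_m) : 'M[R]_m :=
  \matrix_(i, j) (\int[lebesgue_measure]_(t in `[0, 1])
    (fine 'E_P[(fun w => (noisy_signal 1 t thetas w - signal t theta) ^+ 2)%R]%E
     * (gradient (signal t) theta *m (gradient (signal t) theta)^T) i j)).

(* The inverse I_M^{-1} itself, not I_M. *)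
Definition asymptotic_covariance (sigma : R) (theta : 'cV[R]_m) : 'M[R]_m :=
  invmx (info_R theta)
    *m (info_Psi theta + sigma ^+ 2 *: info_R theta)
    *m invmx (info_R theta).

Definition score (n : nat) (w : T) : 'cV[R]_m :=
  (Num.sqrt n%:R)^-1 *: \sum_(1 <= k < n.+1)
    (noisy_signal k (obs_time n k) thetas w
       - signal (obs_time n k) thetas + V k w)
    *: gradient (signal (obs_time n k)) thetas.

End model.

(* Main.v *)
(* For each theta <> thetas, minimality against thetas and the law of large
   numbers yield a neighbourhood of theta that the estimator avoids with
   probability tending to 1; compactness of Theta then gives consistency.
   Near thetas, with t = sqrt n (theta - thetas), a second-order Taylor
   expansion of the signal writes n (M_n(theta) - M_n(thetas)) as
   t^T I_R t - 2 t^T S_n + o(|t|^2), where S_n is the normalized score;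
   comparing the minimizer with t = I_R^-1 S_n, the minimizer of the quadratic
   part, and using the coercivity of I_R gives the asymptotic expansion.
   The limit law of S_n is obtained from characteristic functions, with the
   remainder E[x^2 min(1, a |x|)] in place of the Lindeberg term.  Levy's
   continuity theorem is proved by approximating a continuous function on a box
   by a trigonometric polynomial, namely a Bernstein polynomial in the variables
   (1 + sin (x_i / L)) / 2.  The Gaussian characteristic function comes from the
   same estimate applied to the normal law as a sum of n normal laws. *)
Require Import Defs.
From HB Require Import structures.
From mathcomp Require Import all_boot all_order all_algebra.
From mathcomp Require Import finmap.
From mathcomp Require Import all_classical all_reals all_analysis.
From mathcomp Require Import measurable_realfun.
From mathcomp Require Import ring lra.

Set Implicit Arguments.
Unset Strict Implicit.
Unset Printing Implicit Defensive.

Import Order.TTheory GRing.Theory Num.Theory.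
Import numFieldNormedType.Exports.

Local Open Scope classical_set_scope.
Local Open Scope ring_scope.

(** * Expectations *)

(** The observation times k/n change with n, so the errors form a triangular array whose laws vary
    with the row. The regression argument is therefore carried out for an abstract array known only
    through its variance function, its independence within rows and a bound on truncated second
    moments that is uniform over the array. No moment above the second is available, so the Taylor
    remainder of the cosine may be cubic for small arguments only and must stay quadratic for large
    ones. Suprema over theta need not be measurable. Statements that hold for all parameters near a
    point are made off measurable exceptional sets of vanishing probability; such statements form a
    filter, so they combine by intersection, and compactness can be applied to the filter
    transported by the estimator. Complex exponentials are replaced by cosines with an arbitrary
    phase: the phase makes the family stable under products and under adding an independent summand,
    and it recovers the sine. *)

Section expectation.
Context {d : measure_display} {T : measurableType d} {R : realType}.
Variable P : probability T R.

Lemma measurable_ge_set (X : T -> R) (a : R) : measurable_fun setT X ->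
  measurable [set w | a <= X w].
Proof.
move=> mX; rewrite (_ : [set w | _] = X @^-1` [set` `[a, +oo[]); last first.
  by apply/seteqP; split=> w /=; rewrite in_itv/= andbT.
by rewrite -[X in measurable X]setTI; exact: mX.
Qed.

Lemma bounded_integrable (f : T -> R) (M : R) :
  measurable_fun setT f -> (forall x, `|f x| <= M) ->
  P.-integrable setT (EFin \o f).
Proof.
move=> mf fM; apply: measurable_bounded_integrable => //.
  by rewrite (le_lt_trans (probability_le1 _ _))// ltry.
exists M; split; first exact: num_real.
by move=> x Mx y _ /=; rewrite (le_trans (fM y))// ltW.
Qed.

Lemma dominated_integrable (f g : T -> R) :
  measurable_fun setT f -> P.-integrable setT (EFin \o g) ->
  (forall x, `|f x| <= `|g x|) -> P.-integrable setT (EFin \o f).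
Proof.
move=> mf ig fg; apply: (le_integrable _ _ _ ig) => //.
  exact/measurable_EFinP.
by move=> x _ /=; rewrite lee_fin.
Qed.

Lemma measurable_integrable (f : T -> R) :
  P.-integrable setT (EFin \o f) -> measurable_fun setT f.
Proof. by move=> /measurable_int /measurable_EFinP. Qed.

Lemma integrableDr (f g : T -> R) :
  P.-integrable setT (EFin \o f) -> P.-integrable setT (EFin \o g) ->
  P.-integrable setT (EFin \o (fun x => f x + g x)).
Proof. by move=> fi gi; exact: (integrableD _ fi gi). Qed.

Lemma integrableZr (a : R) (f : T -> R) :
  P.-integrable setT (EFin \o f) ->
  P.-integrable setT (EFin \o (fun x => a * f x)).
Proof. by move=> fi; exact: (integrableZl _ a fi). Qed.

Lemma integrableNr (f : T -> R) :
  P.-integrable setT (EFin \o f) ->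
  P.-integrable setT (EFin \o (fun x => - f x)).
Proof. by move=> fi; exact: (integrableN fi). Qed.

Lemma integrable_cstr (a : R) : P.-integrable setT (EFin \o (fun=> a)).
Proof. by apply: (@bounded_integrable _ `|a|). Qed.

Lemma integrable_sumr (I : Type) (s : seq I) (p : pred I) (f : I -> T -> R) :
  (forall i, p i -> P.-integrable setT (EFin \o f i)) ->
  P.-integrable setT (EFin \o (fun x => \sum_(i <- s | p i) f i x)).
Proof.
move=> fi; elim: s => [|i s ih].
  by under [X in EFin \o X]eq_fun do rewrite big_nil; exact: integrable_cstr.
under [X in EFin \o X]eq_fun do rewrite big_cons.
case: (boolP (p i)) => // pi.
by apply: integrableDr => //; exact: fi.
Qed.

Lemma Rintegral_sum (I : Type) (s : seq I) (p : pred I) (f : I -> T -> R) :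
  (forall i, p i -> P.-integrable setT (EFin \o f i)) ->
  \int[P]_x (\sum_(i <- s | p i) f i x) =
  \sum_(i <- s | p i) \int[P]_x f i x.
Proof.
move=> fi; elim: s => [|i s ih].
  rewrite big_nil; under eq_Rintegral do rewrite big_nil.
  by rewrite Rintegral_cst// mul0r.
rewrite big_cons -ih; under eq_Rintegral do rewrite big_cons.
case: (boolP (p i)) => // pi.
by rewrite RintegralD//; [exact: fi|exact: integrable_sumr].
Qed.

Lemma Rintegral_cstP (a : R) : \int[P]_x a = a.
Proof.
rewrite Rintegral_cst// -[RHS]mulr1; congr (_ * _).
exact: (congr1 fine (probability_setT P)).
Qed.

Lemma integral_EFinE (f : T -> R) : P.-integrable setT (EFin \o f) ->
  (\int[P]_x (f x)%:E = (\int[P]_x f x)%:E)%E.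
Proof. by move=> fi; rewrite /Rintegral fineK//; exact: integrable_fin_num. Qed.

Lemma ler_norm_Rintegral (f : T -> R) (M : R) :
  measurable_fun setT f -> (forall x, `|f x| <= M) -> `|\int[P]_x f x| <= M.
Proof.
move=> mf fM; have fi := bounded_integrable mf fM.
apply: (le_trans (le_normr_Rintegral _ fi)) => //.
rewrite -[leRHS]Rintegral_cstP; apply: le_Rintegral => //.
  by apply/(dominated_integrable _ fi) => [|x];
    [exact: measurableT_comp|rewrite normr_id].
exact: integrable_cstr.
Qed.

Lemma markov_real (f : T -> R) (a : R) : 0 < a ->
  P.-integrable setT (EFin \o f) -> (forall x, 0 <= f x) ->
  (P [set x | (a <= f x)%R] <= ((\int[P]_x f x)%R / a)%:E)%E.
Proof.
move=> a0 fi f0.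
have := @le_integral_comp_abse _ _ _ P setT measurableT (EFin \o f) a id
  (@measurable_id _ _ _) (fun _ => id) (fun _ _ _ _ => id)
  (measurable_int _ fi) a0.
rewrite setTI; under eq_set do rewrite /= lee_fin ger0_norm//.
under eq_integral do rewrite /= ger0_norm//.
rewrite integral_EFinE// => h.
by rewrite EFinM muleC lee_pdivlMl.
Qed.

Lemma integrable_square (f : T -> R) : measurable_fun setT f ->
  P.-integrable setT (EFin \o (fun x => f x ^+ 2)) ->
  P.-integrable setT (EFin \o f).
Proof.
move=> mf f2.
apply: (dominated_integrable mf (integrableDr (integrable_cstr 1) f2)) => x.
rewrite [leRHS]ger0_norm ?addr_ge0// ?sqr_ge0//.
by have := sqr_ge0 (`|f x| - 1); rewrite -(real_normK (num_real (f x))); nra.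
Qed.

Lemma integrable_mul (f g : T -> R) :
  measurable_fun setT f -> measurable_fun setT g ->
  P.-integrable setT (EFin \o (fun x => f x ^+ 2)) ->
  P.-integrable setT (EFin \o (fun x => g x ^+ 2)) ->
  P.-integrable setT (EFin \o (fun x => f x * g x)).
Proof.
move=> mf mg f2 g2.
apply: (dominated_integrable _ (integrableDr f2 g2)).
  exact: measurable_funM.
move=> x; rewrite [leRHS]ger0_norm ?addr_ge0// ?sqr_ge0// normrM.
rewrite -(real_normK (num_real (f x))) -(real_normK (num_real (g x))).
by have := sqr_ge0 (`|f x| - `|g x|); have := normr_ge0 (f x);
  have := normr_ge0 (g x); nra.
Qed.

End expectation.

(** * Independence *)

Section independence_functions.
Context {d : measure_display} {T : measurableType d} {R : realType}.
Variable P : probability T R.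

Definition independent_funs (f g : T -> R) : Prop :=
  forall A B : set R, measurable A -> measurable B ->
    P (f @^-1` A `&` g @^-1` B) = (P (f @^-1` A) * P (g @^-1` B))%E.

(** The two variables may live on different spaces, and integrability is transported along with the
    integral. This is how hypotheses on one noise index reach all indices, and how an equality of
    laws becomes an equality of integrals. *)
Lemma eq_Rintegral_distribution {d1 d2 : measure_display}
    {T1 : measurableType d1} {T2 : measurableType d2}
    (Q : probability T1 R) (X : T -> T2) (Y : T1 -> T2) (f : T2 -> R) :
  measurable_fun setT X -> measurable_fun setT Y -> measurable_fun setT f ->
  (forall A, measurable A -> P (X @^-1` A) = Q (Y @^-1` A)) ->
  P.-integrable setT (EFin \o (fun w => f (X w))) ->
  Q.-integrable setT (EFin \o (fun w => f (Y w))) /\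
  \int[P]_w f (X w) = \int[Q]_w f (Y w).
Proof.
move=> mX mY mf XY iX.
pose F : {mfun T >-> T2} := mfun_Sub (mem_set mX).
pose G : {mfun T1 >-> T2} := mfun_Sub (mem_set mY).
pose mF : probability T2 R := distribution P F.
pose mG : probability T2 R := distribution Q G.
have mfe : measurable_fun setT (EFin \o f) by exact/measurable_EFinP.
have eFG (h : T2 -> \bar R) : (\int[mF]_y h y = \int[mG]_y h y)%E.
  by apply: eq_measure_integral => A mA _; exact: XY.
have iY : Q.-integrable setT (EFin \o (fun w => f (Y w))).
  apply/integrableP; split.
    exact/measurable_EFinP/(measurableT_comp mf).
  have /integrableP[_] := iX; congr (_ < _)%E.
  transitivity (\int[mF]_y `|(f y)%:E|)%E.
    rewrite ge0_integral_distribution//.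
    by apply: measurableT_comp => //; exact: mfe.
  rewrite eFG ge0_integral_distribution//.
  by apply: measurableT_comp => //; exact: mfe.
split => //; apply: EFin_inj; rewrite -!integral_EFinE//.
have := eFG (EFin \o f); rewrite !integral_distribution//.
Qed.

(** The joint law of [f] and [g] agrees with the product of their laws on rectangles, hence
    everywhere; Fubini then separates the factors. *)
Lemma Rintegral_independentM (f g : T -> R) :
  P.-integrable setT (EFin \o f) -> P.-integrable setT (EFin \o g) ->
  P.-integrable setT (EFin \o (fun x => f x * g x)) ->
  independent_funs f g ->
  \int[P]_x (f x * g x) = \int[P]_x f x * \int[P]_x g x.
Proof.
move=> fi gi fgi ind.
have mf := measurable_integrable fi; have mg := measurable_integrable gi.
pose F : {mfun T >-> R} := mfun_Sub (mem_set mf).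
pose G : {mfun T >-> R} := mfun_Sub (mem_set mg).
pose H : {mfun T >-> (R * R)%type} :=
  mfun_Sub (mem_set (measurable_fun_pair mf mg)).
pose mF : probability R R := distribution P F.
pose mG : probability R R := distribution P G.
pose mH : probability (R * R)%type R := distribution P H.
have mHE A : measurable A -> (mF \x mG)%E A = mH A.
  by move=> mA; apply: product_measure_unique => // A' B' mA' mB'; exact: ind.
pose k (z : R * R) : \bar R := (z.1 * z.2)%:E.
have mk : measurable_fun setT k.
  by apply/measurable_EFinP; apply: measurable_funM.
have ik : (mF \x mG)%E.-integrable setT k.
  apply: (@eq_integrable _ _ _ _ setT _ k) => //.
  have := @integrable_pushforward _ _ _ _ _ _ (measurable_funPT H) P setT k mk.
  rewrite preimage_setT => /(_ fgi measurableT) /integrableP[_ h].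
  apply/integrableP; split => //.
  by rewrite (@eq_measure_integral _ _ _ _ mH)// => A mA _; exact: mHE.
have e : (\int[P]_x (f x * g x)%:E = \int[mF \x mG]_z k z)%E.
  rewrite (@eq_measure_integral _ _ _ _ mH) => [|A mA _]; last exact: mHE.
  by rewrite integral_distribution.
apply: EFin_inj; rewrite -integral_EFinE// e -integral12_prod_meas1//.
have mE : measurable_fun setT (@EFin R).
  by apply/(measurable_EFinP setT (fun x : R => x)); exact: measurable_id.
have igF : mG.-integrable setT EFin.
  have := @integrable_pushforward _ _ _ _ _ _ (measurable_funPT G) P setT EFin
    mE.
  by apply; rewrite ?preimage_setT.
have ifF : mF.-integrable setT EFin.
  have := @integrable_pushforward _ _ _ _ _ _ (measurable_funPT F) P setT EFin
    mE.
  by apply; rewrite ?preimage_setT.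
have eG : (\int[mG]_y y%:E = (\int[P]_x g x)%:E)%E.
  by rewrite integral_distribution// -integral_EFinE.
have eF : (\int[mF]_y y%:E = (\int[P]_x f x)%:E)%E.
  by rewrite integral_distribution// -integral_EFinE.
under eq_integral => x _.
  rewrite /fubini_F /k /=.
  under eq_integral do rewrite EFinM.
  rewrite integralZl// eG muleC.
  over.
by rewrite integralZl// eF -EFinM mulrC.
Qed.

End independence_functions.

Section sigma_independence.
Context {d : measure_display} {T : measurableType d} {R : realType}.
Variable P : probability T R.

(** For fixed [B], P(A ∩ B) and P(A) P(B) are finite measures in A. They agree on a pi-system
    containing the whole space, hence on the sigma-algebra it generates. *)
Let sigma_independentl (G : set (set T)) (B : set T) :
  setI_closed G -> G setT -> G `<=` measurable -> measurable B ->
  (forall A, G A -> P (A `&` B) = (P A * P B)%E) ->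
  forall A, <<s G >> A -> P (A `&` B) = (P A * P B)%E.
Proof.
move=> GI GT Gm mB GB A GA.
have PB : P B \is a fin_num by exact: fin_num_measure.
pose r : {nonneg R} := NngNum (fine_ge0 (measure_ge0 P B)).
have := @g_sigma_algebra_measure_unique _ _ _ G Gm (fun=> setT) (fun=> GT) _
  (mrestr P mB) (mscale r P) GI _ _ A GA.
have rE C : mscale r P C = (P C * P B)%E.
  by rewrite /mscale/= fineK// muleC.
move=> h; rewrite -rE; apply: h.
- by apply: bigcup_const; exists 0%N.
- by move=> C GC; exact: etrans (GB _ GC) (esym (rE C)).
- move=> _; change (P (setT `&` B) < +oo)%E.
  by rewrite setTI ltey_eq PB.
Qed.

Lemma sigma_independent (G1 G2 : set (set T)) :
  setI_closed G1 -> setI_closed G2 -> G1 setT -> G2 setT ->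
  G1 `<=` measurable -> G2 `<=` measurable ->
  (forall A B, G1 A -> G2 B -> P (A `&` B) = (P A * P B)%E) ->
  forall A B, <<s G1 >> A -> <<s G2 >> B -> P (A `&` B) = (P A * P B)%E.
Proof.
move=> I1 I2 T1 T2 m1 m2 h A B G1A G2B.
have smallm G : G `<=` measurable -> <<s G >> `<=` @measurable _ T.
  by move=> Gm; apply: smallest_sub => //; exact: sigma_algebra_measurable.
apply: (sigma_independentl I1 T1 m1 _ _ G1A) => [|C G1C].
  exact: (smallm _ m2).
rewrite setIC muleC; apply: (sigma_independentl I2 T2 m2 _ _ G2B) => [|D G2D].
  exact: m1.
by rewrite setIC muleC; exact: h.
Qed.

End sigma_independence.

(** * Independence of disjoint blocks of indices for a pair of sequences *)

Section joint_history.
Context {d d1 d2 : measure_display} {T : measurableType d}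
  {T1 : measurableType d1} {T2 : measurableType d2} {R : realType}.
Variables (P : probability T R) (X : nat -> {RV P >-> T1})
  (Y : nat -> {RV P >-> T2}).

(** A pi-system generating the sigma-algebra of the pairs (X_k, Y_k), k in [J]. The sequences are
    kept together because the error of the model at index k depends on both. *)
Definition rectangles (J : {fset nat}) : set (set T) :=
  [set A | exists B C, [/\ forall k : nat, measurable (B k : set T1),
     forall k : nat, measurable (C k : set T2) &
     A = \bigcap_(k in [set` J]) (X k @^-1` B k) `&`
         \bigcap_(k in [set` J]) (Y k @^-1` C k)]].

Lemma rectanglesI J : setI_closed (rectangles J).
Proof.
move=> _ _ [B [C [mB mC ->]]] [B' [C' [mB' mC' ->]]].
exists (fun k => B k `&` B' k), (fun k => C k `&` C' k); split.
- by move=> k; exact: measurableI.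
- by move=> k; exact: measurableI.
- by rewrite setIACA -!bigcapI.
Qed.

Lemma rectanglesT J : rectangles J setT.
Proof.
exists (fun=> setT), (fun=> setT); split => //.
by apply/seteqP; split.
Qed.

Lemma rectangles_measurable J : rectangles J `<=` measurable.
Proof.
move=> _ [B [C [mB mC ->]]]; apply: measurableI.
  by apply: fin_bigcap_measurable => // k _; exact: measurable_funPTI.
by apply: fin_bigcap_measurable => // k _; exact: measurable_funPTI.
Qed.

Lemma rectanglesX J k B : k \in J -> measurable B -> rectangles J (X k @^-1` B).
Proof.
move=> kJ mB; exists (fun j => if j == k then B else setT), (fun=> setT).
split=> [j||]; first by case: ifP.
  by [].
apply/seteqP; split=> [w Bw|w [/(_ k kJ)/=]]; last by rewrite eqxx.
by split=> j _ //=; case: eqP => // ->.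
Qed.

Lemma rectanglesY J k B : k \in J -> measurable B -> rectangles J (Y k @^-1` B).
Proof.
move=> kJ mB; exists (fun=> setT), (fun j => if j == k then B else setT).
split=> [||]; first by [].
  by move=> j; case: ifP.
apply/seteqP; split=> [w Bw|w [_ /(_ k kJ)/=]]; last by rewrite eqxx.
by split=> j _ //=; case: eqP => // ->.
Qed.

Hypotheses (X_ind : mutually_independent X) (Y_ind : mutually_independent Y)
  (YX : independent_sequences Y X).

(** Independence of the two sequences separates the X part from the Y part; mutual independence then
    factors each part over [J]. *)
Let prob_rectangle (J : {fset nat}) B C :
  (forall k : nat, measurable (B k : set T1)) ->
  (forall k : nat, measurable (C k : set T2)) ->
  P (\bigcap_(k in [set` J]) (X k @^-1` B k) `&`
         \bigcap_(k in [set` J]) (Y k @^-1` C k)) =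
  (\prod_(k <- J) P (X k @^-1` B k) * \prod_(k <- J) P (Y k @^-1` C k))%E.
Proof.
move=> mB mC; rewrite -X_ind// -Y_ind// setIC muleC; apply: YX.
  apply: (@fin_bigcap_measurable _ (g_sigma_algebraType
    (\bigcup_k preimage_set_system [set: T] (Y k) measurable))) => // k _.
  apply: sub_sigma_algebra; exists k => //.
  by exists (C k); rewrite ?setTI.
apply: (@fin_bigcap_measurable _ (g_sigma_algebraType
  (\bigcup_k preimage_set_system [set: T] (X k) measurable))) => // k _.
apply: sub_sigma_algebra; exists k => //.
by exists (B k); rewrite ?setTI.
Qed.

(** A rectangle over [J] meets one over [K] in a rectangle over the union, whose probability is a
    product over all its indices. Independence on these pi-systems extends to the sigma-algebras. *)
Lemma rectangles_independent (J K : {fset nat}) : [disjoint J & K]%fset ->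
  forall A B, <<s rectangles J >> A -> <<s rectangles K >> B ->
  P (A `&` B) = (P A * P B)%E.
Proof.
move=> JK; apply: sigma_independent; try exact: rectanglesI;
  try exact: rectanglesT; try exact: rectangles_measurable.
move=> _ _ [B [C [mB mC ->]]] [B' [C' [mB' mC' ->]]].
have notJ k : k \in K -> (k \in J) = false.
  by move=> kK; apply: contraTF JK => kJ; apply/fdisjointP => /(_ k kJ); rewrite kK.
pose B2 k := if k \in J then B k else B' k.
pose C2 k := if k \in J then C k else C' k.
have -> : \bigcap_(k in [set` J]) (X k @^-1` B k) `&`
         \bigcap_(k in [set` J]) (Y k @^-1` C k) `&`
   (\bigcap_(k in [set` K]) (X k @^-1` B' k) `&`
         \bigcap_(k in [set` K]) (Y k @^-1` C' k)) =
   \bigcap_(k in [set` (J `|` K)%fset]) (X k @^-1` B2 k) `&`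
         \bigcap_(k in [set` (J `|` K)%fset]) (Y k @^-1` C2 k).
  apply/seteqP; split=> w.
    move=> [[hB hC] [hB' hC']]; split=> k /=; rewrite in_fsetU /B2 /C2.
      by case: ifPn => kJ /= => [_|kK]; [exact: hB|exact: hB'].
    by case: ifPn => kJ /= => [_|kK]; [exact: hC|exact: hC'].
  move=> [hB hC]; split; split=> k /= kJ.
  - by have := hB k; rewrite /= in_fsetU /B2 kJ => /(_ isT).
  - by have := hC k; rewrite /= in_fsetU /C2 kJ => /(_ isT).
  - by have := hB k; rewrite /= in_fsetU /B2 kJ (notJ _ kJ) => /(_ isT).
  - by have := hC k; rewrite /= in_fsetU /C2 kJ (notJ _ kJ) => /(_ isT).
rewrite !prob_rectangle//; last 2 first.
- by move=> k; rewrite /B2; case: ifP.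
- by move=> k; rewrite /C2; case: ifP.
have JKperm : perm_eq (enum_fset (J `|` K)%fset) (enum_fset J ++ enum_fset K).
  apply: uniq_perm; first exact: fset_uniq.
    rewrite cat_uniq !fset_uniq andbT/=.
    by apply/hasPn => k kK; rewrite /= (notJ _ kK).
  by move=> k; rewrite mem_cat in_fsetU.
rewrite !(perm_big _ JKperm)/= !big_cat/= muleACA.
by congr (_ * _ * (_ * _))%E; apply: eq_big_seq => k kJ;
  rewrite /B2 /C2 ?kJ ?(notJ _ kJ).
Qed.

End joint_history.

Section history_functions.
Context {d d1 d2 : measure_display} {T : measurableType d}
  {T1 : measurableType d1} {T2 : measurableType d2} {R : realType}.
Variables (P : probability T R) (X : nat -> {RV P >-> T1})
  (Y : nat -> {RV P >-> T2}).

(** A second measurable structure on the same carrier: depending on the indices in [J] alone becomes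
    ordinary measurability, which is stable under sums and compositions. *)
Definition history (J : {fset nat}) := g_sigma_algebraType (rectangles X Y J).

Lemma history_measurableX J k (h : T1 -> R) : k \in J ->
  measurable_fun setT h ->
  measurable_fun [set: history J] (fun w => h (X k w)).
Proof.
move=> kJ mh _ A mA; rewrite setTI; apply: sub_sigma_algebra.
rewrite (_ : _ @^-1` _ = X k @^-1` (h @^-1` A))//; apply: rectanglesX => //.
by rewrite -[X in measurable X]setTI; exact: mh.
Qed.

Lemma history_measurableY J k (h : T2 -> R) : k \in J ->
  measurable_fun setT h ->
  measurable_fun [set: history J] (fun w => h (Y k w)).
Proof.
move=> kJ mh _ A mA; rewrite setTI; apply: sub_sigma_algebra.
rewrite (_ : _ @^-1` _ = Y k @^-1` (h @^-1` A))//; apply: rectanglesY => //.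
by rewrite -[X in measurable X]setTI; exact: mh.
Qed.

Lemma history_independent (J K : {fset nat}) (f g : T -> R) :
  mutually_independent X -> mutually_independent Y ->
  independent_sequences Y X -> [disjoint J & K]%fset ->
  measurable_fun [set: history J] f -> measurable_fun [set: history K] g ->
  independent_funs P f g.
Proof.
move=> iX iY iYX JK mf mg A B mA mB.
apply: (rectangles_independent iX iY iYX JK).
  by rewrite -[X in <<s _ >> X]setTI; exact: mf.
by rewrite -[X in <<s _ >> X]setTI; exact: mg.
Qed.

End history_functions.

Lemma independent_funs_comp d (T : measurableType d) (R : realType)
    (P : probability T R) (f g : T -> R) (h k : R -> R) :
  measurable_fun setT h -> measurable_fun setT k ->
  independent_funs P f g -> independent_funs P (h \o f) (k \o g).
Proof.
move=> mh mk fg A B mA mB.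
by apply: (fg (h @^-1` A) (k @^-1` B)); rewrite -[X in measurable X]setTI;
  [exact: mh|exact: mk].
Qed.

(** * Characteristic functions of sums *)

Section taylor_bounds.
Context {R : realType}.
Implicit Types x y v : R.

Lemma ler_norm_sin y : `|sin y| <= `|y|.
Proof.
have key (z : R) : 0 <= z -> `|sin z| <= z.
  move=> z0; have [c _] := @MVT_segment R sin cos 0 z z0
    (fun x _ => is_derive_sin x) (continuous_subspaceT (@continuous_sin R)).
  rewrite sin0 !subr0 => ->; rewrite normrM (ger0_norm z0) ler_piMl//.
  by rewrite ler_norml cos_geN1 cos_le1.
have [y0|y0] := leP 0 y; first by rewrite (ger0_norm y0) key.
by rewrite -normrN -sinN (ltr0_norm y0) key// oppr_ge0 ltW.
Qed.

Lemma cos_half y : 1 - cos y = 2 * sin (y / 2) ^+ 2.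
Proof.
rewrite [in LHS](splitr y) cosD -!expr2.
by have := cos2Dsin2 (y / 2); lra.
Qed.

Lemma ler_1Bcos y : 0 <= 1 - cos y <= y ^+ 2 / 2.
Proof.
rewrite subr_ge0 cos_le1/= cos_half.
have := ler_norm_sin (y / 2).
rewrite -(@ler_pXn2r _ 2) ?nnegrE// ?real_normK ?num_real//.
lra.
Qed.

Lemma ler_Bsin y : `|y - sin y| <= `|y| ^+ 3 / 2.
Proof.
have key (z : R) : 0 <= z -> `|z - sin z| <= z ^+ 3 / 2.
  move=> z0; have dB x : x \in `]0, z[ -> is_derive x 1 (id - sin) (1 - cos x).
    by move=> _; exact: is_deriveB.
  have [|c] := @MVT_segment R _ _ 0 z z0 dB.
    apply: continuous_subspaceT => x.
    by apply: continuousB; [exact: cvg_id|exact: continuous_sin].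
  rewrite in_itv/= => /andP[c0 cz].
  rewrite !fctE sin0 !subr0 => ->; rewrite normrM (ger0_norm z0).
  have /andP[h1 h2] := ler_1Bcos c; rewrite ger0_norm//.
  have : (1 - cos c) * z <= z ^+ 2 / 2 * z.
    by apply: ler_wpM2r => //; apply: (le_trans h2); rewrite ler_pM2r// ler_sqr.
  lra.
have [y0|y0] := leP 0 y; first by rewrite (ger0_norm y0) key.
rewrite -normrN opprB addrC -{1}(opprK y) -{2}(opprK y) sinN.
rewrite (ltr0_norm y0) opprK; have := key (- y).
by apply; rewrite oppr_ge0 ltW.
Qed.

(** The scale [a] is kept as a parameter so that a weight can be pulled out of the argument, as in
    [trunc_sqrZ]: the weight of a normalized sum becomes a small scale. *)
Definition trunc_sqr (a y : R) := y ^+ 2 * Num.min 1 (a * `|y|).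

(** The addition formula reduces the remainder to those of [cos y] and [sin y]. Each has a bound for
    large |y| (y^2 / 2 and 2 |y|) and one for small |y| (y^4 / 8 and |y|^3 / 2); their sums stay
    below 3 y^2 and 3 |y|^3 respectively. *)
Lemma cos_taylor2 x y :
  `|cos (x + y) - cos x + y * sin x + y ^+ 2 / 2 * cos x| <=
  3 * trunc_sqr 1 y.
Proof.
have -> : cos (x + y) - cos x + y * sin x + y ^+ 2 / 2 * cos x =
    cos x * (y ^+ 2 / 2 - (1 - cos y)) + sin x * (y - sin y).
  by rewrite cosD; ring.
apply: (le_trans (ler_normD _ _)); rewrite !normrM.
have c1 : `|cos x| <= 1 by rewrite ler_norml cos_geN1 cos_le1.
have s1 : `|sin x| <= 1 by rewrite ler_norml sin_geN1 sin_le1.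
have /andP[h1 h2] := ler_1Bcos y.
have h3 := ler_Bsin y.
have h4 : `|y - sin y| <= 2 * `|y|.
  by have := ler_norm_sin y; have := ler_normB y (sin y); lra.
have h5 : `|y ^+ 2 / 2 - (1 - cos y)| <= `|y| ^+ 4 / 8.
  have -> : y ^+ 2 / 2 - (1 - cos y) =
     2 * ((y / 2 - sin (y / 2)) * (y / 2 + sin (y / 2))).
    by rewrite cos_half; field.
  rewrite normrM ger0_norm// normrM.
  have h6 := ler_Bsin (y / 2).
  have h7 : `|y / 2 + sin (y / 2)| <= 2 * `|y / 2|.
    have := ler_norm_sin (y / 2); have := ler_normD (y / 2) (sin (y / 2)); lra.
  have := ler_pM (normr_ge0 _) (normr_ge0 _) h6 h7.
  rewrite normrM (@ger0_norm _ (2^-1))//; lra.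
have h6 : `|y ^+ 2 / 2 - (1 - cos y)| <= `|y| ^+ 2 / 2.
  by rewrite (real_normK (num_real y)) ger0_norm; lra.
apply: (@le_trans _ _ (`|y ^+ 2 / 2 - (1 - cos y)| + `|y - sin y|)).
  by apply: lerD; rewrite ler_piMl.
rewrite /trunc_sqr mul1r -[X in 3 * (X * _)](real_normK (num_real y)).
move: (normr_ge0 y) h3 h4 h5 h6; move: `|y| `|y - _| `|_ - (1 - _)|.
move=> a b c a0 h3 h4 h5 h6; have [a1|a1] := leP 1 a.
  have : a <= a ^+ 2 by rewrite expr2 ler_peMl.
  lra.
have : a ^+ 4 <= a ^+ 3 by rewrite [leLHS]exprS ler_piMl ?exprn_ge0// ltW.
have : 0 <= a ^+ 3 by rewrite exprn_ge0.
have -> : a ^+ 2 * a = a ^+ 3 by ring.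
lra.
Qed.

Lemma expRN_taylor1 v : 0 <= v -> `|expR (- v) - 1 + v| <= v ^+ 2.
Proof.
move=> v0; have h1 := expR_ge1Dx (- v); have h2 := expR_ge1Dx v.
rewrite ger0_norm; last by lra.
have : expR (- v) * expR v = 1 by rewrite -expRD addNr expR0.
by have := expR_gt0 (- v); nra.
Qed.

End taylor_bounds.

Section trunc_sqr_theory.
Context {R : realType}.
Implicit Types a y : R.

Lemma trunc_sqr_ge0 a y : 0 <= a -> 0 <= trunc_sqr a y.
Proof.
by move=> a0; rewrite mulr_ge0// ?sqr_ge0// le_min ler01 mulr_ge0.
Qed.

Lemma trunc_sqr_le_sqr a y : trunc_sqr a y <= y ^+ 2.
Proof. by rewrite ler_piMr ?sqr_ge0// ge_min lexx. Qed.

Lemma trunc_sqrZ c y : trunc_sqr 1 (c * y) = c ^+ 2 * trunc_sqr `|c| y.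
Proof. by rewrite /trunc_sqr mul1r normrM exprMn mulrA. Qed.

Lemma measurable_trunc_sqr a : measurable_fun [set: R] (trunc_sqr a).
Proof.
apply: measurable_funM; first exact: measurable_funX.
by apply: measurable_minr => //; exact: measurable_funM.
Qed.

Lemma measurable_cos : measurable_fun [set: R] (@cos R).
Proof. apply: continuous_measurable_fun; exact: continuous_cos. Qed.

Lemma measurable_sin : measurable_fun [set: R] (@sin R).
Proof. apply: continuous_measurable_fun; exact: continuous_sin. Qed.

Lemma normr_cos_le1 y : `|cos y| <= 1.
Proof. by rewrite ler_norml cos_geN1 cos_le1. Qed.

Lemma normr_sin_le1 y : `|sin y| <= 1.
Proof. by rewrite ler_norml sin_geN1 sin_le1. Qed.

End trunc_sqr_theory.

Section characteristic_function_bound.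
Context {d : measure_display} {T : measurableType d} {R : realType}.
Variable P : probability T R.
Implicit Types (X S : T -> R) (s x : R).

Lemma integrable_cos X : measurable_fun setT X ->
  P.-integrable setT (EFin \o (fun w => cos (X w))).
Proof.
move=> mX; apply: (@bounded_integrable _ _ _ _ _ 1).
  exact: (measurableT_comp measurable_cos).
by move=> w; exact: normr_cos_le1.
Qed.

Lemma integrable_sin X : measurable_fun setT X ->
  P.-integrable setT (EFin \o (fun w => sin (X w))).
Proof.
move=> mX; apply: (@bounded_integrable _ _ _ _ _ 1).
  exact: (measurableT_comp measurable_sin).
by move=> w; exact: normr_sin_le1.
Qed.

Lemma integrable_trunc_sqr a X : 0 <= a -> measurable_fun setT X ->
  P.-integrable setT (EFin \o (fun w => X w ^+ 2)) ->
  P.-integrable setT (EFin \o (fun w => trunc_sqr a (X w))).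
Proof.
move=> a0 mX X2; apply: (dominated_integrable _ X2).
  exact: (measurableT_comp (measurable_trunc_sqr a)).
move=> w; rewrite !ger0_norm ?sqr_ge0 ?trunc_sqr_ge0//.
exact: trunc_sqr_le_sqr.
Qed.

Lemma Rintegral_cosD X y : measurable_fun setT X ->
  \int[P]_w cos (y + X w) =
  cos y * \int[P]_w cos (X w) - sin y * \int[P]_w sin (X w).
Proof.
move=> mX; under eq_Rintegral do rewrite cosD.
rewrite RintegralB//; last 2 first.
- exact/integrableZr/integrable_cos.
- exact/integrableZr/integrable_sin.
by rewrite !RintegralZl//; [exact: integrable_sin|exact: integrable_cos].
Qed.

(** Integrating [cos_taylor2], the linear term vanishes by centering and the quadratic one becomes
    -(s/2) cos x, which is also the first-order term of the Gaussian factor. The two remainders add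
    up to the bound. *)
Lemma char_fun_local X s x : measurable_fun setT X ->
  P.-integrable setT (EFin \o (fun w => X w ^+ 2)) ->
  \int[P]_w X w = 0 -> \int[P]_w (X w ^+ 2) = s ->
  `|\int[P]_w cos (x + X w) - expR (- (s / 2)) * cos x| <=
  3 * \int[P]_w trunc_sqr 1 (X w) + s ^+ 2.
Proof.
move=> mX X2 EX EX2.
have iX := integrable_square mX X2.
have s0 : 0 <= s by rewrite -EX2; apply: Rintegral_ge0 => w _; exact: sqr_ge0.
have ic : P.-integrable setT (EFin \o (fun w => cos (x + X w))).
  by apply: integrable_cos; exact: measurable_funD.
have i1 := integrableZr (sin x) iX.
have i2 := integrableZr (cos x / 2) X2.
have i3 := integrableDr ic (integrable_cstr P (- cos x)).
have i4 := integrableDr i3 i1.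
have i5 := integrableDr i4 i2.
have E : \int[P]_w (cos (x + X w) - cos x + sin x * X w + cos x / 2 * X w ^+ 2)
   = \int[P]_w cos (x + X w) - cos x + s / 2 * cos x.
  rewrite RintegralD// RintegralD// RintegralD//; last exact: integrable_cstr.
  by rewrite Rintegral_cstP RintegralZl// RintegralZl// EX EX2; lra.
have -> : \int[P]_w cos (x + X w) - expR (- (s / 2)) * cos x =
  \int[P]_w (cos (x + X w) - cos x + sin x * X w + cos x / 2 * X w ^+ 2) +
  - (expR (- (s / 2)) - 1 + s / 2) * cos x by rewrite E; ring.
apply: (le_trans (ler_normD _ _)); apply: lerD.
  apply: (le_trans (le_normr_Rintegral _ i5)) => //.
  have it := integrable_trunc_sqr ler01 mX X2.
  rewrite -RintegralZl//; apply: le_Rintegral => //.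
  - apply: (dominated_integrable _ i5); last by move=> w; rewrite normr_id.
    by apply: measurableT_comp => //; exact: (measurable_integrable i5).
  - exact: integrableZr.
  - move=> w _; apply: le_trans (cos_taylor2 x (X w)).
    by rewrite (_ : _ + cos x / 2 * _ = cos (x + X w) - cos x + X w * sin x +
      X w ^+ 2 / 2 * cos x)//; field.
rewrite normrM normrN; apply: (@le_trans _ _ ((s / 2) ^+ 2 * 1)).
  apply: ler_pM => //; last exact: normr_cos_le1.
  by apply: expRN_taylor1; rewrite divr_ge0.
by rewrite mulr1 exprMn ler_piMr ?sqr_ge0//; lra.
Qed.

(** With the value of [S] frozen this is [char_fun_local] at phase [x + S w]. The freezing is done
    by the addition formula: it yields products of a function of [S] and a function of [X], so
    independence replaces the second factor by its mean inside the integral over [S]. *)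
Lemma char_fun_step S X s x : measurable_fun setT S -> measurable_fun setT X ->
  P.-integrable setT (EFin \o (fun w => X w ^+ 2)) ->
  \int[P]_w X w = 0 -> \int[P]_w (X w ^+ 2) = s ->
  independent_funs P S X ->
  `|\int[P]_w cos (x + (S w + X w)) -
      expR (- (s / 2)) * \int[P]_w cos (x + S w)| <=
  3 * \int[P]_w trunc_sqr 1 (X w) + s ^+ 2.
Proof.
move=> mS mX X2 EX EX2 SX.
pose A := \int[P]_w cos (X w); pose B := \int[P]_w sin (X w).
have mxS : measurable_fun setT (fun w => x + S w) by exact: measurable_funD.
have AB y := Rintegral_cosD y mX.
have ibM (h k : R -> R) : measurable_fun setT h -> measurable_fun setT k ->
    (forall y, `|h y| <= 1) -> (forall y, `|k y| <= 1) ->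
    P.-integrable setT (EFin \o (fun w => h (x + S w) * k (X w))) /\
    \int[P]_w (h (x + S w) * k (X w)) =
      \int[P]_w h (x + S w) * \int[P]_w k (X w).
  move=> mh mk h1 k1.
  have mhS : measurable_fun setT (fun w => h (x + S w)).
    exact: (measurableT_comp mh).
  have mkX : measurable_fun setT (fun w => k (X w)).
    exact: (measurableT_comp mk).
  have ip : P.-integrable setT (EFin \o (fun w => h (x + S w) * k (X w))).
    apply: (@bounded_integrable _ _ _ _ _ 1); first exact: measurable_funM.
    by move=> w; rewrite normrM mulr_ile1.
  split => //; apply: Rintegral_independentM => //.
  - exact: bounded_integrable mhS (fun w => h1 _).
  - exact: bounded_integrable mkX (fun w => k1 _).
  apply: (@independent_funs_comp _ _ _ _ _ _ (fun y => h (x + y)) k) => //.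
  by apply: (measurableT_comp mh); exact: measurable_funD.
have [ic ec] := ibM _ _ measurable_cos measurable_cos
  (@normr_cos_le1 _) (@normr_cos_le1 _).
have [is_ es] := ibM _ _ measurable_sin measurable_sin
  (@normr_sin_le1 _) (@normr_sin_le1 _).
have icS := integrable_cos mxS; have isS := integrable_sin mxS.
have -> : \int[P]_w cos (x + (S w + X w)) -
      expR (- (s / 2)) * \int[P]_w cos (x + S w) =
  \int[P]_w (cos (x + S w) * A - sin (x + S w) * B
     - expR (- (s / 2)) * cos (x + S w)).
  under eq_Rintegral do rewrite addrA cosD.
  rewrite RintegralB// ec es.
  have iA : P.-integrable setT (EFin \o (fun w => cos (x + S w) * A)).
    by under [X in EFin \o X]eq_fun do rewrite mulrC; exact: integrableZr.
  have iB : P.-integrable setT (EFin \o (fun w => sin (x + S w) * B)).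
    by under [X in EFin \o X]eq_fun do rewrite mulrC; exact: integrableZr.
  rewrite RintegralB//; last 2 first.
  - exact: integrableDr iA (integrableNr iB).
  - exact: integrableZr.
  by rewrite RintegralB// !RintegralZr// RintegralZl.
apply: ler_norm_Rintegral.
  apply: measurable_funB; last first.
    apply: measurable_funM => //; exact: (measurableT_comp measurable_cos).
  apply: measurable_funB; apply: measurable_funM => //.
    exact: (measurableT_comp measurable_cos).
  exact: (measurableT_comp measurable_sin).
by move=> w; rewrite -AB; exact: char_fun_local.
Qed.

(** Summands are replaced one at a time by their Gaussian factors. These are at most 1, so earlier
    errors do not grow and the total is the sum of the one-step errors. *)
Lemma char_fun_sum (X : nat -> T -> R) (s : nat -> R) n x :
  (forall k, (k < n)%N -> measurable_fun setT (X k)) ->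
  (forall k, (k < n)%N ->
     P.-integrable setT (EFin \o (fun w => X k w ^+ 2))) ->
  (forall k, (k < n)%N -> \int[P]_w X k w = 0) ->
  (forall k, (k < n)%N -> \int[P]_w (X k w ^+ 2) = s k) ->
  (forall k, (k < n)%N ->
     independent_funs P (fun w => \sum_(i < k) X i w) (X k)) ->
  `|\int[P]_w cos (x + \sum_(k < n) X k w) -
      expR (- ((\sum_(k < n) s k) / 2)) * cos x| <=
  \sum_(k < n) (3 * \int[P]_w trunc_sqr 1 (X k w) + s k ^+ 2).
Proof.
elim: n => [|n ih] mX X2 EX EX2 iX.
  under eq_Rintegral do rewrite big_ord0 addr0.
  rewrite !big_ord0 Rintegral_cstP mul0r oppr0 expR0 mul1r subrr.
  by rewrite normr0.
have {}ih := ih (fun k kn => mX k (ltnW kn)) (fun k kn => X2 k (ltnW kn))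
  (fun k kn => EX k (ltnW kn)) (fun k kn => EX2 k (ltnW kn))
  (fun k kn => iX k (ltnW kn)).
under eq_Rintegral do rewrite big_ord_recr/=.
rewrite !big_ord_recr/=.
have mS : measurable_fun setT (fun w => \sum_(i < n) X i w).
  by apply: measurable_sum => i; apply: mX; rewrite ltnS ltnW.
have st := @char_fun_step _ _ (s n) x mS (mX n (ltnSn n)) (X2 n (ltnSn n))
  (EX n (ltnSn n)) (EX2 n (ltnSn n)) (iX n (ltnSn n)).
have sn0 : 0 <= s n.
  by rewrite -EX2//; apply: Rintegral_ge0 => w _; exact: sqr_ge0.
rewrite mulrDl opprD expRD.
rewrite [X in `|X|](_ : _ =
  \int[P]_x0 cos (x + (\sum_(i < n) X i x0 + X n x0)) -
  expR (- (s n / 2)) * \int[P]_x0 cos (x + \sum_(i < n) X i x0)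
  + expR (- (s n / 2)) * (\int[P]_w cos (x + \sum_(k < n) X k w) -
     expR (- ((\sum_(k < n) s k) / 2)) * cos x)); last by ring.
apply: (le_trans (ler_normD _ _)); rewrite [leRHS]addrC; apply: lerD => //.
rewrite normrM; apply: le_trans ih.
by rewrite ler_piMl// ger0_norm ?expR_ge0// -expR0 ler_expR oppr_le0 divr_ge0.
Qed.

End characteristic_function_bound.

(** * The normal law *)

Section trunc_limit.
Context {d : measure_display} {T : measurableType d} {R : realType}.
Variable P : probability T R.

(** Dominated convergence along a = 1/(n+1), with dominating function X^2; monotonicity in [a]
    covers all smaller scales. *)
Lemma trunc_sqr_small (X : T -> R) e : 0 < e -> measurable_fun setT X ->
  P.-integrable setT (EFin \o (fun w => X w ^+ 2)) ->
  exists2 a0 : R, 0 < a0 & forall a, 0 <= a -> a <= a0 ->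
    \int[P]_w trunc_sqr a (X w) <= e.
Proof.
move=> e0 mX X2.
pose f n w : \bar R := (trunc_sqr n.+1%:R^-1 (X w))%:E.
have mf n : measurable_fun setT (f n).
  apply/measurable_EFinP.
  exact: (measurableT_comp (measurable_trunc_sqr _)).
have := @dominated_convergence _ _ _ P setT measurableT f (cst 0%E)
  (EFin \o (fun w => X w ^+ 2)) mf (measurable_cst _).
case=> [|//||_ _].
- apply/aeW => w _; apply: cvg_EFin; first by apply: nearW.
  have h : (fun n : nat => n.+1%:R^-1 * `|X w|) @ \oo --> (0 : R).
    rewrite -[0](mul0r `|X w|); apply: cvgMl; exact: cvg_harmonic.
  rewrite /= -[X in _ --> X](mulr0 (X w ^+ 2)).
  apply: cvgM; first exact: cvg_cst.
  apply: (squeeze_cvgr _ (cvg_cst 0) h).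
  by near=> n; rewrite le_min ler01 mulr_ge0//= ge_min lexx orbT.
- apply/aeW => w n _; rewrite lee_fin ger0_norm ?trunc_sqr_le_sqr//.
  exact: trunc_sqr_ge0.
rewrite integral0 => /fine_cvgP[_] /cvgr0Pnorm_le /(_ e e0)[n _ /(_ n (leqnn n))].
move=> h; exists n.+1%:R^-1 => [|a a0 an]; first by rewrite invr_gt0.
apply: le_trans h; apply: le_trans (ler_norm _).
apply: le_Rintegral => //.
- exact: integrable_trunc_sqr.
- exact: integrable_trunc_sqr.
- move=> w _; apply: ler_wpM2l; first exact: sqr_ge0.
  by rewrite le_min ge_min lexx/= ge_min ler_wpM2r ?orbT.
Unshelve. all: end_near. Qed.

End trunc_limit.

Section gaussian.
Context {R : realType}.
Implicit Types (m a b s x y z : R) (A : set R).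
Local Notation mu := (@lebesgue_measure R).
Local Notation N01 := (@normal_prob R 0 1).

Lemma measurable_affine m b : measurable_fun [set: R] (fun z => m + b * z).
Proof. by apply: measurable_funD => //; exact: measurable_funM. Qed.

(** The image of Lebesgue measure under the affine map, multiplied by |b|, gives half-open intervals
    their length, so it is Lebesgue measure. A negative [b] swaps the closed and the open end
    point. *)
Lemma ge0_integral_affine m b (f : R -> \bar R) : b != 0 ->
  measurable_fun setT f -> (forall x, (0 <= f x)%E) ->
  (\int[mu]_x f x = `|b|%:E * \int[mu]_z f (m + b * z)%R)%E.
Proof.
move=> b0 mf f0; have mphi := measurable_affine m b.
pose nu : {measure set (measurableTypeR R) -> \bar R} :=
  @measure_function_pushforward__canonical__measure_function_Measure _ _
    (measurableTypeR R) (measurableTypeR R) R mu (fun z : R => m + b * z) mphi.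
pose r : {nonneg R} := NngNum (normr_ge0 b).
have rmu : forall A : set (measurableTypeR R), measurable A -> mu A = mscale r nu A.
  apply: (@lebesgue_measure_unique R (mscale r nu)) => _ [[u v] _ <-] /=.
  rewrite /mscale/= /pushforward lebesgue_measure_itv/=.
  have [bp|bn|b00] := ltgtP b 0; last by rewrite b00 eqxx in b0.
  - have -> : (fun z => m + b * z) @^-1` `]u, v] =
       [set` `[(v - m) / b, (u - m) / b[].
      apply/seteqP; split => z /=; rewrite !in_itv/= ler_ndivrMr// ltr_ndivlMr//;
      by rewrite ltrBlDl lerBrDl (mulrC z) andbC.
    rewrite lebesgue_measure_itv/= !lte_fin ltr_ndivlMr// divfK ?lt_eqF//.
    rewrite ltrD2r; case: ifPn => uv; rewrite ?mule0//.
    by rewrite -!EFinD -EFinM (ltr0_norm bp); congr EFin; field; rewrite lt_eqF.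
  - have -> : (fun z => m + b * z) @^-1` `]u, v] =
       [set` `](u - m) / b, (v - m) / b]].
      apply/seteqP; split => z /=; rewrite !in_itv/= ltr_pdivrMr// ler_pdivlMr//;
      by rewrite ltrBlDl lerBrDl (mulrC z).
    rewrite lebesgue_measure_itv/= !lte_fin ltr_pdivrMr// divfK ?gt_eqF//.
    rewrite ltrD2r; case: ifPn => uv; rewrite ?mule0//.
    by rewrite -!EFinD -EFinM (gtr0_norm bn); congr EFin; field; rewrite gt_eqF.
rewrite (@eq_measure_integral _ _ _ _ (mscale r nu)) => [|A mA _]; last exact: rmu.
rewrite ge0_integral_mscale//; congr (_ * _)%E.
by rewrite ge0_integral_pushforward ?preimage_setT.
Qed.

Lemma normal_prob_affine m b A : b != 0 -> measurable A ->
  N01 [set z | A (m + b * z)] = normal_prob m b A.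
Proof.
move=> b0 mA; rewrite /normal_prob [RHS]integral_mkcond [LHS]integral_mkcond.
have mr : measurable_fun [set: R] ((fun x : R => (normal_pdf m b x)%:E) \_ A).
  apply/(measurable_restrictT _ mA).
  by apply/measurable_EFinP; apply: measurable_funTS; exact: measurable_normal_pdf.
have mr' := measurableT_comp mr (measurable_affine m b).
have r0 x : (0 <= ((fun x : R => (normal_pdf m b x)%:E) \_ A) x)%E.
  by rewrite patchE; case: ifP => // _; rewrite lee_fin normal_pdf_ge0.
rewrite [RHS](ge0_integral_affine m b0)// -ge0_integralZl_EFin//.
apply: eq_integral => z _; rewrite !patchE.
have -> : (z \in [set z | A (m + b * z)]) = (m + b * z \in A).
  by apply/idP/idP; rewrite !inE.
case: ifP => _; last by rewrite mule0.
rewrite -EFinM; congr EFin; rewrite !normal_pdfE ?oner_eq0//.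
rewrite /normal_peak /normal_fun mulrA; congr (_ * expR _); last first.
  by rewrite expr1n; field; rewrite b0.
rewrite expr1n mul1r -mulrnAr sqrtrM ?sqr_ge0// sqrtr_sqr invfM mulrA.
by rewrite mulfV ?normr_eq0// mul1r.
Qed.

Lemma measurable_idR : measurable_fun [set: measurableTypeR R] (fun x => x : R).
Proof. exact: measurable_id. Qed.

(* The standard normal law, moved from [measurableTypeR R] to [R]. *)
Definition std_normal : probability R R :=
  distribution (normal_prob 0 1 : probability (measurableTypeR R) R)
    (@mfun_Sub _ _ (measurableTypeR R) R _ (mem_set measurable_idR)).
Local Notation N := std_normal.

Lemma std_normal_affine m b A : b != 0 -> measurable A ->
  N [set z | A (m + b * z)] = normal_prob m b A.
Proof. exact: normal_prob_affine. Qed.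

(** The Radon-Nikodym derivative of the normal law and [normal_pdf] have the same integral over
    every measurable set, so they agree almost everywhere. *)
Lemma integral_normal_prob (f : R -> R) (M : R) : measurable_fun setT f ->
  (forall x, `|f x| <= M) ->
  (\int[N]_x (f x)%:E = \int[mu]_x (f x * normal_pdf 0 1 x)%:E)%E.
Proof.
move=> mf fM.
have fi := bounded_integrable (normal_prob 0 1 : probability _ _) mf fM.
rewrite integral_distribution//; last exact/measurable_EFinP.
rewrite /comp/=.
have dom := @normal_prob_dominates R 0 1.
rewrite -(Radon_Nikodym_change_of_variables dom)//=.
under [RHS]eq_integral do rewrite EFinM.
have mp : measurable_fun setT (fun x : R => (normal_pdf 0 1 x)%:E).
  by apply/measurable_EFinP; exact: measurable_normal_pdf.
have mf' : measurable_fun setT (fun x : R => (f x)%:E) by apply/measurable_EFinP.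
apply: ae_eq_integral => //.
- exact: emeasurable_funM.
- exact: emeasurable_funM.
- apply: ae_eqe_mul2l => /=.
  rewrite Radon_NikodymE//=.
  case: cid => /= h [h1 h2 h3].
  by apply: integral_ae_eq => //= E E01 mE; rewrite -h3.
Qed.

Lemma normal_prob_sqr m b b' A : b ^+ 2 = b' ^+ 2 -> b != 0 ->
  normal_prob m b A = normal_prob m b' A.
Proof.
move=> bb' b0; have b0' : b' != 0 by rewrite -sqrf_eq0 -bb' sqrf_eq0.
rewrite /normal_prob; apply: eq_integral => x _.
by rewrite !normal_pdfE// /normal_peak /normal_fun bb'.
Qed.

(** Bayes' formula for independent standard normal Z, W: the density of Z times the conditional
    density of aZ + bW equals the density of aZ + bW times the conditional density of Z. The
    exponents match by completing the square. *)
Lemma normal_pdf_sum a b y z : b != 0 ->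
  normal_pdf 0 1 z * normal_pdf (a * z) b y =
  normal_pdf 0 (Num.sqrt (a ^+ 2 + b ^+ 2)) y *
  normal_pdf (a / (a ^+ 2 + b ^+ 2) * y) (b / Num.sqrt (a ^+ 2 + b ^+ 2)) z.
Proof.
move=> b0; set s2 := a ^+ 2 + b ^+ 2.
have b2 : 0 < b ^+ 2 by rewrite exprn_even_gt0.
have s20 : 0 < s2 by rewrite ltr_wpDl// sqr_ge0.
have s0 : Num.sqrt s2 != 0 by rewrite gt_eqF// sqrtr_gt0.
rewrite !normal_pdfE ?oner_eq0 ?mulf_neq0 ?invr_eq0//.
rewrite /normal_peak /normal_fun mulrACA -expRD [RHS]mulrACA -expRD.
rewrite exprMn exprVn !sqr_sqrtr ?ltW//; congr (_ * expR _).
  rewrite -!invfM; congr (_^-1); rewrite -!sqrtrM; last 2 first.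
  - by rewrite mulrn_wge0// mulr_ge0 ?pi_ge0// ltW.
  - by rewrite mulrn_wge0// mulr_ge0 ?pi_ge0// expr1n.
  by congr Num.sqrt; rewrite !mulr2n; field; rewrite gt_eqF.
by rewrite /s2; field; rewrite b0 gt_eqF.
Qed.

(** For [b] nonzero, Tonelli exchanges the integrals and [normal_pdf_sum] leaves a conditional
    density in z, which integrates to 1. For [b = 0] there is no conditional density and the sum is
    a z. *)
Lemma normal_convolution a b A : measurable A ->
  (\int[N]_z N [set w | A (a * z + b * w)%R] =
   N [set w | A (Num.sqrt (a ^+ 2 + b ^+ 2) * w)%R])%E.
Proof.
move=> mA; have [b0|b0] := eqVneq b 0.
  rewrite b0 expr0n addr0/=.
  transitivity (N [set z | A (a * z)]).
    have maz : measurable [set z : R | A (a * z)].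
      rewrite -[X in measurable X]setTI.
      by apply: (mulrl_measurable a).
    rewrite -[X in N X]setIT -[RHS](integral_indic N)//; apply: eq_integral => z _.
    rewrite indicE; case: (boolP (z \in _)) => [|]; rewrite ?inE ?notin_setE => zA.
      rewrite (_ : [set _ | _] = setT) ?probability_setT//.
      by apply/seteqP; split => // w _ /=; rewrite mul0r addr0.
    rewrite (_ : [set _ | _] = set0) ?measure0//.
    by apply/seteqP; split => // w /=; rewrite mul0r addr0.
  have [->|a0] := eqVneq a 0; first by rewrite expr0n/= sqrtr0.
  have sa0 : Num.sqrt (a ^+ 2) != 0 by rewrite sqrtr_sqr normr_eq0.
  have affine0 c : c != 0 -> N [set z | A (c * z)] = normal_prob 0 c A.
    move=> c0; rewrite -[RHS](std_normal_affine 0 c0 mA).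
    by apply: (congr1 N); apply/seteqP; split => w /=; rewrite add0r.
  rewrite (affine0 _ a0) (affine0 _ sa0); apply: normal_prob_sqr => //.
  by rewrite sqr_sqrtr// sqr_ge0.
set s := Num.sqrt _.
have s2 : 0 < a ^+ 2 + b ^+ 2 by rewrite ltr_wpDl ?sqr_ge0// exprn_even_gt0.
have s0 : s != 0 by rewrite gt_eqF// sqrtr_gt0.
transitivity (normal_prob 0 s A); last first.
  rewrite -(std_normal_affine 0 s0 mA).
  by apply: (congr1 N); apply/seteqP; split => w /=; rewrite add0r.
under eq_integral do rewrite std_normal_affine//.
pose k (p : R * R) : \bar R := (normal_pdf (a * p.1) b p.2 * \1_A p.2)%:E.
have mk : measurable_fun setT k.
  apply/measurable_EFinP; apply: measurable_funM; last first.
    by apply: measurableT_comp => //; exact: measurable_indic.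
  rewrite (_ : (fun _ => _) = fun p : R * R => normal_peak b *
     expR (- (p.2 - a * p.1) ^+ 2 / (b ^+ 2 *+ 2))); last first.
    by apply/funext => p; rewrite normal_pdfE.
  apply: measurable_funM => //; apply: measurableT_comp => //.
  apply: measurable_funM => //; apply: measurableT_comp => //.
  apply: measurable_funX; apply: measurable_funB => //.
  exact: measurable_funM.
have k0 p : (0 <= k p)%E by rewrite lee_fin mulr_ge0// normal_pdf_ge0.
have kE z : normal_prob (a * z) b A = (\int[mu]_y k (z, y))%E.
  rewrite /normal_prob integral_mkcond; apply: eq_integral => y _.
  by rewrite patchE /k/= indicE; case: ifP => _; rewrite ?mulr1 ?mulr0.
pose F z := normal_prob (a * z) b A.
have F01 z : (0 <= F z <= 1)%E.
  by rewrite measure_ge0/= probability_le1.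
have mF : measurable_fun setT F.
  rewrite (_ : F = fubini_F mu k); last by apply/funext.
  exact: measurable_fun_fubini_tonelli_F.
have Ffin z : F z = (fine (F z))%:E.
  by rewrite fineK// ge0_fin_numE; [case/andP: (F01 z) => _ /le_lt_trans; apply; rewrite ltry|case/andP: (F01 z)].
under eq_integral do rewrite -/(F _) Ffin.
rewrite (@integral_normal_prob _ 1); last 2 first.
- by apply: (measurableT_comp _ mF); exact: fine_measurable.
- move=> z; have /andP[F0 F1] := F01 z.
  by rewrite ger0_norm ?fine_ge0// -lee_fin -Ffin.
have mp m' b' : measurable_fun setT (fun x : R => (normal_pdf m' b' x)%:E).
  by apply/measurable_EFinP; exact: measurable_normal_pdf.
have mk1 z : measurable_fun setT (fun y => k (z, y)).
  by apply: (measurableT_comp mk); exact: measurable_pair1.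
have p0 m' b' x : (0 <= (normal_pdf m' b' x)%:E)%E.
  by rewrite lee_fin normal_pdf_ge0.
pose g (p : R * R) := ((normal_pdf 0 1 p.1)%:E * k p)%E.
transitivity (\int[mu]_z \int[mu]_y g (z, y))%E.
  apply: eq_integral => z _; rewrite EFinM -Ffin muleC /F kE /g/=.
  by rewrite -ge0_integralZl_EFin ?normal_pdf_ge0//; exact: mk1.
rewrite fubini_tonelli; last 2 first.
- apply: emeasurable_funM => //.
  exact: (measurableT_comp (mp 0 1) measurable_fst).
- by move=> p; rewrite mule_ge0.
rewrite /normal_prob [RHS]integral_mkcond; apply: eq_integral => y _.
transitivity (\int[mu]_z ((normal_pdf 0 s y * \1_A y)%:E *
    (normal_pdf (a / (a ^+ 2 + b ^+ 2) * y) (b / s) z)%:E))%E.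
  apply: eq_integral => z _; rewrite /k/= -!EFinM; congr EFin.
  by rewrite mulrA normal_pdf_sum// mulrAC.
rewrite ge0_integralZl_EFin//; last 2 first.
- exact: mp.
- by rewrite mulr_ge0// normal_pdf_ge0.
rewrite integral_normal_pdf mule1 patchE indicE.
by case: ifP => _; rewrite ?mulr1 ?mulr0.
Qed.

(** The integrand times the standard density is 1/q times the density of standard deviation 1/q. *)
Lemma normal_expRN_sqr q : 1 <= q ->
  \int[N]_x expR (- ((q ^+ 2 - 1) * x ^+ 2 / 2)) = q^-1.
Proof.
move=> q1; have q0 : 0 < q by exact: lt_le_trans q1.
have q2 : 0 <= q ^+ 2 - 1 by rewrite subr_ge0 exprn_ege1.
rewrite /Rintegral (@integral_normal_prob _ 1); last 2 first.
- apply: measurableT_comp => //; apply: measurable_funN.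
  by apply: measurable_funM => //; apply: measurable_funM => //; exact: measurable_funX.
- move=> x; rewrite ger0_norm ?expR_ge0// -[leRHS]expR0 ler_expR oppr_le0.
  by rewrite divr_ge0// mulr_ge0// sqr_ge0.
have mp : measurable_fun setT (fun x : R => (normal_pdf 0 q^-1 x)%:E).
  by apply/measurable_EFinP; exact: measurable_normal_pdf.
transitivity (fine (\int[mu]_x (q^-1%:E * (normal_pdf 0 q^-1 x)%:E))%E).
  congr fine; apply: eq_integral => x _; rewrite -EFinM; congr EFin.
  have qV0 : q^-1 != 0 by rewrite invr_eq0 gt_eqF.
  rewrite !normal_pdfE ?oner_eq0// /normal_peak /normal_fun.
  rewrite [LHS]mulrCA -expRD [RHS]mulrA; congr (_ * expR _); last first.
    by field; rewrite gt_eqF.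
  rewrite expr1n mul1r -mulrnAr sqrtrM ?sqr_ge0// sqrtr_sqr normrV ?unitfE ?gt_eqF//.
  by rewrite invfM invrK gtr0_norm// mulrA mulVf ?mul1r// gt_eqF.
rewrite ge0_integralZl_EFin//; last 2 first.
- by move=> x _; rewrite lee_fin normal_pdf_ge0.
- by rewrite invr_ge0 ltW.
by rewrite integral_normal_pdf mule1.
Qed.

(** With v = x^2 / 2, the quotient (1 - exp(-e v)) / e tends to v as e decreases to 0, and
    [normal_expRN_sqr] gives its exact mean. The quotient lies below v, and above v / (1 + e v),
    which increases to v; so the mean of v is squeezed to 1/2. *)
Lemma normal_second_moment :
  N.-integrable setT (EFin \o (fun x : R => x ^+ 2)) /\
  \int[N]_x (x ^+ 2) = 1.
Proof.
pose v x : R := x ^+ 2 / 2.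
have v0 x : 0 <= v x by rewrite divr_ge0 ?sqr_ge0.
have mv : measurable_fun setT v.
  by apply: measurable_funM => //; exact: measurable_funX.
pose q n : R := 1 + n.+1%:R^-1.
have q1 n : 1 < q n by rewrite ltrDl invr_gt0.
pose e n := q n ^+ 2 - 1.
have e0 n : 0 < e n by rewrite subr_gt0 exprn_egt1.
have mexp n : measurable_fun setT (fun x : R => expR (- (e n * x ^+ 2 / 2))).
  apply: measurableT_comp => //; apply: measurable_funN.
  by apply: measurable_funM => //; apply: measurable_funM => //; exact: measurable_funX.
have iexp n : N.-integrable setT (EFin \o (fun x : R => expR (- (e n * x ^+ 2 / 2)))).
  apply: (@bounded_integrable _ _ _ _ _ 1); [exact: mexp|move=> x].
  rewrite ger0_norm ?expR_ge0// -[leRHS]expR0 ler_expR oppr_le0 -mulrA.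
  by rewrite mulr_ge0 ?v0// ltW.
have iexp1 n : N.-integrable setT (EFin \o
    (fun x : R => (e n)^-1 * (1 - expR (- (e n * x ^+ 2 / 2))))).
  exact/integrableZr/(integrableDr (integrable_cstr N 1))/integrableNr.
(* Since e = q^2 - 1, the value is (1 - 1/q) / (q^2 - 1), which tends to 1/2 as q tends to 1. *)
have Eexp n : \int[N]_x ((e n)^-1 * (1 - expR (- (e n * x ^+ 2 / 2)))) =
    (q n * (q n + 1))^-1.
  rewrite RintegralZl//; last first.
    exact/(integrableDr (integrable_cstr N 1))/integrableNr.
  rewrite RintegralB//; last exact: (integrable_cstr N).
  rewrite Rintegral_cstP normal_expRN_sqr ?ltW// /e; field.
  have := q1 n; move: (q n) => r r1.
  by apply/and3P; split; apply/eqP; nra.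
(* A minorant of the quotient whose monotonicity in n is immediate, so that monotone convergence
   yields integrability of v. *)
pose f n x := v x / (1 + e n * v x).
have den n x : 0 < 1 + e n * v x by rewrite ltr_pwDl// mulr_ge0// ltW.
have fexp n x : f n x <= (e n)^-1 * (1 - expR (- (e n * x ^+ 2 / 2))).
  rewrite /f ler_pdivlMl// mulrA.
  have -> : e n * x ^+ 2 / 2 = e n * v x by rewrite /v mulrA.
  rewrite ler_pdivrMr//; have := expR_ge1Dx (e n * v x).
  have : expR (- (e n * v x)) * expR (e n * v x) = 1 by rewrite -expRD addNr expR0.
  have := expR_gt0 (- (e n * v x)); have := den n x.
  by move: (e n * v x) => C; move: (expR (- C)) (expR C) => A B *; nra.
have mf n : measurable_fun setT (fun x => (f n x)%:E).
  apply/measurable_EFinP; apply: measurable_funM => //.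
  apply: continuous_measurable_fun => x; apply: cvgV; first by rewrite gt_eqF.
  apply: cvgD; first exact: cvg_cst.
  apply: cvgM; first exact: cvg_cst.
  apply: cvgM; last exact: cvg_cst.
  exact: exprn_continuous.
have fv x : (f n x)%:E @[n --> \oo] --> (v x)%:E.
  apply: cvg_EFin; first exact: nearW.
  have q_cvg : q @ \oo --> (1 : R).
    rewrite -[X in _ --> X]addr0; apply: cvgD; first exact: cvg_cst.
    exact: cvg_harmonic.
  have e_cvg : e @ \oo --> (0 : R).
    rewrite -(subrr (1 ^+ 2)) expr1n -[X in X - 1](expr1n _ 2).
    apply: cvgB; last exact: cvg_cst.
    by rewrite expr2; apply: cvgM.
  rewrite /= -[X in _ --> X]divr1; apply: cvgM; first exact: cvg_cst.
  apply: cvgV; first exact: oner_neq0.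
  rewrite -[X in _ --> X]addr0 -(mul0r (v x)); apply: cvgD; first exact: cvg_cst.
  by apply: cvgM => //; exact: cvg_cst.
have f0 n x : (0 <= (f n x)%:E)%E by rewrite lee_fin divr_ge0// ltW.
have e_mono (m n : nat) : (m <= n)%N -> e n <= e m.
  move=> mn; rewrite lerD2r ler_sqr ?nnegrE ?addr_ge0//.
  by rewrite lerD2l lef_pV2 ?posrE// ler_nat.
have Ev : (\int[N]_x (v x)%:E <= (1 / 2)%:E)%E.
  rewrite (_ : (fun x => (v x)%:E) = fun x => limn (fun n => (f n x)%:E)); last first.
    by apply/funext => x; apply/esym/cvg_lim => //; exact: fv.
  rewrite monotone_convergence//; last first.
    move=> x _ m n mn; rewrite lee_fin ler_wpM2l// lef_pV2 ?posrE//.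
    by rewrite lerD2l ler_wpM2r// e_mono.
  apply: lime_le.
    apply: ereal_nondecreasing_is_cvgn => m n mn; apply: ge0_le_integral => //.
    move=> x _; rewrite lee_fin ler_wpM2l// lef_pV2 ?posrE//.
    by rewrite lerD2l ler_wpM2r// e_mono.
  apply: nearW => n.
  apply: (@le_trans _ _ (\int[N]_x ((e n)^-1 * (1 - expR (- (e n * x ^+ 2 / 2))))%:E)%E).
    apply: ge0_le_integral => //.
    - exact: measurable_int (iexp1 n).
    - by move=> x _; rewrite lee_fin; exact: fexp.
  rewrite integral_EFinE// Eexp lee_fin div1r lef_pV2 ?posrE//.
    by have := q1 n; move: (q n) => r; nra.
  by have := q1 n; move: (q n) => r; nra.
have iv : N.-integrable setT (EFin \o v).
  apply/integrableP; split; first exact/measurable_EFinP.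
  under eq_integral do rewrite /= ger0_norm//.
  by apply: le_lt_trans Ev _; rewrite ltry.
have v2 : (fun x : R => x ^+ 2) = (fun x => 2 * v x).
  by apply/funext => x; rewrite /v; field.
have i2 : N.-integrable setT (EFin \o (fun x : R => x ^+ 2)).
  by rewrite v2; exact: integrableZr.
split => //; rewrite v2 RintegralZl//.
suff -> : \int[N]_x v x = 1 / 2 by lra.
apply/eqP; rewrite eq_le; apply/andP; split.
  by rewrite -lee_fin -integral_EFinE.
apply/ler_addgt0Pl => d d0.
have [n] : exists n, n.+1%:R^-1 < d.
  have [n _ /(_ n (leqnn n))] := @near_infty_natSinv_lt R (PosNum d0).
  by exists n.
move=> nd; have : (q n * (q n + 1))^-1 <= \int[N]_x v x.
  rewrite -(Eexp n); apply: le_Rintegral => // x _.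
  rewrite ler_pdivrMl//; have := expR_ge1Dx (- (e n * x ^+ 2 / 2)).
  by rewrite /v; lra.
move=> hq; suff h : 1 / 2 - n.+1%:R^-1 <= (q n * (q n + 1))^-1.
  move: (le_trans h hq); rewrite lerBlDl => /le_trans; apply.
  by rewrite lerD2r ltW.
rewrite /q; have : 0 < n.+1%:R^-1 :> R by rewrite invr_gt0.
move: (n.+1%:R^-1) => r r0; rewrite -[leRHS]mul1r ler_pdivlMr; last by nra.
have r2 : 0 <= r ^+ 2 by rewrite sqr_ge0.
have r3 : 0 <= r ^+ 3 by rewrite exprn_ge0// ltW.
have -> : (1 / 2 - r) * ((1 + r) * (1 + r + 1)) =
  1 - r / 2 - 5 / 2 * r ^+ 2 - r ^+ 3 by field.
lra.
Unshelve. all: end_near. Qed.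

Lemma std_normalN (f : R -> R) : measurable_fun setT f ->
  N.-integrable setT (EFin \o f) -> \int[N]_x f x = \int[N]_x f (- x).
Proof.
move=> mf iN.
have sym A : measurable A -> N ((fun w : R => w) @^-1` A) =
    N ((fun w : R => - w) @^-1` A).
  move=> mA; have := @std_normal_affine 0 (-1) A _ mA.
  rewrite oppr_eq0 oner_eq0 => /(_ isT).
  rewrite (_ : [set _ | _] = (fun w : R => - w) @^-1` A); last first.
    by apply/seteqP; split => w /=; rewrite add0r mulN1r.
  move=> h; apply: etrans (esym h); apply: normal_prob_sqr; last exact: oner_neq0.
  by rewrite sqrrN.
by have [_ h] := eq_Rintegral_distribution (@measurable_id _ _ _)
  (measurable_funN (@measurable_id _ _ setT)) mf sym iN.
Qed.

Lemma normal_mean : \int[N]_x x = 0.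
Proof.
have mid : measurable_fun [set: R] (fun w => w : R) by exact: measurable_id.
have iN : N.-integrable setT (EFin \o (fun x : R => x)).
  exact: integrable_square mid normal_second_moment.1.
have : \int[N]_x x = - \int[N]_x x.
  rewrite [LHS](std_normalN mid)// -mulN1r -RintegralZl//.
  by apply: eq_Rintegral => x _; rewrite mulN1r.
lra.
Qed.

Lemma integral_normal_convolution a b (f : R -> R) (M : R) :
  measurable_fun setT f -> (forall x, `|f x| <= M) ->
  \int[N]_z (\int[N]_w f (a * z + b * w)) =
  \int[N]_w f (Num.sqrt (a ^+ 2 + b ^+ 2) * w).
Proof.
move=> mf fM.
pose Q : probability (R * R)%type R := (N \x N)%E.
pose X (p : R * R) : R := a * p.1 + b * p.2.
have mX : measurable_fun setT X.
  by apply: measurable_funD; apply: measurable_funM.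
have mY : measurable_fun [set: R]
    (fun w => Num.sqrt (a ^+ 2 + b ^+ 2) * (w : R)).
  exact: measurable_funM.
have law A : measurable A -> Q (X @^-1` A) =
    N ((fun w : R => Num.sqrt (a ^+ 2 + b ^+ 2) * w) @^-1` A).
  move=> mA; rewrite -[RHS](@normal_convolution a b A mA).
  apply: eq_integral => z _; apply: (congr1 N).
  by apply/seteqP; split => w; rewrite /xsection/= inE.
have iX : Q.-integrable setT (EFin \o (fun p => f (X p))).
  apply: (@bounded_integrable _ _ _ _ _ M) => //.
  exact: (measurableT_comp mf).
have [_ <-] := eq_Rintegral_distribution mX mY mf law iX.
rewrite /Rintegral -integral12_prod_meas1//; congr fine.
apply: eq_integral => z _; rewrite /fubini_F /X/=.
rewrite integral_EFinE//; apply: (@bounded_integrable _ _ _ _ _ M) => //.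
by apply: (measurableT_comp mf); exact: measurable_affine.
Qed.

Lemma normal_char_fun s x : \int[N]_w cos (x + s * w) = expR (- (s ^+ 2 / 2)) * cos x.
Proof.
(* Error at scale [s], uniform in the phase. Uniformity lets [GD] add independent normals: scales
   combine in quadrature while errors add. *)
pose G s (e : R) := forall x,
  `|\int[N]_w cos (x + s * w) - expR (- (s ^+ 2 / 2)) * cos x| <= e.
have GD a b e e' : G a e -> G b e' -> G (Num.sqrt (a ^+ 2 + b ^+ 2)) (e + e').
  move=> Ga Gb {}x.
  have mcx (y c : R) : measurable_fun setT (fun w : R => cos (y + c * w)).
    by apply: (measurableT_comp measurable_cos); exact: measurable_affine.
  rewrite -(@integral_normal_convolution _ _ (fun y => cos (x + y)) 1); last 2 first.
  - by apply: (measurableT_comp measurable_cos); exact: measurable_funD.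
  - by move=> y; exact: normr_cos_le1.
  pose H z := \int[N]_w cos (x + (a * z + b * w)).
  have HE z : H z = \int[N]_w cos ((x + a * z) + b * w).
    by apply: eq_Rintegral => w _; rewrite addrA.
  have mH : measurable_fun setT H.
    have mb : measurable_fun setT (fun w : R => b * w) by exact: measurable_funM.
    rewrite (_ : H = fun z => cos (x + a * z) * \int[N]_w cos (b * w) -
      sin (x + a * z) * \int[N]_w sin (b * w)); last first.
      by apply/funext => z; rewrite HE Rintegral_cosD.
    apply: measurable_funB; apply: measurable_funM => //.
    by apply: (measurableT_comp measurable_sin); exact: measurable_affine.
  have H1 z : `|H z| <= 1.
    rewrite HE; apply: ler_norm_Rintegral; first exact: mcx.
    by move=> w; exact: normr_cos_le1.
  have iH : N.-integrable setT (EFin \o H) by exact: bounded_integrable mH H1.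
  have ic : N.-integrable setT (EFin \o (fun z => cos (x + a * z))).
    by apply: integrable_cos; exact: measurable_affine.
  have -> : \int[N]_z H z - expR (- (Num.sqrt (a ^+ 2 + b ^+ 2) ^+ 2 / 2)) * cos x =
    \int[N]_z (H z - expR (- (b ^+ 2 / 2)) * cos (x + a * z)) +
    expR (- (b ^+ 2 / 2)) * (\int[N]_z cos (x + a * z) -
       expR (- (a ^+ 2 / 2)) * cos x).
    rewrite RintegralB//; last exact: integrableZr.
    rewrite RintegralZl// sqr_sqrtr ?addr_ge0 ?sqr_ge0//.
    by rewrite mulrDl opprD expRD; ring.
  apply: (le_trans (ler_normD _ _)); rewrite [leRHS]addrC; apply: lerD.
    apply: ler_norm_Rintegral; last by move=> z; rewrite HE; exact: Gb.
    by apply: measurable_funB => //; exact: measurable_funM.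
  rewrite normrM; apply: le_trans (Ga x).
  by rewrite ler_piMl// ger0_norm ?expR_ge0// -[leRHS]expR0 ler_expR oppr_le0 divr_ge0 ?sqr_ge0.
have [N2 EN2] := normal_second_moment.
(* At a = |s| / sqrt n, n copies of this error total 3 s^2 E[trunc_sqr a] + s^4 / n, which tends to
   0. *)
have Gloc a : 0 <= a -> G a (3 * (a ^+ 2 * \int[N]_w trunc_sqr a w) + a ^+ 4).
  move=> a0 y.
  have mid : measurable_fun [set: R] (fun w => w : R).
    exact: measurable_id.
  have m1 : measurable_fun setT (fun w => a * w) by exact: measurable_funM.
  have iw : N.-integrable setT (EFin \o (fun w : R => w)).
    exact: integrable_square mid N2.
  have i2 : N.-integrable setT (EFin \o (fun w => (a * w) ^+ 2)).
    by under [X in EFin \o X]eq_fun do rewrite exprMn; exact: integrableZr.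
  have := @char_fun_local _ _ _ N _ (a ^+ 2) y m1 i2.
  rewrite RintegralZl// normal_mean mulr0 => /(_ erefl).
  under eq_Rintegral do rewrite exprMn.
  rewrite RintegralZl// EN2 mulr1 => /(_ erefl).
  under [X in _ <= 3 * X + _ -> _]eq_Rintegral do rewrite trunc_sqrZ ger0_norm//.
  rewrite RintegralZl//; last exact: integrable_trunc_sqr.
  by rewrite -exprM.
have Gn a e n : 0 <= a -> G a e -> G (Num.sqrt n.+1%:R * a) (n.+1%:R * e).
  move=> a0 Ga; elim: n => [|n ih]; first by rewrite sqrtr1 !mul1r.
  have := GD _ _ _ _ ih Ga; rewrite exprMn sqr_sqrtr//.
  rewrite -[X in _ + X]mul1r -mulrDl sqrtrM ?addr_ge0// sqrtr_sqr ger0_norm//.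
  by rewrite natr1 (_ : n.+1%:R * e + e = n.+2%:R * e)// -[in RHS]natr1 mulrDl mul1r.
have Gs : G `|s| 0.
  move=> y; apply/ler_addgt0Pl => e e0; rewrite addr0.
  have c0 : 0 < 3 * s ^+ 2 + 1 by rewrite ltr_pwDr// mulr_ge0// sqr_ge0.
  have [|||a0 a00 small] := @trunc_sqr_small _ _ _ N (fun w : R => w)
    (e / 2 / (3 * s ^+ 2 + 1)).
  - by rewrite !divr_gt0.
  - exact: measurable_id.
  - exact: N2.
  (* The first bound puts |s| / sqrt(n+1) below [a0], the second makes the fourth-order part at most
     e / 2. *)
  pose n := maxn (Num.bound (`|s| ^+ 2 / a0 ^+ 2)) (Num.bound (s ^+ 4 / (e / 2))).
  have [hn1 hn2] : `|s| ^+ 2 / a0 ^+ 2 <= n.+1%:R /\ s ^+ 4 / (e / 2) <= n.+1%:R.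
    have bnd (z : R) : 0 <= z -> (Num.bound z <= n)%N -> z <= n.+1%:R.
      move=> z0 zn; apply/ltW/(lt_le_trans (archi_boundP z0)).
      by rewrite ler_nat leqW.
    split; apply: bnd; rewrite ?leq_maxl ?leq_maxr//.
      by rewrite divr_ge0 ?sqr_ge0.
    by apply: divr_ge0; [exact: exprn_even_ge0|exact/ltW/divr_gt0].
  pose r := Num.sqrt (n.+1%:R : R).
  have r0 : 0 < r by rewrite sqrtr_gt0.
  have r2 : r ^+ 2 = n.+1%:R by rewrite sqr_sqrtr.
  have a_ge0 : 0 <= `|s| / r by rewrite divr_ge0// ltW.
  have := Gn _ _ n a_ge0 (Gloc _ a_ge0) y.
  rewrite -/r mulrCA divff ?gt_eqF// mulr1 => /le_trans; apply.
  have aa0 : `|s| / r <= a0.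
    rewrite -(@ler_pXn2r _ 2) ?nnegrE ?(ltW a00)// expr_div_n r2 ler_pdivrMr//.
    by rewrite mulrC -ler_pdivrMr// exprn_gt0.
  have {}small := small _ a_ge0 aa0.
  rewrite mulrDr exprMn exprVn r2 real_normK ?num_real//.
  have -> : n.+1%:R * (3 * (s ^+ 2 / n.+1%:R * \int[N]_w trunc_sqr (`|s| / r) w)) =
     3 * s ^+ 2 * \int[N]_w trunc_sqr (`|s| / r) w.
    by field; rewrite addrC natr1 pnatr_eq0.
  have -> : n.+1%:R * (`|s| / r) ^+ 4 = s ^+ 4 / n.+1%:R.
    rewrite (_ : (`|s| / r) ^+ 4 = (`|s| ^+ 2) ^+ 2 / (r ^+ 2) ^+ 2); last first.
      by field; rewrite gt_eqF.
    rewrite r2 real_normK ?num_real//.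
    by field; rewrite addrC natr1 pnatr_eq0.
  have h1 : s ^+ 4 / n.+1%:R <= e / 2.
    by rewrite ler_pdivrMr// mulrC -ler_pdivrMr// divr_gt0.
  have h2 : 3 * s ^+ 2 * \int[N]_w trunc_sqr (`|s| / r) w <= e / 2.
    apply: (@le_trans _ _ ((3 * s ^+ 2 + 1) * (e / 2 / (3 * s ^+ 2 + 1)))).
      apply: ler_pM => //; first by rewrite mulr_ge0// sqr_ge0.
        by apply: Rintegral_ge0 => w _; exact: trunc_sqr_ge0.
      by rewrite lerDl.
    by rewrite mulrC divfK// gt_eqF.
  by rewrite [leRHS](splitr e) lerD.
have := Gs x; rewrite normr_le0 subr_eq0 real_normK ?num_real// => /eqP <-.
(* The estimate concerns |s|. The sign drops out since the sine integrals vanish by symmetry of the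
   law and the cosine is even. *)
have [s0|s0] := leP 0 s; first by rewrite ger0_norm.
rewrite ltr0_norm//.
have mb b : measurable_fun setT (fun w : R => b * w) by exact: measurable_funM.
have sN y : \int[N]_w sin (y * w) = 0.
  have ms : measurable_fun setT (fun w : R => sin (y * w)).
    exact: (measurableT_comp measurable_sin (mb y)).
  have is_ := integrable_sin N (mb y).
  have : \int[N]_w sin (y * w) = - \int[N]_w sin (y * w).
    rewrite [LHS](std_normalN ms)// -mulN1r -RintegralZl//.
    by apply: eq_Rintegral => x' _; rewrite mulrN sinN mulN1r.
  lra.
rewrite (Rintegral_cosD _ _ (mb s)) (Rintegral_cosD _ _ (mb (- s))) !sN.
by congr (_ * _ - _); apply: eq_Rintegral => w _; rewrite mulNr cosN.
Qed.

End gaussian.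

(** * Vectors and trigonometric approximation *)

Section vectors.
Context {R : realType}.
Implicit Types m : nat.

Lemma mx_entry_le_norm m n (x : 'M[R]_(m, n)) i j : `|x i j| <= `|x|.
Proof.
rewrite [leRHS]mx_normrE.
by apply: (@le_bigmax _ _ _ 0 (fun ij => `|x ij.1 ij.2|) (i, j)).
Qed.

Lemma mx_norm_le m n (x : 'M[R]_(m, n)) (c : R) : 0 <= c ->
  (forall i j, `|x i j| <= c) -> `|x| <= c.
Proof.
by move=> c0 xc; rewrite [leLHS]mx_normrE; apply/bigmax_leP; split => // -[i j] _.
Qed.

Lemma mx_norm_lt m n (x : 'M[R]_(m, n)) (c : R) : 0 < c ->
  (forall i j, `|x i j| < c) -> `|x| < c.
Proof.
by move=> c0 xc; rewrite [ltLHS]mx_normrE; apply/bigmax_ltP; split => // -[i j] _.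
Qed.

Definition dot m (u x : 'cV[R]_m) : R := (u^T *m x) 0 0.

Lemma dotE m (u x : 'cV[R]_m) : dot u x = \sum_i u i 0 * x i 0.
Proof. by rewrite /dot mxE; apply: eq_bigr => i _; rewrite mxE. Qed.

Lemma dotDr m (u x y : 'cV[R]_m) : dot u (x + y) = dot u x + dot u y.
Proof. by rewrite /dot mulmxDr mxE. Qed.

Lemma dotZr m c (u x : 'cV[R]_m) : dot u (c *: x) = c * dot u x.
Proof. by rewrite /dot -scalemxAr mxE. Qed.

Lemma dotDl m (u v x : 'cV[R]_m) : dot (u + v) x = dot u x + dot v x.
Proof. by rewrite /dot linearD/= mulmxDl mxE. Qed.

Lemma dotZl m c (u x : 'cV[R]_m) : dot (c *: u) x = c * dot u x.
Proof. by rewrite /dot linearZ/= -scalemxAl mxE. Qed.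

Lemma dot0r m (u : 'cV[R]_m) : dot u 0 = 0.
Proof. by rewrite /dot mulmx0 mxE. Qed.

Lemma dot0l m (x : 'cV[R]_m) : dot 0 x = 0.
Proof. by rewrite /dot trmx0 mul0mx mxE. Qed.

Lemma dotBr m (u x y : 'cV[R]_m) : dot u (x - y) = dot u x - dot u y.
Proof. by rewrite /dot mulmxBr !mxE. Qed.

Lemma dotBl m (u v x : 'cV[R]_m) : dot (u - v) x = dot u x - dot v x.
Proof. by rewrite -scaleN1r dotDl dotZl mulN1r. Qed.

Lemma dotC m (u x : 'cV[R]_m) : dot u x = dot x u.
Proof. by rewrite !dotE; apply: eq_bigr => i _; rewrite mulrC. Qed.

Lemma dot_delta m i (x : 'cV[R]_m) : dot (delta_mx i 0) x = x i 0.
Proof. by rewrite /dot trmx_delta -rowE mxE. Qed.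

Lemma dot_sumr m (u : 'cV[R]_m) (I : Type) (s : seq I) (p : pred I)
  (x : I -> 'cV[R]_m) :
  dot u (\sum_(i <- s | p i) x i) = \sum_(i <- s | p i) dot u (x i).
Proof.
rewrite /dot mulmx_sumr summxE; exact: eq_bigr.
Qed.

Lemma ler_dot m (u x : 'cV[R]_m) : `|dot u x| <= m%:R * (`|u| * `|x|).
Proof.
rewrite dotE; apply: (le_trans (ler_norm_sum _ _ _)).
apply: (@le_trans _ _ (\sum_(i < m) `|u| * `|x|)).
  by apply: ler_sum => i _; rewrite normrM ler_pM ?mx_entry_le_norm.
by rewrite sumr_const card_ord mulr_natl.
Qed.

Lemma ler_mulmx_norm m (A : 'M[R]_m) (h : 'cV[R]_m) :
  `|A *m h| <= m%:R * `|A| * `|h|.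
Proof.
apply: mx_norm_le; first by rewrite !mulr_ge0.
move=> i j; rewrite mxE; apply: le_trans (ler_norm_sum _ _ _) _.
rewrite -mulrA mulr_natl (_ : _ *+ m = \sum_(k < m) (`|A| * `|h|)); last first.
  by rewrite sumr_const card_ord.
apply: ler_sum => k _.
by rewrite normrM; apply: ler_pM => //; exact: mx_entry_le_norm.
Qed.

Lemma ler_qform m (A : 'M[R]_m) (h : 'cV[R]_m) :
  `|dot h (A *m h)| <= m%:R ^+ 2 * (`|A| * `|h| ^+ 2).
Proof.
apply: le_trans (ler_dot _ _) _; rewrite expr2 -mulrA ler_wpM2l//.
rewrite (_ : m%:R * _ = `|h| * (m%:R * `|A| * `|h|)); last by ring.
by rewrite ler_wpM2l// ler_mulmx_norm.
Qed.

Lemma dot_outer m (g h : 'cV[R]_m) : dot h (g *m g^T *m h) = dot g h ^+ 2.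
Proof.
rewrite /dot -!mulmxA mulmxA mxE big_ord1 expr2.
by congr (_ * _); rewrite -/(dot h g) dotC.
Qed.

Lemma cvg_sumr (I T : Type) (F : set_system T) {FF : Filter F} (s : seq I)
  (p : pred I) (f : I -> T -> R) (l : I -> R) :
  (forall i, p i -> f i x @[x --> F] --> l i) ->
  \sum_(i <- s | p i) f i x @[x --> F] --> \sum_(i <- s | p i) l i.
Proof. by move=> fl; apply: cvg_big => //; exact: add_continuous. Qed.

Lemma dot_continuous m (u : 'cV[R]_m) : continuous (dot u).
Proof.
move=> x; rewrite (_ : dot u = fun y => \sum_i u i 0 * y i 0); last first.
  by apply/funext => y; rewrite dotE.
apply: (@cvg_sumr _ _ (nbhs x)) => i _; apply: cvgM; first exact: cvg_cst.
exact: coord_continuous.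
Qed.

Lemma measurable_continuous_cV m (h : 'cV[R]_m -> R) : continuous h ->
  measurable_fun [set: borelCV R m] h.
Proof.
move=> ch; apply: (measurability _ (RGenOpens.measurableE R)).
move=> _ [_ [a [b ->] <-]]; rewrite setTI; apply: sub_sigma_algebra.
by move/continuousP : ch; apply; exact: interval_open.
Qed.

(** Every open set is a countable union of rational boxes, and the preimage of a box is a finite
    intersection of coordinate conditions. *)
Lemma measurable_coordP m d (T : measurableType d) (f : T -> 'cV[R]_m) :
  measurable_fun setT (f : T -> borelCV R m) <->
  forall i, measurable_fun setT (fun w => f w i 0).
Proof.
split=> [mf i|mf].
  have := @measurable_continuous_cV m (fun x : 'cV[R]_m => x i 0).
  by move=> /(_ (@coord_continuous _ _ _ _ _)) h; exact: (measurableT_comp h mf).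
apply: (@measurability _ _ T (borelCV R m) setT f open erefl).
move=> _ [B oB <-].
rewrite setTI.
pose box (q : 'cV[rat]_m * nat) : set 'cV[R]_m :=
  [set x | forall i, `|x i 0 - ratr (q.1 i 0)| < q.2.+1%:R^-1].
have -> : f @^-1` B = \bigcup_q (if `[< box q `<=` B >] then f @^-1` box q else set0).
  apply/seteqP; split=> w /=; last first.
    by move=> [q _]; case: asboolP => // qB fq; exact: qB.
  move=> Bw.
  have /nbhs_ballP[e e0 eB] : nbhs (f w) B by exact: open_nbhs_nbhs.
  (* Half of [e], because the box is centred at a rational point near [f w] and not at [f w]
     itself. *)
  have [k _ /(_ k (leqnn k)) ke] := @near_infty_natSinv_lt R (PosNum (divr_gt0 e0 (ltr0n R 2))).
  have k0 : 0 < k.+1%:R^-1 :> R by rewrite invr_gt0.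
  have /choice[q hq] : forall i, exists r : rat, `|f w i 0 - ratr r| < k.+1%:R^-1.
    move=> i; move: (k.+1%:R^-1) k0 => c c0.
    have : f w i 0 - c < f w i 0 + c by lra.
    move=> /rat_in_itvoo[r]; rewrite in_itv/= => /andP[r1 r2]; exists r.
    by rewrite ltr_norml; apply/andP; split; lra.
  exists (\col_i q i, k) => //.
  rewrite asboolT /= => [i|x /= xq]; first by rewrite mxE.
  apply: eB; rewrite mx_norm_ball/=; apply: mx_norm_lt => // i j.
  rewrite (ord1 j) !mxE.
  have := xq i; have := hq i; rewrite mxE => h1 h2.
  rewrite (_ : _ - _ = (f w i 0 - ratr (q i)) - (x i 0 - ratr (q i))); last by ring.
  apply: (le_lt_trans (ler_normB _ _)); move: ke h1 h2 => /=.
  by move: (k.+1%:R^-1) => c; lra.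
apply: countable_bigcupT_measurable => [|q]; first exact: countableP.
case: ifP => // _.
rewrite (_ : _ @^-1` _ = \bigcap_(i in [set: 'I_m])
  (fun w => f w i 0) @^-1` (ball (ratr (q.1 i 0) : R) q.2.+1%:R^-1)); last first.
  apply/seteqP; split=> w /= h i; rewrite /ball/=; first by rewrite distrC => _; exact: h.
  by have := h i I; rewrite /ball/= distrC.
apply: fin_bigcap_measurable => [|i _]; first exact: finite_finset.
rewrite -[X in measurable X]setTI; apply: mf => //.
exact: measurable_ball.
Unshelve. all: end_near. Qed.

End vectors.

Section trigonometric_polynomials.
Context {R : realType} {m : nat}.
Implicit Types (f g : 'cV[R]_m -> R).

(** The triples are amplitude, phase and frequency. Free phases make the class an algebra containing
    the sines, with no complex numbers. *)
Definition trig_poly f : Prop :=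
  exists s : seq (R * R * 'cV[R]_m), forall x,
    f x = \sum_(t <- s) t.1.1 * cos (t.1.2 + dot t.2 x).

Lemma eq_trig_poly f g : f =1 g -> trig_poly f -> trig_poly g.
Proof. by move=> fg [s sf]; exists s => x; rewrite -fg. Qed.

Lemma trig_poly_cos a c u : trig_poly (fun x => a * cos (c + dot u x)).
Proof. by exists [:: (a, c, u)] => x; rewrite big_seq1. Qed.

Lemma trig_polyD f g : trig_poly f -> trig_poly g ->
  trig_poly (fun x => f x + g x).
Proof.
by move=> [s sf] [t tg]; exists (s ++ t) => x; rewrite big_cat/= sf tg.
Qed.

Lemma trig_poly_cst a : trig_poly (fun=> a).
Proof.
apply: eq_trig_poly (trig_poly_cos a 0 0) => x.
by rewrite dot0l addr0 cos0 mulr1.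
Qed.

Lemma trig_poly_sum (I : Type) (s : seq I) (p : pred I)
    (f : I -> 'cV[R]_m -> R) : (forall i, p i -> trig_poly (f i)) ->
  trig_poly (fun x => \sum_(i <- s | p i) f i x).
Proof.
move=> tf; elim: s => [|i s ih].
  by apply: eq_trig_poly (trig_poly_cst 0) => x; rewrite big_nil.
have [pi|npi] := boolP (p i).
  by apply: eq_trig_poly (trig_polyD (tf _ pi) ih) => x; rewrite big_cons pi.
by apply: eq_trig_poly ih => x; rewrite big_cons (negbTE npi).
Qed.

Lemma trig_polyM f g : trig_poly f -> trig_poly g ->
  trig_poly (fun x => f x * g x).
Proof.
move=> [s sf] [t tg].
have : trig_poly (fun x => \sum_(i <- s) \sum_(j <- t)
   (i.1.1 * cos (i.1.2 + dot i.2 x)) * (j.1.1 * cos (j.1.2 + dot j.2 x))).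
  apply: trig_poly_sum => i _; apply: trig_poly_sum => j _.
  apply: eq_trig_poly (trig_polyD
    (trig_poly_cos (i.1.1 * j.1.1 / 2) (i.1.2 + j.1.2) (i.2 + j.2))
    (trig_poly_cos (i.1.1 * j.1.1 / 2) (i.1.2 - j.1.2) (i.2 - j.2))) => x.
  rewrite dotDl dotBl.
  rewrite [X in cos X](_ : _ = (i.1.2 + dot i.2 x) + (j.1.2 + dot j.2 x)); last by ring.
  rewrite [X in _ + _ * cos X](_ : _ =
    (i.1.2 + dot i.2 x) - (j.1.2 + dot j.2 x)); last by ring.
  by rewrite cosB cosD; field.
apply: eq_trig_poly => x; rewrite sf tg big_distrl/=; apply: eq_bigr => i _.
by rewrite big_distrr.
Qed.

Lemma trig_poly_prod (I : Type) (s : seq I) (p : pred I)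
    (f : I -> 'cV[R]_m -> R) : (forall i, p i -> trig_poly (f i)) ->
  trig_poly (fun x => \prod_(i <- s | p i) f i x).
Proof.
move=> tf; elim: s => [|i s ih].
  by apply: eq_trig_poly (trig_poly_cst 1) => x; rewrite big_nil.
have [pi|npi] := boolP (p i).
  by apply: eq_trig_poly (trig_polyM (tf _ pi) ih) => x; rewrite big_cons pi.
by apply: eq_trig_poly ih => x; rewrite big_cons (negbTE npi).
Qed.

Lemma trig_poly_sin c u : trig_poly (fun x => sin (c + dot u x)).
Proof.
apply: eq_trig_poly (trig_poly_cos 1 (c - pi / 2) u) => x.
rewrite mul1r (_ : c - pi / 2 + dot u x = c + dot u x - pi / 2); last by ring.
by rewrite cosB cos_pihalf sin_pihalf mulr0 add0r mulr1.
Qed.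

Lemma trig_poly_continuous f : trig_poly f -> continuous f.
Proof.
move=> [s sf] x; rewrite (_ : f = fun x =>
  \sum_(t <- s) t.1.1 * cos (t.1.2 + dot t.2 x)); last exact/funext.
apply: (@cvg_sumr _ _ _ (nbhs x)) => t _; apply: cvgM; first exact: cvg_cst.
apply: (cvg_comp (fun x => t.1.2 + dot t.2 x) cos); last exact: continuous_cos.
by apply: cvgD; [exact: cvg_cst|exact: dot_continuous].
Qed.

End trigonometric_polynomials.

(** * Bernstein polynomials and the binomial variance *)

Section bernstein.
Context {R : realType}.
Implicit Types t : R.

(* [C(N, j) t^j (1 - t)^(N - j)], by Pascal's recursion. *)
Fixpoint bernstein (N j : nat) (t : R) : R :=
  if N is N'.+1 then (1 - t) * bernstein N' j t +
    (if j is j'.+1 then t * bernstein N' j' t else 0)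
  else (j == 0%N)%:R.

Lemma bernstein_ge0 N j t : 0 <= t <= 1 -> 0 <= bernstein N j t.
Proof.
move=> /andP[t0 t1]; elim: N j => [|N ih] j /=; first by rewrite ler0n.
by apply: addr_ge0; [rewrite mulr_ge0 ?subr_ge0|case: j => // j; rewrite mulr_ge0].
Qed.

Lemma bernstein_gt N j t : (N < j)%N -> bernstein N j t = 0.
Proof.
elim: N j => [|N ih] [|j]//=; rewrite ltnS => Nj.
by rewrite !ih ?mulr0 ?addr0// ltnW.
Qed.

(** Conditioning on the last of N + 1 Bernoulli trials: a test function is replaced by its average
    over one trial. *)
Lemma bernstein_sumS N t (phi : nat -> R) :
  \sum_(j < N.+2) bernstein N.+1 j t * phi j =
  \sum_(j < N.+1) bernstein N j t * ((1 - t) * phi j + t * phi j.+1).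
Proof.
transitivity (\sum_(j < N.+2) (1 - t) * bernstein N j t * phi j +
   \sum_(j < N.+1) t * bernstein N j t * phi j.+1).
  rewrite [in RHS]big_ord_recl [LHS]big_ord_recl/= addr0 -addrA; congr (_ + _).
  by rewrite -big_split/=; apply: eq_bigr => j _; rewrite mulrDl.
rewrite big_ord_recr/= bernstein_gt// mulr0 mul0r addr0 -big_split/=.
by apply: eq_bigr => j _; ring.
Qed.

Lemma bernstein_sum N t : \sum_(j < N.+1) bernstein N j t = 1.
Proof.
elim: N => [|N ih]; first by rewrite big_ord1.
have := bernstein_sumS N t (fun=> 1).
under eq_bigr do rewrite mulr1; move=> ->.
by rewrite -[RHS]ih; apply: eq_bigr => j _; ring.
Qed.

(** By [bernstein_sumS], each trial replaces the centred square by its value one degree lower plus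
    t(1 - t). *)
Lemma bernstein_variance N t :
  \sum_(j < N.+1) bernstein N j t * (j%:R - N%:R * t) ^+ 2 =
  N%:R * (t * (1 - t)).
Proof.
elim: N => [|N ih]; first by rewrite big_ord1/= mul0r subr0 expr0n mulr0 mul0r.
rewrite (bernstein_sumS N t (fun j => (j%:R - N.+1%:R * t) ^+ 2)).
have e : \sum_(j < N.+1) bernstein N j t * (t * (1 - t)) = t * (1 - t).
  by rewrite -mulr_suml bernstein_sum mul1r.
rewrite -[in RHS]natr1 [RHS]mulrDl mul1r -ih -{}e -big_split/=.
apply: eq_bigr => j _.
by rewrite -!natr1; ring.
Qed.

Lemma bernstein_dispersion N t : (0 < N)%N -> 0 <= t <= 1 ->
  \sum_(j < N.+1) bernstein N j t * (j%:R / N%:R - t) ^+ 2 <= N%:R^-1.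
Proof.
move=> N0 /andP[t0 t1]; have NR : 0 < N%:R :> R by rewrite ltr0n.
have -> : \sum_(j < N.+1) bernstein N j t * (j%:R / N%:R - t) ^+ 2 =
   (N%:R ^+ 2)^-1 *
   \sum_(j < N.+1) bernstein N j t * (j%:R - N%:R * t) ^+ 2.
  rewrite mulr_sumr; apply: eq_bigr => j _.
  by field; rewrite gt_eqF.
rewrite bernstein_variance expr2 invfM mulrA -[X in _ <= X]mulr1 -!mulrA.
rewrite ler_pM2l ?invr_gt0// mulKf ?gt_eqF//.
by nra.
Qed.

End bernstein.

Section trig_approximation.
Context {R : realType} {m : nat}.
Local Notation vec := 'cV[R]_m.

Lemma compact_box (L : R) : 0 <= L -> compact [set x : vec | `|x| <= L].
Proof.
move=> L0; have -> : [set x : vec | `|x| <= L] =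
    trmx @` [set v : 'rV[R]_m | forall i, [set` `[- L, L]] (v ord0 i)].
  apply/seteqP; split=> [x /= xL|_ [v /= vL <-]].
    exists x^T => [i|]; last by rewrite trmxK.
    rewrite /= in_itv/= -ler_norml mxE.
    exact: le_trans (mx_entry_le_norm _ _ _) xL.
  apply: mx_norm_le => // i j; rewrite mxE (ord1 j) ler_norml.
  by have := vL i; rewrite /= in_itv.
apply: continuous_compact; last first.
  apply: (@rV_compact R m (fun=> [set` `[- L, L]])) => i.
  exact: segment_compact.
apply: continuous_subspaceT => v A [Q nQ QA].
exists (fun i j => Q j i) => [i j /=|u uQ].
  by have := nQ j i; rewrite mxE.
by apply: QA => i j /=; rewrite mxE.
Qed.

Lemma uniform_continuity_compact (K : set vec) (h : vec -> R) e : 0 < e ->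
  compact K -> continuous h ->
  exists2 r, 0 < r & forall x y, K x -> `|y - x| < r -> `|h y - h x| < e.
Proof.
move=> e0 /compact_near_coveringP cK ch.
pose P (r : R) (x : vec) := forall y, `|y - x| < r -> `|h y - h x| < e.
have := cK R (0^'+) P _.
case=> [x Kx|r r0 hr].
  have := ch x => /cvgrPdist_lt /(_ (e / 2)); rewrite divr_gt0// => /(_ isT).
  move=> /nbhs_ballP[r r0 hr]; have r20 : 0 < r / 2 by rewrite divr_gt0.
  exists (ball x (r / 2), [set s | s < r / 2]).
    split; first exact: nbhsx_ballx.
    by apply: nbhs_right_lt.
  move=> [x' s] /= [x'x sr] y yx'.
  have h1 : `|h x - h x'| < e / 2.
    by apply: hr; apply: le_ball x'x; rewrite ler_pdivrMr// ler_peMr ?ler1n// ltW.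
  have h2 : `|h x - h y| < e / 2.
    apply: hr; rewrite mx_norm_ball/= (_ : x - y = (x - x') - (y - x')); last first.
      by rewrite opprB addrA subrK.
    apply: (le_lt_trans (ler_normB _ _)).
    by rewrite mx_norm_ball/= in x'x; rewrite (splitr r); apply: ltrD => //; exact: lt_trans sr.
  rewrite (_ : h y - h x' = (h x - h x') - (h x - h y)); last by ring.
  by rewrite (splitr e); apply: (le_lt_trans (ler_normB _ _)); exact: ltrD.
exists (r / 2) => [|x y Kx yx]; first by rewrite divr_gt0.
have r20 : 0 < r / 2 by rewrite divr_gt0.
apply: (hr (r / 2) _ r20 _ Kx _ yx).
by rewrite /ball/= sub0r normrN gtr0_norm// ltr_pdivrMr// ltr_pMr// ltr1n.
Qed.

(** Mean value theorem: on this range the derivative [cos c] is at least 1 - c^2 / 2, hence at least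
    1/2. *)
Lemma sin_expanding (a b : R) : `|a| <= 1 / 2 -> `|b| <= 1 / 2 ->
  1 / 2 * `|a - b| <= `|sin a - sin b|.
Proof.
wlog ab : a b / a <= b => [hw a1 b1|].
  have [ab|/ltW ba] := leP a b; first exact: hw.
  by rewrite distrC (distrC (sin a)); exact: hw.
rewrite !ler_norml => /andP[a1 a2] /andP[b1 b2].
have [c] := @MVT_segment R sin cos a b ab
    (fun x _ => is_derive_sin x) (continuous_subspaceT (@continuous_sin R)).
rewrite in_itv/= => /andP[ac cb] e.
rewrite distrC (distrC (sin a)) e normrM ler_wpM2r//.
apply: le_trans (ler_norm _).
have /andP[_ h] := ler_1Bcos c; nra.
Qed.

(** The bound by [M] holds on the whole space and not only on the box; this is what makes the tails
    harmless when test functions are exchanged under an integral. *)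
Lemma trig_poly_approx (h : vec -> R) (M L e : R) : 0 < L -> 0 < e ->
  continuous h -> (forall x, `|h x| <= M) ->
  exists2 f, trig_poly f & (forall x, `|f x| <= M) /\
    (forall x, `|x| <= L -> `|h x - f x| <= e).
Proof.
move=> L0 e0 ch hM.
have M0 : 0 <= M by apply: le_trans (hM 0).
have [r r0 hr] := uniform_continuity_compact (divr_gt0 e0 (ltr0n R 2))
  (compact_box (ltW L0)) ch.
(* The factor 2 L brings the argument of the sine into [-1/2, 1/2] on the box, where [sin_expanding]
   makes [y] injective with a Lipschitz inverse. *)
pose y (x : vec) i : R := (1 + sin (x i 0 / (2 * L))) / 2.
have y01 x i : 0 <= y x i <= 1.
  have := @normr_sin_le1 R (x i 0 / (2 * L)); rewrite ler_norml /y.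
  by move: (sin _) => s /andP[s1 s2]; apply/andP; split; lra.
(* If coordinates of [y] differ by less than 2 dl, the sines differ by less than 4 dl, their
   arguments by less than 8 dl, and the points by less than 16 L dl = r. *)
pose dl := r / (16 * L).
have dl0 : 0 < dl by rewrite divr_gt0 ?mulr_gt0.
have close (x x' : vec) : `|x| <= L -> `|x'| <= L ->
    (forall i, `|y x i - y x' i| < 2 * dl) -> `|x' - x| < r.
  move=> xL x'L yy; apply: mx_norm_lt => // i j; rewrite (ord1 j) !mxE.
  have half (z : vec) : `|z| <= L -> `|z i 0 / (2 * L)| <= 1 / 2.
    move=> zL; rewrite normrM normfV (ger0_norm (_ : 0 <= 2 * L)) ?mulr_ge0 ?(ltW L0)//.
    rewrite ler_pdivrMr ?mulr_gt0// (_ : 1 / 2 * (2 * L) = L); last by field.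
    exact: le_trans (mx_entry_le_norm _ _ _) zL.
  have := sin_expanding (half _ x'L) (half _ xL).
  have := yy i; rewrite /y distrC -mulrBl opprD addrACA subrr add0r normrM.
  rewrite (ger0_norm (_ : 0 <= 2^-1)) ?invr_ge0// -mulrBl [in X in _ -> X -> _]normrM.
  rewrite (ger0_norm (_ : 0 <= (2 * L)^-1)) ?invr_ge0 ?mulr_ge0 ?(ltW L0)//.
  have dlE : 16 * (L * dl) = r by rewrite /dl; field; rewrite gt_eqF.
  move: (sin _ - sin _) `|x' i 0 - x i 0| => s t s1.
  rewrite mulrA ler_pdivrMr ?mulr_gt0// => s2.
  clearbody dl.
  have s3 : `|s| < 4 * dl by lra.
  have : `|s| * L < 4 * dl * L by rewrite ltr_pM2r.
  by lra.
pose nearx N (J : {ffun 'I_m -> 'I_N.+1}) (x : vec) :=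
  `|x| <= L /\ forall i, `|y x i - (J i)%:R / N%:R| < dl.
(* A grid node gets the value of [h] at some point of the box mapped near it. The default 0 occurs
   only at nodes far from the image of every point of the box, where just the bound by [M] is
   used. *)
pose v N (J : {ffun 'I_m -> 'I_N.+1}) : R :=
  if pselect (exists x, nearx N J x) is left ex then h (sval (cid ex)) else 0.
have vM N J : `|v N J| <= M by rewrite /v; case: pselect => // _; rewrite normr0.
pose w N (J : {ffun 'I_m -> 'I_N.+1}) x := \prod_i bernstein N (J i) (y x i).
have w0 N J x : 0 <= w N J x by apply: prodr_ge0 => i _; exact: bernstein_ge0.
have w1 N x : \sum_J w N J x = 1.
  rewrite /w -(bigA_distr_bigA (fun i (j : 'I_N.+1) => bernstein N j (y x i))).
  by apply: big1 => i _; exact: bernstein_sum.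
have wdisp N x i : (0 < N)%N ->
    \sum_J w N J x * ((J i)%:R / N%:R - y x i) ^+ 2 <= N%:R^-1.
  move=> N0; rewrite (_ : \sum_J _ =
    \sum_(J : {ffun 'I_m -> 'I_N.+1}) \prod_k (if k == i then
       bernstein N (J k) (y x k) * ((J k)%:R / N%:R - y x k) ^+ 2
       else bernstein N (J k) (y x k))); last first.
    apply: eq_bigr => J _; rewrite /w (bigD1 i)//= [RHS](bigD1 i)//= eqxx.
    rewrite mulrAC; congr (_ * _); apply: eq_bigr => k ki.
    by rewrite (negbTE ki).
  rewrite -(bigA_distr_bigA (fun k (j : 'I_N.+1) => if k == i then
       bernstein N j (y x k) * (j%:R / N%:R - y x k) ^+ 2
       else bernstein N j (y x k))) (bigD1 i)//= eqxx [X in _ * X]big1 ?mulr1.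
    exact: bernstein_dispersion.
  by move=> k ki; rewrite (negbTE ki) bernstein_sum.
pose f N x := \sum_J v N J * w N J x.
have ftrig N : trig_poly (f N).
  apply: trig_poly_sum => J _; apply: trig_polyM; first exact: trig_poly_cst.
  apply: trig_poly_prod => i _.
  have ty : trig_poly (fun x => y x i).
    apply: eq_trig_poly (trig_polyM (trig_poly_cst (1 / 2)) (trig_polyD
      (trig_poly_cst 1) (trig_poly_sin 0 ((2 * L)^-1 *: delta_mx i 0)))) => x.
    by rewrite dotZl dot_delta add0r /y mul1r mulrC (mulrC (x i 0)).
  move: (nat_of_ord (J i)) => j; elim: N {J} j => [|N ih] j /=; first exact: trig_poly_cst.
  apply: trig_polyD.
    apply: trig_polyM (ih j).
    apply: eq_trig_poly (trig_polyD (trig_poly_cst 1)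
      (trig_polyM (trig_poly_cst (-1)) ty)) => x.
    by rewrite mulN1r.
  case: j => [|j]; first exact: trig_poly_cst.
  exact: trig_polyM (ih j).
have fM N x : `|f N x| <= M.
  apply: (le_trans (ler_norm_sum _ _ _)).
  apply: (@le_trans _ _ (\sum_J M * w N J x)); last by rewrite -mulr_sumr w1 mulr1.
  by apply: ler_sum => J _; rewrite normrM (ger0_norm (w0 _ _ _)) ler_wpM2r.
have fapprox N (x : vec) : (0 < N)%N -> `|x| <= L ->
    `|h x - f N x| <= e / 2 + 2 * M / dl ^+ 2 * (m%:R / N%:R).
  move=> N0 xL.
  have -> : h x - f N x = \sum_J (h x - v N J) * w N J x.
    by under eq_bigr do rewrite mulrBl; rewrite sumrB -mulr_sumr w1 mulr1.
  apply: (le_trans (ler_norm_sum _ _ _)).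
  (* Chebyshev's argument: either every coordinate of the node is within [dl] and uniform continuity
     gives e / 2, or one squared deviation is at least dl^2 and the second term exceeds the trivial
     bound 2 M. *)
  have key (J : {ffun 'I_m -> 'I_N.+1}) : `|h x - v N J| <= e / 2 + 2 * M / dl ^+ 2 *
      \sum_i ((J i)%:R / N%:R - y x i) ^+ 2.
    have s0 : 0 <= 2 * M / dl ^+ 2.
      by rewrite divr_ge0 ?sqr_ge0 ?mulr_ge0.
    have [hJ|] := pselect (forall i, `|y x i - (J i)%:R / N%:R| < dl).
      rewrite -[leLHS]addr0; apply: lerD; last first.
        by rewrite mulr_ge0// sumr_ge0// => i _; exact: sqr_ge0.
      rewrite /v; case: pselect => [ex|]; last by case; exists x.
      case: cid => x' /= [x'L x'J]; rewrite distrC; apply/ltW/hr => //.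
      apply: close => // i.
      rewrite (_ : y x i - y x' i = (y x i - (J i)%:R / N%:R) -
        (y x' i - (J i)%:R / N%:R)); last by ring.
      apply: (le_lt_trans (ler_normB _ _)).
      by rewrite (_ : 2 * dl = dl + dl); [exact: ltrD (hJ i) (x'J i)|ring].
    move=> /existsNP[i /negP]; rewrite -leNgt => hi.
    apply: (@le_trans _ _ (2 * M)).
      by rewrite (_ : 2 * M = M + M); [exact: le_trans (ler_normB _ _) (lerD _ _)|ring].
    rewrite -[leLHS]add0r; apply: lerD; first by rewrite divr_ge0// ltW.
    rewrite mulrAC ler_pdivlMr ?exprn_gt0// ler_wpM2l ?mulr_ge0//.
    rewrite (bigD1 i)//= -[leLHS]addr0; apply: lerD; last first.
      by rewrite sumr_ge0// => k _; exact: sqr_ge0.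
    by rewrite -[leRHS](real_normK (num_real _)) distrC ler_pXn2r ?nnegrE// ltW.
  apply: (@le_trans _ _ (\sum_J (e / 2 * w N J x + 2 * M / dl ^+ 2 *
      \sum_i (w N J x * ((J i)%:R / N%:R - y x i) ^+ 2)))).
    apply: ler_sum => J _; rewrite normrM (ger0_norm (w0 _ _ _)).
    have := ler_wpM2r (w0 N J x) (key J); rewrite mulrDl => /le_trans; apply.
    by rewrite lerD2l -mulr_sumr (mulrC (w N J x)) mulrA.
  rewrite big_split/= -!mulr_sumr w1 mulr1 lerD2l ler_wpM2l//.
    by rewrite divr_ge0 ?sqr_ge0 ?mulr_ge0.
  rewrite exchange_big/=; apply: (@le_trans _ _ (\sum_(i < m) N%:R^-1)).
    by apply: ler_sum => i _; exact: wdisp.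
  by rewrite sumr_const card_ord mulr_natl.
pose K := 2 * M / dl ^+ 2 * m%:R / (e / 2).
have K0 : 0 <= K.
  apply: divr_ge0; last exact/ltW/divr_gt0.
  by apply: mulr_ge0 => //; apply: divr_ge0; [exact: mulr_ge0|exact: sqr_ge0].
exists (f (Num.bound K).+1); first exact: ftrig.
split => // x xL; apply: le_trans (fapprox _ x _ xL) _ => //.
rewrite [leRHS](splitr e) lerD2l mulrA ler_pdivrMr//.
rewrite [leRHS]mulrC -ler_pdivrMr ?divr_gt0//.
by apply/ltW/(lt_le_trans (archi_boundP K0)); rewrite ler_nat.
Qed.

End trig_approximation.

(** * Weak convergence and Gaussian vectors *)

Section weak_convergence.
Context {R : realType} {m : nat}.
Local Notation vec := 'cV[R]_m.

Lemma measurable_norm_cV : measurable_fun [set: borelCV R m]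
  (fun x : vec => `|x|).
Proof. by apply: measurable_continuous_cV; exact: norm_continuous. Qed.

Section tails.
Context {d : measure_display} {T : measurableType d} (Q : probability T R).

Lemma probability_tail (X : T -> R) (e : R) : measurable_fun setT X -> 0 < e ->
  exists2 L, 0 < L & (Q [set w | (L <= `|X w|)%R] <= e%:E)%E.
Proof.
move=> mX e0; pose F (n : nat) := [set w | n%:R <= `|X w|].
have mF n : measurable (F n).
  by apply: measurable_ge_set; apply: measurableT_comp.
have F0 : \bigcap_n F n = set0.
  apply/seteqP; split=> // w /(_ (Num.bound `|X w|) I) /=.
  by rewrite /F/= leNgt archi_boundP.
have Ffin : (Q (F 0%N) < +oo)%E.
  by rewrite (le_lt_trans (probability_le1 _ _))// ltry.
have Fmono : {homo F : a b / (a <= b)%N >-> (b <= a)%O}.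
  move=> a b ab; apply/subsetPset => w /=; apply: le_trans.
  by rewrite ler_nat.
have := nonincreasing_cvg_mu Ffin mF _ Fmono.
rewrite F0 measure0 => /(_ measurable0).
move=> /fine_cvgP[fF] /cvgr0Pnorm_le /(_ e e0)[N1 _ hN1].
have [N2 _ hN2] := fF.
pose N := (N1 + N2).+1.
exists N%:R => //; have := hN1 N; rewrite /= leqW ?leq_addr// => /(_ isT) h.
have := hN2 N; rewrite /= leqW ?leq_addl// => /(_ isT) fN.
rewrite -(fineK fN) lee_fin; apply: le_trans h; exact: ler_norm.
Qed.

Lemma Rintegral_close_off (F G : T -> R) (A : set T) (M e : R) :
  measurable_fun setT F -> measurable_fun setT G -> measurable A ->
  (forall w, `|F w| <= M) -> (forall w, `|G w| <= M) ->
  (forall w, ~ A w -> `|F w - G w| <= e) -> 0 <= e ->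
  `|\int[Q]_w F w - \int[Q]_w G w| <= e + 2 * M * fine (Q A).
Proof.
move=> mF mG mA FM GM FG e0.
have iF := bounded_integrable Q mF FM; have iG := bounded_integrable Q mG GM.
have iA : Q.-integrable setT (EFin \o (fun w => \1_A w : R)).
  apply: (@bounded_integrable _ _ _ _ _ 1); first exact: measurable_indic.
  by move=> w; rewrite indicE; case: (_ \in _); rewrite ?normr1 ?normr0.
rewrite -RintegralB//.
have iB := integrableDr iF (integrableNr iG).
apply: (le_trans (le_normr_Rintegral _ iB)) => //.
have -> : e + 2 * M * fine (Q A) = \int[Q]_w (e + 2 * M * \1_A w).
  rewrite RintegralD//; [|exact: integrable_cstr|exact: integrableZr].
  rewrite Rintegral_cstP RintegralZl//; congr (_ + _ * _).
  by rewrite /Rintegral integral_indic// setIT.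
apply: le_Rintegral => //.
- apply: dominated_integrable iB _.
    by apply: measurableT_comp => //; exact: measurable_funB.
  by move=> w; rewrite normr_id.
- exact/(integrableDr (integrable_cstr Q e))/integrableZr.
- move=> w _; rewrite indicE; have [wA|wA] := boolP (w \in A).
    rewrite mulr1; apply: (le_trans (ler_normB _ _)).
    have := FM w; have := GM w; lra.
  by rewrite mulr0 addr0; apply: FG; rewrite notin_setE in wA.
Qed.

Lemma Rintegral_close (Y : T -> vec) (h f : vec -> R) (M L e : R) :
  measurable_fun setT (Y : T -> borelCV R m) ->
  continuous h -> continuous f ->
  (forall x, `|h x| <= M) -> (forall x, `|f x| <= M) ->
  (forall x, `|x| <= L -> `|h x - f x| <= e) -> 0 <= e ->
  `|\int[Q]_w h (Y w) - \int[Q]_w f (Y w)| <=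
    e + 2 * M * fine (Q [set w | (L <= `|Y w|)%R]).
Proof.
move=> mY ch cf hM fM hf e0; apply: Rintegral_close_off => //.
- exact: (measurableT_comp (measurable_continuous_cV ch) mY).
- exact: (measurableT_comp (measurable_continuous_cV cf) mY).
- by apply: measurable_ge_set; exact: (measurableT_comp measurable_norm_cV mY).
- by move=> w /= /negP; rewrite -ltNge => /ltW /hf.
Qed.

End tails.

(** Cosines with phases give trigonometric polynomials by linearity. A bounded continuous function
    is replaced by such a polynomial on a large box, and tightness controls what happens outside
    it. *)
Lemma weak_convergence d (T : measurableType d) (P : probability T R)
    (Z : nat -> T -> vec) (mu : probability (borelCV R m) R) :
  (forall n, measurable_fun setT (Z n : T -> borelCV R m)) ->
  (forall c u, \int[P]_w cos (c + dot u (Z n w)) @[n --> \oo] -->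
     \int[mu]_x cos (c + dot u x)) ->
  (forall e, 0 < e -> exists2 L, 0 < L &
     \forall n \near \oo, (P [set w | (L <= `|Z n w|)%R] <= e%:E)%E) ->
  cvg_in_distribution P Z mu.
Proof.
move=> mZ cosZ tight h ch [M hM].
have M0 : 0 <= M by apply: le_trans (hM 0).
have mid : measurable_fun setT (fun x : borelCV R m => x) by exact: measurable_id.
have ih n : P.-integrable setT (EFin \o (fun w => h (Z n w))).
  apply: bounded_integrable (fun w => hM _).
  exact: (measurableT_comp (measurable_continuous_cV ch) (mZ n)).
have ihmu : mu.-integrable setT (EFin \o h).
  exact: bounded_integrable (measurable_continuous_cV ch) (fun w => hM _).
rewrite integral_EFinE//.
have trig_cvg f : trig_poly f ->
    \int[P]_w f (Z n w) @[n --> \oo] --> \int[mu]_x f x.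
  move=> [s sf].
  have sfE (d' : measure_display) (T' : measurableType d')
      (Q : probability T' R) (Y : T' -> vec) :
      measurable_fun setT (Y : T' -> borelCV R m) ->
      \int[Q]_w f (Y w) =
      \sum_(t <- s) t.1.1 * \int[Q]_w cos (t.1.2 + dot t.2 (Y w)).
    move=> mY.
    have ic t : Q.-integrable setT (EFin \o (fun w => cos (t.1.2 + dot t.2 (Y w) : R))).
      apply: integrable_cos; apply: measurable_funD => //.
      exact: (measurableT_comp (measurable_continuous_cV (@dot_continuous _ _ _)) mY).
    under eq_Rintegral do rewrite sf.
    rewrite Rintegral_sum; last by move=> t _; exact: integrableZr.
    by apply: eq_bigr => t _; rewrite RintegralZl.
  rewrite (sfE _ _ mu _ mid); under eq_fun do rewrite (sfE _ _ P _ (mZ _)).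
  by apply: cvg_sumr => t _; apply: cvgM; [exact: cvg_cst|exact: cosZ].
rewrite (_ : (fun k => _) = EFin \o (fun k => \int[P]_w h (Z k w))); last first.
  by apply/funext => k; rewrite unlock/= integral_EFinE.
apply: cvg_EFin; first exact: nearW.
apply/cvgrPdist_le => /= e e0.
(* Two approximation errors and one limit error cost 3 e'; the two tails cost 2 M e' each. *)
pose e' : R := e / (3 + 4 * M).
have den0 : 0 < 3 + 4 * M by lra.
have e'0 : 0 < e' by rewrite divr_gt0.
have [L1 L10 hL1] := tight _ e'0.
have [L2 L20 hL2] := probability_tail mu measurable_norm_cV e'0.
pose L := Num.max L1 L2.
have L0 : 0 < L by rewrite lt_max L10.
have [f tf [fM hf]] := trig_poly_approx L0 e'0 ch hM.
have cf := trig_poly_continuous tf.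
have tailmono (d' : measure_display) (T' : measurableType d') (Q : probability T' R)
    (Y : T' -> vec) L' : measurable_fun setT (Y : T' -> borelCV R m) ->
    L' <= L -> (Q [set w | (L' <= `|Y w|)%R] <= e'%:E)%E ->
    fine (Q [set w | (L <= `|Y w|)%R]) <= e'.
  move=> mY LL hQ.
  have mA l : measurable [set w | l <= `|Y w|].
    rewrite (_ : [set _ | _] = (fun w => `|Y w|) @^-1` [set` `[l, +oo[]); last first.
      by apply/seteqP; split=> w /=; rewrite in_itv/= andbT.
    rewrite -[X in measurable X]setTI.
    by apply: (measurableT_comp measurable_norm_cV mY).
  rewrite -lee_fin fineK ?fin_num_measure//; apply: le_trans hQ.
  by apply: le_measure; rewrite ?inE// => w /=; exact: le_trans.
have h2 : fine (mu [set x : vec | (L <= `|x|)%R]) <= e'.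
  apply: (tailmono _ _ mu _ L2 mid); first by rewrite le_max lexx orbT.
  by apply: le_trans hL2; rewrite le_eqVlt; apply/orP; left; apply/eqP;
    congr (mu _); apply/seteqP; split => x /=; rewrite normr_id.
have cl2 := Rintegral_close mu mid ch cf hM fM hf (ltW e'0).
have fcvg := trig_cvg _ tf.
near=> n.
have h1 : fine (P [set w | (L <= `|Z n w|)%R]) <= e'.
  apply: (tailmono _ _ P _ L1 (mZ n)); first by rewrite le_max lexx.
  by near: n; exact: hL1.
have cl1 := Rintegral_close P (mZ n) ch cf hM fM hf (ltW e'0).
have h3 : `|\int[mu]_x f x - \int[P]_w f (Z n w)| <= e'.
  by near: n; move/cvgrPdist_le : fcvg; apply.
have -> : \int[mu]_x h x - \int[P]_w h (Z n w) =
  (\int[mu]_x h x - \int[mu]_x f x) + (\int[mu]_x f x - \int[P]_w f (Z n w)) -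
  (\int[P]_w h (Z n w) - \int[P]_w f (Z n w)) by ring.
apply: (le_trans (ler_normB _ _)); apply: (@le_trans _ _
  (e' + 2 * M * e' + e' + (e' + 2 * M * e'))).
  apply: lerD; last first.
    apply: (le_trans cl1); rewrite lerD2l ler_wpM2l ?mulr_ge0//.
  apply: (le_trans (ler_normD _ _)); apply: lerD => //.
  by apply: (le_trans cl2); rewrite lerD2l ler_wpM2l ?mulr_ge0.
have -> : e = (3 + 4 * M) * e' by rewrite /e' mulrC divfK// gt_eqF.
lra.
Unshelve. all: end_near. Qed.

End weak_convergence.

Section gaussian_vectors.
Context {R : realType} {m : nat}.
Local Notation vec := 'cV[R]_m.
Local Notation N := (@std_normal R).

Definition shift_along (v : vec) (p : borelCV R m * R) : borelCV R m :=
  (p.1 : vec) + p.2 *: v.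

Lemma measurable_shift_along v : measurable_fun setT (shift_along v).
Proof.
apply/measurable_coordP => i.
rewrite (_ : (fun _ => _) = fun p : borelCV R m * R =>
  (p.1 : vec) i 0 + p.2 * v i 0); last first.
  by apply/funext => p; rewrite /shift_along !mxE.
apply: measurable_funD; last first.
  by apply: measurable_funM => //; exact: measurable_snd.
have mi : measurable_fun [set: borelCV R m] (fun x : vec => x i 0).
  by apply: measurable_continuous_cV; exact: coord_continuous.
exact: (measurableT_comp mi measurable_fst).
Qed.

(* The law of the sum of [z_v *: v] over [v] in the list, for independent
   standard normal [z_v]. *)
Fixpoint gaussian_law (s : seq vec) : probability (borelCV R m) R :=
  if s is v :: s' then
    distribution (gaussian_law s' \x N)%E
      (mfun_Sub (mem_set (measurable_shift_along v)))
  else \d_(0 : borelCV R m).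

(** The quadratic form of the covariance, the sum of v v^T over the list, that is, the variance of
    the projection on [u]. *)
Definition qform_seq (s : seq vec) (u : vec) : R := \sum_(v <- s) dot u v ^+ 2.

Lemma qform_seq_ge0 s u : 0 <= qform_seq s u.
Proof. by apply: sumr_ge0 => v _; exact: sqr_ge0. Qed.

Lemma measurable_dot u : measurable_fun [set: borelCV R m] (dot u).
Proof. by apply: measurable_continuous_cV; exact: dot_continuous. Qed.

Lemma std_normal_mul0 (A : set R) :
  N ((fun w => 0 * w) @^-1` A) = \d_(0 : R) A.
Proof.
rewrite diracE; have [A0|A0] := boolP (0 \in A).
  rewrite (_ : _ @^-1` A = setT) ?probability_setT//.
  by apply/seteqP; split => // w _ /=; rewrite mul0r; move: A0; rewrite inE.
rewrite (_ : _ @^-1` A = set0) ?measure0//.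
by apply/seteqP; split => // w /=; rewrite mul0r; move: A0; rewrite notin_setE.
Qed.

(** Projecting on [u] turns each step of the recursion into a one-dimensional convolution of centred
    normals, so variances add along the list. *)
Lemma gaussian_law_dot s u (A : set R) : measurable A ->
  gaussian_law s (dot u @^-1` A) =
  N ((fun w => Num.sqrt (qform_seq s u) * w) @^-1` A).
Proof.
elim: s A => [|v s ih] A mA.
  rewrite /qform_seq big_nil sqrtr0 std_normal_mul0 /= !diracE.
  suff -> : ((0 : vec) \in dot u @^-1` A) = (0 \in A) by [].
  by apply/idP/idP; rewrite !inE /= dot0r.
pose c := dot u v; pose sg := Num.sqrt (qform_seq s u).
pose G (y : R) := N [set z | A (y + c * z)].
have mG : measurable_fun setT G.
  pose B := (fun p : R * R => p.1 + c * p.2) @^-1` A.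
  have mB : measurable B.
    rewrite -[B]setTI; have mf : measurable_fun setT (fun p : R * R => p.1 + c * p.2).
      by apply: measurable_funD => //; exact: measurable_funM.
    exact: mf.
  rewrite (_ : G = N \o xsection B); first exact: measurable_fun_xsection.
  apply/funext => y; apply: (congr1 N).
  by apply/seteqP; split => z; rewrite /xsection/= inE.
transitivity (\int[gaussian_law s]_x G (dot u x))%E.
  apply: eq_integral => x _; apply: (congr1 N).
  by apply/seteqP; split => z /=;
    rewrite /xsection/= inE /shift_along/= dotDr dotZr mulrC.
transitivity (\int[N]_w G (sg * w)%R)%E.
  have msg : measurable_fun setT (fun w : R => sg * w) by exact: measurable_funM.
  pose X : {mfun borelCV R m >-> R} := mfun_Sub (mem_set (measurable_dot u)).
  pose Y : {mfun R >-> R} := mfun_Sub (mem_set msg).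
  transitivity (\int[distribution (gaussian_law s) X]_y G y)%E.
    by rewrite ge0_integral_distribution.
  rewrite (@eq_measure_integral _ _ _ _ (distribution N Y)).
    by rewrite ge0_integral_distribution.
  by move=> B mB _; exact: ih.
rewrite normal_convolution//.
by rewrite sqr_sqrtr ?qform_seq_ge0// /qform_seq big_cons addrC.
Qed.

Lemma gaussian_law_cos s c u :
  \int[gaussian_law s]_x cos (c + dot u x) =
  expR (- (qform_seq s u / 2)) * cos c.
Proof.
rewrite -[in RHS](sqr_sqrtr (qform_seq_ge0 s u)) -normal_char_fun.
have mf : measurable_fun setT (fun y : R => cos (c + y)).
  by apply: (measurableT_comp measurable_cos); exact: measurable_funD.
have mN : measurable_fun setT (fun w : R => Num.sqrt (qform_seq s u) * w).
  exact: measurable_funM.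
have [|_ h] := eq_Rintegral_distribution (measurable_dot u) mN mf
  (@gaussian_law_dot s u) => //.
apply: integrable_cos; apply: measurable_funD => //; exact: measurable_dot.
Qed.

Lemma gaussian_law_multinormal s (Sigma : 'M[R]_m) :
  (forall u, dot u (Sigma *m u) = qform_seq s u) ->
  is_multinormal (gaussian_law s) 0 Sigma.
Proof.
move=> SE u B mB; rewrite mulmx0 mxE -mulmxA -/(dot u _) SE.
rewrite [LHS](gaussian_law_dot s u mB) /gaussian1; case: eqP => [->|/eqP q0].
  by rewrite sqrtr0 std_normal_mul0.
have s0 : Num.sqrt (qform_seq s u) != 0.
  by rewrite sqrtr_eq0 -ltNge lt_neqAle eq_sym q0 qform_seq_ge0.
rewrite -(std_normal_affine 0 s0 mB); apply: (congr1 N).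
by apply/seteqP; split => w /=; rewrite add0r.
Qed.

End gaussian_vectors.

(** * Factorization of positive semidefinite matrices *)

Section positive_semidefinite.
Context {R : realType} {m : nat}.
Local Notation vec := 'cV[R]_m.

Definition psd (S : 'M[R]_m) : Prop :=
  S^T = S /\ forall u : vec, 0 <= dot u (S *m u).

Lemma sym_dot (S : 'M[R]_m) (u v : vec) : S^T = S ->
  dot u (S *m v) = dot v (S *m u).
Proof. by move=> sS; rewrite dotC /dot trmx_mul sS -mulmxA. Qed.

Lemma psd_cauchy_schwarz (S : 'M[R]_m) (u v : vec) : psd S ->
  dot u (S *m v) ^+ 2 <= dot u (S *m u) * dot v (S *m v).
Proof.
move=> [sS pS].
have key t : 0 <= dot u (S *m u) + 2 * t * dot u (S *m v) +
    t ^+ 2 * dot v (S *m v).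
  have := pS (u + t *: v); rewrite mulmxDr -scalemxAr !dotDr !dotDl !dotZr !dotZl.
  by rewrite (sym_dot v u sS); lra.
have := pS u; have := pS v; move: key.
move: (dot u (S *m u)) (dot u (S *m v)) (dot v (S *m v)) => a b c key c0 a0.
have [c00|cn0] := eqVneq c 0.
  have [->|b0] := eqVneq b 0; first by rewrite expr0n/= mulr_ge0.
  (* With [c = 0] the nonnegative form is affine in t; at this t it would equal -1. *)
  have := key (- (a + 1) / (2 * b)); rewrite c00 mulr0 addr0.
  rewrite (_ : 2 * _ * b = - (a + 1)); last by field.
  lra.
have cp : 0 < c by rewrite lt_neqAle eq_sym cn0.
have := key (- b / c).
have -> : a + 2 * (- b / c) * b + (- b / c) ^+ 2 * c = (a * c - b ^+ 2) / c.
  by field.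
by rewrite pmulr_lge0 ?invr_gt0// subr_ge0.
Qed.

(** Cholesky elimination. With v = S e_i / sqrt(S_ii), subtracting v v^T stays positive semidefinite
    by Cauchy-Schwarz, annihilates entry (i, i) and keeps zero diagonal entries zero, so the number
    of nonzero ones drops. A zero diagonal forces S = 0, again by Cauchy-Schwarz. *)
Lemma psd_factor (S : 'M[R]_m) : psd S ->
  exists s : seq vec, forall u, dot u (S *m u) = qform_seq s u.
Proof.
have [n] := ubnP #|[pred i | S i i != 0]|; elim: n S => // n ih S hn [sS pS].
have dE (A : 'M[R]_m) i : dot (delta_mx i 0) (A *m delta_mx i 0) = A i i.
  by rewrite dot_delta -colE mxE.
have [/existsP[i Sii]|/existsPn S0] := boolP [exists i, S i i != 0]; last first.
  exists [::] => u; rewrite /qform_seq big_nil.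
  have /(congr1 (dot u)) : S *m u = 0.
    apply/matrixP => i j; rewrite (ord1 j) -dot_delta mxE; apply/eqP.
    rewrite -sqrf_eq0 eq_le sqr_ge0 andbT.
    apply: (le_trans (psd_cauchy_schwarz _ _ (conj sS pS))).
    by rewrite dE; move: (S0 i); rewrite negbK => /eqP ->; rewrite mul0r.
  by rewrite dot0r.
have Sp : 0 < S i i by rewrite lt_neqAle eq_sym Sii -dE pS.
pose v : vec := (Num.sqrt (S i i))^-1 *: (S *m delta_mx i 0).
have q2 : (Num.sqrt (S i i))^-1 ^+ 2 = (S i i)^-1 by rewrite exprVn sqr_sqrtr// ltW.
pose S' := S - v *m v^T.
have S'E u w : dot u (S' *m w) = dot u (S *m w) - dot u v * dot v w.
  rewrite mulmxBl dotBr; congr (_ - _).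
  by rewrite -mulmxA [v^T *m w]mx11_scalar mul_mx_scalar dotZr mulrC.
have vE u : dot u v ^+ 2 = (S i i)^-1 * dot u (S *m delta_mx i 0) ^+ 2.
  by rewrite dotZr exprMn q2.
have psdS' : psd S'.
  split; first by rewrite /S' linearB/= trmx_mul trmxK sS.
  move=> u; rewrite S'E (dotC v) -expr2 vE subr_ge0 ler_pdivrMl//.
  by rewrite mulrC -dE; apply: psd_cauchy_schwarz.
have [|s hs] := ih S' _ psdS'.
  rewrite ltnS in hn; apply: leq_trans hn; apply: proper_card.
  apply/properP; split.
    apply/fintype.subsetP => j; rewrite !inE; apply: contra => /eqP Sj.
    rewrite -(dE S') S'E (dotC v) -expr2 vE dE Sj sub0r oppr_eq0 mulf_eq0 sqrf_eq0.
    apply/orP; right; rewrite -sqrf_eq0 eq_le sqr_ge0 andbT.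
    apply: (le_trans (psd_cauchy_schwarz _ _ (conj sS pS))).
    by rewrite dE Sj mul0r.
  exists i; rewrite !inE//= negbK -(dE S') S'E (dotC v) -expr2 vE dE expr2 mulKf//.
  by rewrite subrr.
exists (v :: s) => u; rewrite /qform_seq big_cons -/(qform_seq s u) -hs S'E.
by rewrite (dotC v) -expr2 addrC subrK.
Qed.

End positive_semidefinite.

(** * Riemann sums and Taylor expansion *)

Section uniformity.
Context {R : realType}.

(** Continuity is needed only at the points (x0, y) and relative to A x K; compactness of [K] makes
    the neighbourhood of [x0] independent of y. *)
Lemma uniform_on_compact (X Y : topologicalType) (V : normedModType R)
    (A : set X) (K : set Y) (f : X -> Y -> V) (x0 : X) (e : R) :
  compact K -> 0 < e -> A x0 ->
  (forall y, K y -> f p.1 p.2 @[p --> within (A `*` K) (nbhs (x0, y))] -->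
     f x0 y) ->
  \forall x \near within A (nbhs x0), forall y, K y ->
    `|f x y - f x0 y| < e.
Proof.
move=> /compact_near_coveringP/near_covering_withinP cK e0 Ax0 cf.
apply: (cK X (within A (nbhs x0)) (fun x y => `|f x y - f x0 y| < e)) => y Ky.
have := cf y Ky => /cvgrPdist_lt /(_ (e / 2)); rewrite divr_gt0// => /(_ isT).
move=> [[B C] /= [nB nC] BC].
exists (C, [set x | B x /\ A x]) => /=.
  split => //; apply: filterS nB => x Bx Ax; split; [exact: Bx|exact: Ax].
move=> [y' x] /= [Cy' [Bx Ax]] Ky'.
have h1 : `|f x0 y - f x y'| < e / 2 by apply: (BC (x, y')).
have h2 : `|f x0 y - f x0 y'| < e / 2.
  by apply: (BC (x0, y')) => //; split => //=; exact: nbhs_singleton.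
rewrite (_ : f x y' - f x0 y' =
  (f x0 y - f x0 y') - (f x0 y - f x y')); last first.
  by rewrite opprB [RHS]addrC addrA subrK.
by rewrite (splitr e); apply: (le_lt_trans (ler_normB _ _)); exact: ltrD.
Qed.

End uniformity.

Section riemann_sums.
Context {R : realType}.
Local Notation mu := (@lebesgue_measure R).

(** Composition with this retraction extends a function continuous on [0, 1] to a continuous
    function on the line, so that 0 and 1 become interior points. *)
Definition clamp01 (t : R) : R := Num.max 0 (Num.min 1 t).

Lemma clamp01_itv t : 0 <= clamp01 t <= 1.
Proof. by rewrite le_max lexx/= ge_max ler01 ge_min lexx. Qed.

Lemma clamp01_id t : 0 <= t <= 1 -> clamp01 t = t.
Proof. by move=> /andP[t0 t1]; rewrite /clamp01 min_r// max_r. Qed.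

Lemma continuous_clamp01 (f : R -> R) : {within `[0, 1], continuous f} ->
  continuous (f \o clamp01).
Proof.
move=> /subspace_continuousP cf t.
have ct : 0 <= clamp01 t <= 1 by exact: clamp01_itv.
have := cf (clamp01 t); rewrite /= in_itv/= ct => /(_ isT).
apply: cvg_comp => A nA.
have cc : clamp01 x @[x --> t] --> clamp01 t.
  apply: (@continuous_max _ R) => /=; [exact: cst_continuous|].
  by apply: (@continuous_min _ R); [exact: cst_continuous|move=> ?; exact: cvg_id].
have := cc _ nA; apply: (@filterS _ (nbhs t)) => x /=; apply.
by rewrite in_itv/= clamp01_itv.
Qed.

Lemma obs_time_itv n k : (0 < n)%N -> (k <= n)%N ->
  0 <= (obs_time n k : R) <= 1.
Proof.
move=> n0 kn; rewrite /obs_time divr_ge0//= ler_pdivrMr ?ltr0n//.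
by rewrite mul1r ler_nat.
Qed.

Lemma obs_time_in n k : (k < n)%N -> obs_time n k.+1 \in `[0 : R, 1].
Proof. by move=> kn; rewrite in_itv/= obs_time_itv//; case: n kn. Qed.

(** The integral is a telescoping sum of increments of a primitive. Each increment is 1/n times a
    value of the extended function in the cell, which uniform continuity compares with the right end
    point. *)
Lemma riemann_sum (f : R -> R) : {within `[0, 1], continuous f} ->
  n%:R^-1 * (\sum_(1 <= k < n.+1) f (obs_time n k)) @[n --> \oo] -->
  \int[mu]_(t in `[0, 1]) f t.
Proof.
move=> cf; pose g := f \o clamp01; have cg := continuous_clamp01 cf.
have ig a b : mu.-integrable `[a, b] (EFin \o g).
  apply: continuous_compact_integrable; first exact: segment_compact.
  exact: continuous_subspaceT.
(* Starting at -1 makes 0 interior, so the primitive is differentiable on all of [0, 1]. *)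
pose F (x : R) := \int[mu]_(t in `[-1, x]) g t.
have dF (x : R) : -1 < x -> is_derive x 1 F (g x).
  move=> x1; have x_lt : x < x + 1 by rewrite ltrDl.
  have [dFx Fx] := @continuous_FTC1 _ g (BLeft (-1)) x (x + 1) x_lt (ig _ _) x1 (cg x).
  by apply: (DeriveDef dFx); rewrite -derive1E; exact: Fx.
have F01 : F 1 - F 0 = \int[mu]_(t in `[0, 1]) f t.
  rewrite /F Rintegral_itvB ?bnd_simp ?lerN10 ?ler01//.
  rewrite Rintegral_itv_obnd_cbnd; last first.
    by apply: (integrableS _ _ _ (ig 0 1)) => //; exact: subset_itv_oc_cc.
  apply: eq_Rintegral => t; rewrite inE/= in_itv/= => t01.
  by rewrite /g/= clamp01_id.
have cF (a b : R) : -1 < a -> {within `[a, b], continuous F}.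
  move=> a1; apply: derivable_within_continuous => x.
  rewrite in_itv/= => /andP[ax _]; apply: ex_derive; apply: dF.
  exact: lt_le_trans ax.
apply/cvgrPdist_le => /= e e0.
have unif : exists2 r, 0 < r & forall x y, 0 <= x <= 1 -> `|y - x| < r ->
    `|g y - g x| <= e.
  have := @uniform_on_compact R R R R (setT : set R) (`[0, 1]%classic : set R)
     (fun s y => g (y + s)) 0 e (@segment_compact _ 0 1) e0 I.
  case=> [y _|r r0 hr].
    have h : p.2 + p.1 @[p --> ((0 : R), y)] --> y + 0.
      by apply: cvgD; [exact: cvg_snd|exact: cvg_fst].
    apply: cvg_trans (cvg_comp _ _ h (cg _)).
    by apply: cvg_app; exact: cvg_within.
  exists r => // x y x01 yx; have := hr (y - x); rewrite /ball/= sub0r normrN.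
  move=> /(_ yx I x); rewrite in_itv/= => /(_ x01).
  by rewrite addr0 (_ : x + (y - x) = y) => [/ltW//|]; ring.
have [r r0 hr] := unif.
pose N := Num.bound r^-1.
have rN : r^-1 < N%:R by apply: archi_boundP; rewrite invr_ge0 ltW.
near=> n.
have n0 : (0 < n)%N by near: n; exact: nbhs_infty_gt.
have nR0 : 0 < n%:R :> R by rewrite ltr0n.
have nr : n%:R^-1 < r.
  rewrite -[r]invrK ltf_pV2 ?posrE ?invr_gt0//; apply: lt_le_trans rN _.
  by rewrite ler_nat; near: n; exact: nbhs_infty_ge.
rewrite -F01.
have -> : F 1 - F 0 = \sum_(1 <= k < n.+1) (F (k%:R / n%:R) - F (k.-1%:R / n%:R)).
  rewrite big_add1/= (telescope_sumr (fun k => F (k%:R / n%:R)))//.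
  by rewrite divff ?gt_eqF// mul0r.
rewrite mulr_sumr -sumrB; apply: (le_trans (ler_norm_sum _ _ _)).
apply: (@le_trans _ _ (\sum_(1 <= k < n.+1) e / n%:R)); last first.
  by rewrite sumr_const_nat subn1/= -[(_ / _) *+ _]mulr_natr divfK ?gt_eqF.
rewrite !big_nat; apply: ler_sum => k /andP[k1 kn].
have le_k : k.-1%:R / n%:R <= k%:R / n%:R :> R.
  by rewrite ler_pM2r ?invr_gt0// ler_nat leq_pred.
have k_ge0 : 0 <= k.-1%:R / n%:R :> R by rewrite divr_ge0.
have kneg : -1 < k.-1%:R / n%:R :> R by apply: lt_le_trans k_ge0; rewrite oppr_lt0.
have [c|c] := @MVT_segment R F g _ _ le_k _ (cF _ _ kneg).
  rewrite in_itv/= => /andP[kc _]; apply: dF; exact: lt_trans kc.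
rewrite in_itv/= => /andP[kc ck] ->.
have kE : k%:R / n%:R - k.-1%:R / n%:R = n%:R^-1 :> R.
  by rewrite -mulrBl -{1}(prednK k1) -natr1 addrC addKr mul1r.
have gE : g (k%:R / n%:R) = f (obs_time n k).
  by rewrite /g/= clamp01_id//; exact: obs_time_itv.
rewrite kE -gE [n%:R^-1 * _]mulrC -mulrBl.
rewrite normrM [ `|n%:R^-1| ]ger0_norm ?invr_ge0// ler_pM2r ?invr_gt0//.
apply: hr; first exact: obs_time_itv.
rewrite distrC ger0_norm ?subr_ge0//; apply: le_lt_trans nr.
by rewrite -[leRHS]kE lerB.
Unshelve. all: end_near. Qed.

End riemann_sums.

Arguments obs_time_in R [n k] _.

Section taylor.
Context {R : realType} {m : nat}.
Local Notation vec := 'cV[R]_m.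

Lemma derive_gradient (f : vec -> R) (x v : vec) : differentiable f x ->
  'D_v f x = dot (gradient f x) v.
Proof.
move=> df; rewrite deriveE// {1}(_ : v = \sum_i v i 0 *: delta_mx i 0).
  rewrite linear_sum dotE; apply: eq_bigr => i _.
  by rewrite linearZ/= -deriveE// mxE mulrC.
apply/colP => i; rewrite summxE (bigD1 i)//= !mxE !eqxx/= mulr1.
rewrite big1 ?addr0// => j ji; rewrite !mxE eq_sym (negbTE ji)/= mulr0//.
Qed.

Lemma is_derive_line (f : vec -> R) (x h : vec) (a : R) :
  differentiable f (x + a *: h) ->
  is_derive a 1 (fun b : R => f (x + b *: h)) (dot (gradient f (x + a *: h)) h).
Proof.
move=> df; have qE : (fun b : R => b^-1 *: (f (x + (b *: 1 + a) *: h) - f (x + a *: h))) =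
    (fun b : R => b^-1 *: ((f \o shift (x + a *: h)) (b *: h) - f (x + a *: h))).
  apply/funext => b /=; congr (_ *: (f _ - _)).
  by rewrite [b *: 1]mulr1 scalerDl addrCA addrC.
have dh := diff_derivable df.
apply: DeriveDef.
  by rewrite /derivable/= qE; exact: dh.
by rewrite /derive/= qE -derive_gradient.
Qed.

(** After subtracting a g'(0) + a^2 q / 2, the mean value theorem is applied twice on [0, 1]; the
    factor 1/2 that an exact remainder would give is dropped. *)
Lemma taylor2_bound (g g1 g2 : R -> R) (q B : R) :
  (forall a : R, 0 <= a <= 1 -> is_derive a 1 g (g1 a)) ->
  (forall a : R, 0 <= a <= 1 -> is_derive a 1 g1 (g2 a)) ->
  (forall a : R, 0 <= a <= 1 -> `|g2 a - q| <= B) ->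
  `|g 1 - g 0 - g1 0 - q / 2| <= B.
Proof.
move=> dg dg1 g2B.
pose p (a : R) : R := g a - a * g1 0 - a ^+ 2 * (q / 2).
pose p1 (a : R) : R := g1 a - g1 0 - a * q.
have dp (a : R) : 0 <= a <= 1 -> is_derive a 1 p (p1 a).
  move=> /dg dga; rewrite /p; apply: is_derive_eq.
  rewrite /p1 [g1 0 *: _]/GRing.scale/= /GRing.scale/=; lra.
have dp1 (a : R) : 0 <= a <= 1 -> is_derive a 1 p1 (g2 a - q).
  move=> /dg1 dga; rewrite /p1; apply: is_derive_eq.
  rewrite /GRing.scale/=; lra.
have itv (a b : R) : 0 <= b <= 1 -> a \in `]0, b[ -> 0 <= a <= 1.
  move=> /andP[b0 b1]; rewrite in_itv/= => /andP[a0 ab].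
  by rewrite ltW//= (le_trans (ltW ab)).
have citv (k l : R -> R) (b : R) : 0 <= b <= 1 ->
    (forall a : R, 0 <= a <= 1 -> is_derive a 1 k (l a)) ->
    {within `[0, b], continuous k}.
  move=> /andP[b0 b1] dk; apply: derivable_within_continuous => a.
  rewrite in_itv/= => /andP[a0 ab]; apply: ex_derive; apply: dk.
  by rewrite a0 (le_trans ab).
have [||c] := @MVT_segment R p p1 0 1 ler01.
- by move=> a /(itv _ _ _) a01; apply: dp; apply: a01; rewrite ler01 lexx.
- by apply: (citv _ p1) => //; rewrite ler01 lexx.
rewrite in_itv/= => /andP[c0 c1].
rewrite subr0 mulr1 => pc.
have [||e] := @MVT_segment R p1 (fun a => g2 a - q) 0 c c0.
- by move=> a /(itv _ _ _) a01; apply: dp1; apply: a01; rewrite c0.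
- by apply: (citv _ (fun a => g2 a - q)) => //; rewrite c0.
rewrite in_itv/= => /andP[e0 ec].
have -> : g 1 - g 0 - g1 0 - q / 2 = p 1 - p 0 by rewrite /p; ring.
have p10 : p1 0 = 0 by rewrite /p1; ring.
rewrite p10 subr0 subr0 pc => ->; rewrite normrM (ger0_norm c0).
rewrite -[B]mulr1; apply: ler_pM => //; apply: g2B.
by rewrite e0 (le_trans ec).
Qed.

(** The error is measured by the deviation of the Hessian from a reference matrix along the segment,
    so no modulus of continuity enters. The factor m^2 bounds a quadratic form in sup norms. *)
Lemma taylor2 (f : vec -> R) (x h : vec) (H : 'M[R]_m) (b : R) :
  (forall a : R, 0 <= a <= 1 -> differentiable f (x + a *: h)) ->
  (forall a : R, 0 <= a <= 1 -> differentiable (gradient f) (x + a *: h)) ->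
  (forall a : R, 0 <= a <= 1 ->
     `|hessian f (x + a *: h) - H| <= b) ->
  `|f (x + h) - f x - dot (gradient f x) h - dot h (H *m h) / 2| <=
  m%:R ^+ 2 * (b * `|h| ^+ 2).
Proof.
move=> df dg Hb.
have := @taylor2_bound (fun a : R => f (x + a *: h))
  (fun a => dot (gradient f (x + a *: h)) h)
  (fun a => dot h (hessian f (x + a *: h) *m h))
  (dot h (H *m h)) (m%:R ^+ 2 * (b * `|h| ^+ 2)).
rewrite !scale0r scale1r addr0; apply.
- by move=> a /df /is_derive_line.
- move=> a a01.
  have -> : (fun b : R => dot (gradient f (x + b *: h)) h) =
    \sum_(i < m) (fun b : R => h i 0 * gradient f (x + b *: h) i 0).
    apply/funext => c; rewrite fct_sumE dotE.
    by apply: eq_bigr => i _; rewrite mulrC.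
  rewrite dotE; apply: is_derive_sum => i.
  have dgi : differentiable (fun y => gradient f y i 0) (x + a *: h).
    apply: (@differentiable_comp _ _ _ _ (gradient f) (fun M : vec => M i 0)).
      exact: dg.
    exact: differentiable_coord.
  have dl := is_derive_line dgi.
  apply: is_derive_eq.
  congr (_ * _).
  rewrite mxE dotE; apply: eq_bigr => j _; congr (_ * _).
  by rewrite !mxE.
- move=> a a01; rewrite -dotBr -mulmxBl.
  apply: le_trans (ler_qform _ _) _; rewrite ler_wpM2l ?sqr_ge0//.
  by rewrite ler_wpM2r ?sqr_ge0//; exact: Hb.
Qed.

End taylor.

(** * Approximate minimizers of a positive definite quadratic *)

Section quadratic_argmin.
Context {R : realType} {m : nat}.
Local Notation vec := 'cV[R]_m.
Implicit Types (J : 'M[R]_m) (t S : vec).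

(** No spectral theory: each coordinate is t_i = (J^-1 e_i)^T J t, and Cauchy-Schwarz for the form
    of J bounds its square by a constant times t^T J t. *)
Lemma psd_unit_coercive J : psd J -> J \in unitmx ->
  exists2 c : R, 0 <= c & forall t, `|t| ^+ 2 <= c * dot t (J *m t).
Proof.
move=> pJ uJ; pose u i : vec := invmx J *m delta_mx i 0.
have JJ := pJ.2.
exists (\sum_i dot (u i) (J *m u i)); first exact: sumr_ge0.
move=> t; set q := dot t _; set c := \sum_i _.
have c0 : 0 <= c by exact: sumr_ge0.
have cq : 0 <= c * q by rewrite mulr_ge0 ?JJ.
rewrite -(sqr_sqrtr cq) lerXn2r ?nnegrE ?sqrtr_ge0//.
apply: mx_norm_le; rewrite ?sqrtr_ge0// => i j; rewrite ord1.
rewrite -sqrtr_sqr ler_wsqrtr//.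
have -> : t i 0 = dot (u i) (J *m t).
  by rewrite sym_dot ?pJ.1// /u mulmxA mulmxV// mul1mx dotC dot_delta.
apply: le_trans (psd_cauchy_schwarz _ _ pJ) _; rewrite ler_wpM2r ?JJ//.
by rewrite /c (bigD1 i)//= lerDl sumr_ge0.
Qed.

Lemma quadratic_argmin J (c rho : R) t S : J^T = J -> J \in unitmx ->
  (forall t, `|t| ^+ 2 <= c * dot t (J *m t)) -> 0 <= c -> 0 <= rho ->
  c * rho <= 1 / 2 ->
  let Q t := dot t (J *m t) - 2 * dot t S in
  let t0 := invmx J *m S in
  Q t <= rho * `|t| ^+ 2 -> Q t <= Q t0 + rho * (`|t| ^+ 2 + `|t0| ^+ 2) ->
  `|t| <= 4 * c * m%:R * `|S| /\
  `|t - t0| ^+ 2 <= c * rho * (`|t| ^+ 2 + `|t0| ^+ 2).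
Proof.
move=> sJ uJ coer c0 rho0 crho Q t0 Qt Qt0; split.
  have [->|t_neq0] := eqVneq t 0; first by rewrite normr0 !mulr_ge0.
  have tp : 0 < `|t| by rewrite normr_gt0.
  have h1 : dot t (J *m t) <= 2 * (m%:R * (`|t| * `|S|)) + rho * `|t| ^+ 2.
    have := ler_dot t S; have := ler_norm (dot t S); move: Qt; rewrite /Q.
    by move: (dot t (J *m t)) (dot t S) (m%:R * _) (rho * _) => *; lra.
  have h2 : `|t| ^+ 2 <= c * (2 * (m%:R * (`|t| * `|S|)) + rho * `|t| ^+ 2).
    by apply: le_trans (coer t) _; rewrite ler_wpM2l.
  have h3 : c * rho * `|t| ^+ 2 <= 1 / 2 * `|t| ^+ 2.
    by rewrite ler_wpM2r ?sqr_ge0.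
  rewrite -(ler_pM2l tp) -expr2.
  move: h2 h3; rewrite mulrDr [c * (rho * _)]mulrA.
  rewrite (_ : c * (2 * _) = 1 / 2 * (`|t| * (4 * c * m%:R * `|S|))).
    move: (`|t| ^+ 2) (c * rho * _) (`|t| * (4 * c * m%:R * `|S|)) => *; lra.
  move: (`|t|) (`|S|) (m%:R : R) => x y z; lra.
apply: le_trans (coer _) _; rewrite -[leRHS]mulrA ler_wpM2l//.
have JS : J *m t0 = S by rewrite /t0 mulmxA mulmxV// mul1mx.
have e1 : dot t0 (J *m t) = dot t S by rewrite sym_dot// JS dotC.
move: Qt0; rewrite /Q mulmxBr !dotBr !dotBl JS e1.
move: (dot t (J *m t)) (dot t S) (dot t0 S) (rho * _) => *; lra.
Qed.

End quadratic_argmin.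

(** * Triangular arrays of noise *)

Section with_high_probability.
Context {d : measure_display} {T : measurableType d} {R : realType}.
Variable P : probability T R.

Definition vanishing (A : nat -> set T) : Prop :=
  (forall n, measurable (A n)) /\
  forall e : R, 0 < e -> \forall n \near \oo, (P (A n) <= e%:E)%E.

(** Only the exceptional sets are measurable; [Q] itself may quantify over all vectors. Predicates
    on pairs make this a filter, so finitely many such properties can be intersected. *)
Definition whp (Q : set (nat * T)) : Prop :=
  exists2 A, vanishing A &
    \forall n \near \oo, forall w, ~ A n w -> Q (n, w).

Lemma vanishingU A B : vanishing A -> vanishing B ->
  vanishing (fun n => A n `|` B n).
Proof.
move=> [mA vA] [mB vB]; split => [n|e e0]; first exact: measurableU.
have e2 : 0 < e / 2 by rewrite divr_gt0.
near=> n; apply: (le_trans (measureU2 P (mA n) (mB n))).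
rewrite (splitr e) EFinD leeD//.
  by near: n; exact: vA.
by near: n; exact: vB.
Unshelve. all: end_near. Qed.

Lemma vanishing0 : vanishing (fun=> set0).
Proof.
by split=> // e e0; near=> n; rewrite measure0 lee_fin ltW.
Unshelve. all: end_near. Qed.

Global Instance whp_filter : Filter whp.
Proof.
split.
- by exists (fun=> set0); [exact: vanishing0|near=> n].
- move=> Q Q' [A vA AQ] [B vB BQ].
  exists (fun n => A n `|` B n); first exact: vanishingU.
  near=> n => w /not_orP[Aw Bw]; split.
    by have /(_ w Aw) : forall w, ~ A n w -> Q (n, w) by near: n; exact: AQ.
  by have /(_ w Bw) : forall w, ~ B n w -> Q' (n, w) by near: n; exact: BQ.
- move=> Q Q' QQ' [A vA AQ]; exists A => //.
  by apply: filterS AQ => n AQ w /AQ /QQ'.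
Unshelve. all: end_near. Qed.

Lemma whpI (Q Q' : set (nat * T)) : whp Q -> whp Q' -> whp (Q `&` Q').
Proof. by move=> h h'; exact: filterI. Qed.

Lemma whpS (Q Q' : set (nat * T)) : Q `<=` Q' -> whp Q -> whp Q'.
Proof. by move=> QQ'; exact: filterS. Qed.

Lemma whp_forall2 (I I' : finType) (Q : I -> I' -> set (nat * T)) :
  (forall i j, whp (Q i j)) -> whp [set p | forall i j, Q i j p].
Proof.
move=> hQ.
apply: (@filter_forall _ _ (fun i p => forall j, Q i j p) whp) => i.
by apply: (@filter_forall _ _ (Q i) whp) => j; exact: hQ.
Qed.

Lemma whp_eventually (Q : set nat) : (\forall n \near \oo, Q n) ->
  whp [set p | Q p.1].
Proof.
by move=> nQ; exists (fun=> set0); [exact: vanishing0|apply: filterS nQ].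
Qed.

Lemma whp_markov (X : nat -> T -> R) (b : nat -> R) (e : R) : 0 < e ->
  (forall n w, 0 <= X n w) ->
  (forall n, P.-integrable setT (EFin \o X n)) ->
  (forall n, \int[P]_w X n w <= b n) -> b n @[n --> \oo] --> 0 ->
  whp [set p | X p.1 p.2 < e].
Proof.
move=> e0 X0 iX Xb b0.
exists (fun n => [set w | e <= X n w]); last first.
  by near=> n => w /= /negP; rewrite -ltNge.
split=> [n|c c0].
  by apply: measurable_ge_set; exact: measurable_integrable (iX n).
have ce : 0 < c * e by rewrite mulr_gt0.
near=> n; apply: le_trans (markov_real e0 (iX n) (X0 n)) _.
rewrite lee_fin ler_pdivrMr//; apply: le_trans (Xb n) _; apply: ltW.
by near: n; exact: (cvgr_lt (0 : R) b0 _ ce).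
Unshelve. all: end_near. Qed.

Lemma whp_proba (A : nat -> set T) (e : R) : 0 < e ->
  (forall n, measurable (A n)) -> whp [set p | ~ A p.1 p.2] ->
  \forall n \near \oo, (P (A n) <= e%:E)%E.
Proof.
move=> e0 mA [B [mB vB] BA]; near=> n.
have : (P (B n) <= e%:E)%E by near: n; exact: vB.
apply: le_trans; apply: le_measure; rewrite ?inE//.
have BAn : forall w, ~ B n w -> ~ A n w by near: n; exact: BA.
by move=> w Aw; apply: contrapT => /BAn.
Unshelve. all: end_near. Qed.

End with_high_probability.

Section orthogonal_sums.
Context {d : measure_display} {T : measurableType d} {R : realType}.
Variable P : probability T R.

(** Cross terms vanish: each summand is centred and independent of the preceding partial sum. *)
Lemma second_moment_sum (X : nat -> T -> R) n :
  (forall k, (k < n)%N -> measurable_fun setT (X k)) ->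
  (forall k, (k < n)%N ->
     P.-integrable setT (EFin \o (fun w => X k w ^+ 2))) ->
  (forall k, (k < n)%N -> \int[P]_w X k w = 0) ->
  (forall k, (k < n)%N ->
     independent_funs P (fun w => \sum_(i < k) X i w) (X k)) ->
  P.-integrable setT (EFin \o (fun w => (\sum_(k < n) X k w) ^+ 2)) /\
  \int[P]_w (\sum_(k < n) X k w) ^+ 2 = \sum_(k < n) \int[P]_w (X k w ^+ 2).
Proof.
elim: n => [|n ih] mX X2 EX iX.
  under eq_Rintegral do rewrite big_ord0 expr0n/=.
  under [X in EFin \o X]eq_fun do rewrite big_ord0 expr0n/=.
  by rewrite big_ord0 Rintegral_cstP; split => //; exact: integrable_cstr.
have [i2 E2] := ih (fun k kn => mX k (ltnW kn)) (fun k kn => X2 k (ltnW kn))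
  (fun k kn => EX k (ltnW kn)) (fun k kn => iX k (ltnW kn)).
pose S w := \sum_(k < n) X k w.
have mS : measurable_fun setT S.
  by apply: measurable_sum => i; apply: mX; rewrite ltnS ltnW.
have sE w : (\sum_(k < n.+1) X k w) ^+ 2 =
    S w ^+ 2 + 2 * (S w * X n w) + X n w ^+ 2.
  by rewrite big_ord_recr/= sqrrD -mulr_natl.
under eq_Rintegral do rewrite sE.
under [X in EFin \o X]eq_fun do rewrite sE.
have mXn := mX n (ltnSn n); have X2n := X2 n (ltnSn n).
have iSX := integrable_mul mS mXn i2 X2n.
have i2SX := integrableZr 2 iSX.
split; first by apply: integrableDr => //; exact: integrableDr.
rewrite !RintegralD//; last exact: integrableDr.
rewrite RintegralZl// big_ord_recr/= -E2.
rewrite (@Rintegral_independentM _ _ _ P S (X n))//.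
- by rewrite EX// !mulr0 addr0.
- exact: integrable_square.
- exact: integrable_square.
- exact: iX.
Qed.

End orthogonal_sums.

Section limits.
Context {R : realType}.

Lemma cvg_natinv_mul (K : R) : n%:R^-1 * K @[n --> \oo] --> 0.
Proof.
apply/cvgrPdist_lt => e e0.
pose N := Num.bound (`|K| / e).
have rN : `|K| / e < N%:R.
  by apply: archi_boundP; rewrite divr_ge0// ltW.
near=> n; have n0 : (0 < n)%N by near: n; exact: nbhs_infty_gt.
rewrite sub0r normrN normrM ger0_norm ?invr_ge0// mulrC ltr_pdivrMr ?ltr0n//.
rewrite mulrC -ltr_pdivrMr//; apply: lt_le_trans rN _.
by rewrite ler_nat; near: n; exact: nbhs_infty_ge.
Unshelve. all: end_near. Qed.

Lemma small_factor (K rho : R) : 0 <= K -> 0 < rho ->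
  exists eta, [/\ 0 < eta, eta <= 1 & K * eta <= rho].
Proof.
move=> K0 rho0; have K1 : 0 < K + 1 by rewrite ltr_wpDl.
exists (Num.min 1 (rho / (K + 1))); split.
- by rewrite lt_min ltr01 divr_gt0.
- by rewrite ge_min lexx.
- apply: le_trans (_ : (K + 1) * (rho / (K + 1)) <= _).
    by apply: ler_pM => //; rewrite ?lerDl ?ge_min ?lexx ?orbT// le_min ler01 divr_ge0// ltW.
  by rewrite mulrC divfK ?gt_eqF.
Qed.

End limits.

(** * Laws of large numbers and characteristic functions for an error array *)

Section noise_array.
Context {d : measure_display} {T : measurableType d} {R : realType}.
(** Entry k of row n belongs to time (k + 1) / n. Independence is required after arbitrary
    transformations [f i] since it also serves for weighted errors and centred absolute values; the
    last field plays the role of a Lindeberg condition. *)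
Record noise_array (P : probability T R) (xi : nat -> nat -> T -> R)
    (v : R -> R) (C : R) : Prop := NoiseArray {
  noise_v_le : forall t, 0 <= t <= 1 -> 0 <= v t <= C;
  noise_measurable : forall n k, (k < n)%N -> measurable_fun setT (xi n k);
  noise_square : forall n k, (k < n)%N ->
    P.-integrable setT (EFin \o (fun w => xi n k w ^+ 2));
  noise_mean : forall n k, (k < n)%N -> \int[P]_w xi n k w = 0;
  noise_variance : forall n k, (k < n)%N ->
    \int[P]_w (xi n k w ^+ 2) = v (obs_time n k.+1);
  noise_independent : forall n (f : nat -> R -> R),
    (forall i, measurable_fun setT (f i)) -> forall k, (k < n)%N ->
    independent_funs P (fun w => \sum_(i < k) f i (xi n i w))
      (fun w => f k (xi n k w));
  noise_uniform : forall e : R, 0 < e -> exists2 a0 : R, 0 < a0 &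
    forall a n k, 0 <= a -> a <= a0 -> (k < n)%N ->
      \int[P]_w trunc_sqr a (xi n k w) <= e }.

Variables (P : probability T R) (xi : nat -> nat -> T -> R) (v : R -> R).
Variable C : R.
Hypothesis N : noise_array P xi v C.

Let v_le := noise_v_le N.
Let xi_measurable := noise_measurable N.
Let xi_square := noise_square N.
Let xi_mean := noise_mean N.
Let xi_variance := noise_variance N.
Let xi_independent := noise_independent N.
Let xi_uniform := noise_uniform N.

Lemma noise_bound_ge0 : 0 <= C.
Proof.
have [] := andP (noise_v_le N (t := 0) _); first by rewrite lexx ler01.
exact: le_trans.
Qed.

Let C0 := noise_bound_ge0.

Let v_obs n k : (k < n)%N -> 0 <= v (obs_time n k.+1) <= C.
Proof. by move=> /(obs_time_in R) kn; apply: v_le; rewrite in_itv in kn. Qed.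

Let xi_integrable n k : (k < n)%N -> P.-integrable setT (EFin \o xi n k).
Proof. by move=> kn; apply: integrable_square; [exact: xi_measurable|exact: xi_square]. Qed.

Lemma weighted_sum_moment n (c : nat -> R) (B : R) :
  (forall k, (k < n)%N -> `|c k| <= B) ->
  P.-integrable setT (EFin \o (fun w => (\sum_(k < n) c k * xi n k w) ^+ 2)) /\
  \int[P]_w (\sum_(k < n) c k * xi n k w) ^+ 2 <= n%:R * (B ^+ 2 * C).
Proof.
move=> cB.
have sqE k : (fun w => (c k * xi n k w) ^+ 2) =
  (fun w => c k ^+ 2 * xi n k w ^+ 2) by apply/funext => w; rewrite exprMn.
have [|k kn|k kn|k kn|i2 E2] :=
    @second_moment_sum _ _ _ P (fun k w => c k * xi n k w) n.
- by move=> k kn; apply: measurable_funM => //; exact: xi_measurable.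
- by rewrite sqE; apply: integrableZr; exact: xi_square.
- by rewrite RintegralZl ?xi_mean ?mulr0//; exact: xi_integrable.
- apply: (@xi_independent n (fun i x => c i * x)) => // i.
  exact: measurable_funM.
split => //; rewrite E2 mulr_natl -[n in leRHS]card_ord -sumr_const.
apply: ler_sum => k _; rewrite sqE RintegralZl//; last exact: xi_square.
rewrite xi_variance//; have /andP[v0 vC] := v_obs (ltn_ord k).
apply: ler_pM => //; first exact: sqr_ge0.
rewrite -real_normK ?num_real// ler_pXn2r ?nnegrE//; first exact: cB.
exact: le_trans (cB _ (ltn_ord k)).
Qed.

Let mean_square (n : nat) (X : T -> R) (K : R) :
  P.-integrable setT (EFin \o (fun w => X w ^+ 2)) ->
  \int[P]_w X w ^+ 2 <= n%:R * K ->
  P.-integrable setT (EFin \o (fun w => (n%:R^-1 * X w) ^+ 2)) /\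
  \int[P]_w (n%:R^-1 * X w) ^+ 2 <= n%:R^-1 * K.
Proof.
move=> i2 E2.
have sqE : (fun w => (n%:R^-1 * X w) ^+ 2) = (fun w => n%:R^-2 * X w ^+ 2).
  by apply/funext => w; rewrite exprMn exprVn.
rewrite sqE; split; first exact: integrableZr.
rewrite RintegralZl//; case: n E2 {sqE} => [|n] E2.
  by rewrite expr0n/= invr0 !mul0r.
apply: le_trans (_ : n.+1%:R ^- 2 * (n.+1%:R * K) <= _).
  by rewrite ler_wpM2l// invr_ge0 exprn_ge0.
have : n.+1%:R != 0 :> R by rewrite pnatr_eq0.
move: (n.+1%:R : R) => y y0.
by rewrite [leLHS](_ : _ = y^-1 * K)//; field.
Qed.

Let sqr_lt (x e : R) : 0 < e -> x ^+ 2 < e ^+ 2 -> `|x| < e.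
Proof.
move=> e0 xe; rewrite -ltr_sqr ?nnegrE ?(ltW e0)//.
by rewrite real_normK ?num_real.
Qed.

Lemma lln_weighted (c : nat -> nat -> R) (B e : R) : 0 < e ->
  (forall n k, (k < n)%N -> `|c n k| <= B) ->
  whp P [set p | `|p.1%:R^-1 * \sum_(k < p.1) c p.1 k * xi p.1 k p.2| < e].
Proof.
move=> e0 cB.
have h n := @weighted_sum_moment n (c n) B (cB n).
have e2 : 0 < e ^+ 2 by rewrite exprn_gt0.
have := @whp_markov _ _ _ P
  (fun n w => (n%:R^-1 * \sum_(k < n) c n k * xi n k w) ^+ 2)
  (fun n => n%:R^-1 * (B ^+ 2 * C)) (e ^+ 2) e2
  (fun n w => sqr_ge0 _) (fun n => (mean_square (h n).1 (h n).2).1)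
  (fun n => (mean_square (h n).1 (h n).2).2) (cvg_natinv_mul _).
by apply: whpS => p /=; exact: sqr_lt.
Qed.

(** Absolute errors have mean at most C + 1, because |x| <= x^2 + 1, and variance at most C, so
    Chebyshev leaves a deviation below 1. Multiplied by a uniform bound on signal differences, this
    replaces a uniform law of large numbers. *)
Lemma lln_abs :
  whp P [set p | p.1%:R^-1 * \sum_(k < p.1) `|xi p.1 k p.2| <= C + 2].
Proof.
pose b n k := \int[P]_w `|xi n k w|.
pose f n k (x : R) : R := `|x| - b n k.
have mf n k : measurable_fun setT (f n k).
  by apply: measurable_funB => //; exact: measurable_normr.
have iabs n k : (k < n)%N -> P.-integrable setT (EFin \o (fun w => `|xi n k w|)).
  move=> kn; apply: (dominated_integrable _ (xi_integrable kn)) => [|x].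
    by apply: measurableT_comp => //; exact: xi_measurable.
  by rewrite normr_id.
have b_ge0 n k : 0 <= b n k by apply: Rintegral_ge0.
have b_le n k : (k < n)%N -> b n k <= C + 1.
  move=> kn; have /andP[v0 vC] := v_obs kn.
  apply: le_trans (_ : \int[P]_w (xi n k w ^+ 2 + 1) <= _).
    apply: le_Rintegral => //; first exact: iabs.
      by apply: integrableDr; [exact: xi_square|exact: integrable_cstr].
    move=> x _; rewrite -(real_normK (num_real (xi n k x))).
    by have := sqr_ge0 (`|xi n k x| - 1); move: (`|_|) => y; nra.
  rewrite RintegralD//; [|exact: xi_square|exact: integrable_cstr].
  by rewrite Rintegral_cstP xi_variance// lerD2r.
have i2 n k : (k < n)%N ->
    P.-integrable setT (EFin \o (fun w => f n k (xi n k w) ^+ 2)).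
  move=> kn.
  apply: (dominated_integrable _ (integrableDr (integrableZr 2 (xi_square kn))
    (integrable_cstr P (2 * b n k ^+ 2)))).
    apply: measurable_funX; apply: measurableT_comp (mf _ _) _.
    exact: xi_measurable.
  move=> w; rewrite ger0_norm ?sqr_ge0// (le_trans _ (ler_norm _))//.
  rewrite -(real_normK (num_real (xi n k w))) /f.
  by have := sqr_ge0 (`|xi n k w| + b n k); move: (`|_|) (b n k) => y z; nra.
have E2 n k : (k < n)%N -> \int[P]_w (f n k (xi n k w) ^+ 2) <= C.
  move=> kn; have /andP[v0 vC] := v_obs kn.
  have -> : (fun w => f n k (xi n k w) ^+ 2) =
      (fun w => xi n k w ^+ 2 + (- (2 * b n k) * `|xi n k w| + b n k ^+ 2)).
    apply/funext => w; rewrite /f -(real_normK (num_real (xi n k w))); ring.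
  have ic := integrable_cstr P (b n k ^+ 2).
  have ia := integrableZr (- (2 * b n k)) (iabs n k kn).
  rewrite !RintegralD//; last 2 first.
    exact: xi_square.
    exact: integrableDr.
  rewrite RintegralZl ?iabs// Rintegral_cstP xi_variance// -/(b n k).
  have := sqr_ge0 (b n k); move: (b n k) (v _) vC => y z; nra.
have h n := @second_moment_sum _ _ _ P (fun k w => f n k (xi n k w)) n
  (fun k kn => measurableT_comp (mf n k) (xi_measurable kn)) (i2 n).
have {}h n : P.-integrable setT (EFin \o (fun w => (\sum_(k < n) f n k (xi n k w)) ^+ 2)) /\
    \int[P]_w (\sum_(k < n) f n k (xi n k w)) ^+ 2 <= n%:R * C.
  have [k kn|k kn|j1 j2] := h n.
  - rewrite RintegralB//; [|exact: iabs|exact: integrable_cstr].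
    by rewrite Rintegral_cstP subrr.
  - exact: (@xi_independent n (f n)).
  split => //; rewrite j2 mulr_natl -[n in leRHS]card_ord -sumr_const.
  by apply: ler_sum => k _; exact: E2.
have := @whp_markov _ _ _ P
  (fun n w => (n%:R^-1 * \sum_(k < n) f n k (xi n k w)) ^+ 2)
  (fun n => n%:R^-1 * C) (1 ^+ 2) (exprn_gt0 _ ltr01)
  (fun n w => sqr_ge0 _) (fun n => (mean_square (h n).1 (h n).2).1)
  (fun n => (mean_square (h n).1 (h n).2).2) (cvg_natinv_mul _).
apply: whpS => -[n w] /=.
move=> /(sqr_lt ltr01) /ltr_normlP[_].
rewrite sumrB mulrBr ltrBlDr => /ltW /le_trans; apply.
rewrite (_ : C + 2 = 1 + (C + 1)); last by ring.
rewrite lerD2l; case: n => [|n]; first by rewrite invr0 mul0r addr_ge0.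
rewrite mulrC ler_pdivrMr ?ltr0n// mulr_natr -[n.+1 in leRHS]card_ord -sumr_const.
by apply: ler_sum => k _; exact: b_le.
Qed.

(** The summands carry the factor 1/sqrt n, so each replacement error is 1/n times a quantity that
    tends to 0 uniformly over the row, and the n errors together vanish. *)
Lemma char_fun_weighted (c : nat -> nat -> R) (B L x : R) :
  (forall n k, (k < n)%N -> `|c n k| <= B) ->
  n%:R^-1 * (\sum_(k < n) c n k ^+ 2 * v (obs_time n k.+1)) @[n --> \oo] --> L ->
  \int[P]_w cos (x + (Num.sqrt n%:R)^-1 * \sum_(k < n) c n k * xi n k w)
    @[n --> \oo] --> expR (- (L / 2)) * cos x.
Proof.
move=> cB cL.
have B0 : 0 <= B by apply: le_trans (cB 1%N 0%N isT).
pose X n k w := ((Num.sqrt n%:R)^-1 * c n k) * xi n k w.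
pose s n k := n%:R^-1 * (c n k ^+ 2 * v (obs_time n k.+1)).
have sq2 n : (Num.sqrt n%:R)^-1 ^+ 2 = n%:R^-1 :> R.
  by rewrite exprVn sqr_sqrtr.
have XE n k w : X n k w ^+ 2 = (n%:R^-1 * c n k ^+ 2) * xi n k w ^+ 2.
  by rewrite /X !exprMn sq2.
have bound n : `|\int[P]_w cos (x + \sum_(k < n) X n k w) -
      expR (- ((\sum_(k < n) s n k) / 2)) * cos x| <=
    \sum_(k < n) (3 * \int[P]_w trunc_sqr 1 (X n k w) + s n k ^+ 2).
  apply: char_fun_sum => k kn.
  - by apply: measurable_funM => //; exact: xi_measurable.
  - under [F in EFin \o F]eq_fun do rewrite XE.
    by apply: integrableZr; exact: xi_square.
  - by rewrite RintegralZl ?xi_mean ?mulr0//; exact: xi_integrable.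
  - under eq_Rintegral do rewrite XE.
    rewrite RintegralZl//; last exact: xi_square.
    by rewrite (xi_variance kn) /s -!mulrA.
  - apply: (@xi_independent n (fun i y => (Num.sqrt n%:R)^-1 * c n i * y)) => // i.
    exact: measurable_funM.
have sum_sE n : \sum_(k < n) s n k =
    n%:R^-1 * (\sum_(k < n) c n k ^+ 2 * v (obs_time n k.+1)).
  by rewrite mulr_sumr.
have SE n w : \sum_(k < n) X n k w =
    (Num.sqrt n%:R)^-1 * \sum_(k < n) c n k * xi n k w.
  by rewrite mulr_sumr; apply: eq_bigr => k _; rewrite /X mulrA.
have lim1 : expR (- ((\sum_(k < n) s n k) / 2)) * cos x @[n --> \oo] -->
    expR (- (L / 2)) * cos x.
  have lim0 : - ((\sum_(k < n) s n k) / 2) @[n --> \oo] --> - (L / 2).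
    apply: cvgN; apply: cvgM; last exact: cvg_cst.
    by under eq_fun do rewrite sum_sE; exact: cL.
  apply: cvgM; last exact: cvg_cst.
  exact: (cvg_comp _ _ lim0 (@continuous_expR R _)).
apply/cvgrPdist_le => /= e e0.
(* After the factors 3 and c^2 <= B^2 this leaves e / 4 per summand, up to 1/n; the squared variance
   accounts for another e / 4. The + 1 guards against B = 0. *)
have [a0 a00 ha0] := @xi_uniform (e / (12 * (B ^+ 2 + 1)))
   (divr_gt0 e0 (mulr_gt0 (ltr0n _ 12) (ltr_wpDl (sqr_ge0 B) ltr01))).
have e4 : 0 < e / 4 by rewrite divr_gt0.
have e2 : 0 < e / 2 by rewrite divr_gt0.
have a02 : 0 < a0 ^+ 2 by rewrite exprn_gt0.
near=> n.
have n0 : (0 < n)%N by near: n; exact: nbhs_infty_gt.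
have nR0 : 0 < n%:R :> R by rewrite ltr0n.
have h1 : `|expR (- (L / 2)) * cos x -
    expR (- ((\sum_(k < n) s n k) / 2)) * cos x| < e / 2.
  by near: n; move/cvgrPdist_lt : lim1; apply.
have h2 : n%:R^-1 * (B ^+ 2 * C) ^+ 2 < e / 4.
  by near: n; exact: (cvgr_lt (0 : R) (cvg_natinv_mul _) _ e4).
have h3 : n%:R^-1 * B ^+ 2 < a0 ^+ 2.
  by near: n; exact: (cvgr_lt (0 : R) (cvg_natinv_mul _) _ a02).
have h4 : (Num.sqrt n%:R)^-1 * B <= a0.
  rewrite -ler_sqr ?nnegrE ?(ltW a00)// ?mulr_ge0 ?invr_ge0 ?sqrtr_ge0//.
  by rewrite exprMn sq2 ltW.
have := bound n; under eq_Rintegral do rewrite SE.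
set p := expR (- (L / 2)) * cos x in h1 *.
set q := expR (- ((\sum_(k < n) s n k) / 2)) * cos x in h1 *.
set r := \int[P]_w cos _ => rq.
have {rq} rq : `|r - q| <= e / 2.
  apply: le_trans rq _.
  apply: le_trans (_ : \sum_(k < n) n%:R^-1 * (e / 2) <= _); last first.
    rewrite -mulr_sumr sumr_const card_ord -[(e / 2) *+ n]mulr_natl.
    by rewrite mulKf ?gt_eqF.
  apply: ler_sum => k _.
  have cBk := cB n k (ltn_ord k).
  have cB2 : c n k ^+ 2 <= B ^+ 2.
    by rewrite -real_normK ?num_real// ler_pXn2r ?nnegrE.
  have /andP[v0 vC] := v_obs (ltn_ord k).
  have k1 : 3 * \int[P]_w trunc_sqr 1 (X n k w) <= n%:R^-1 * (e / 4).
    have -> : (fun w => trunc_sqr 1 (X n k w)) = (fun w =>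
      (n%:R^-1 * c n k ^+ 2) * trunc_sqr `|(Num.sqrt n%:R)^-1 * c n k| (xi n k w)).
      by apply/funext => w; rewrite trunc_sqrZ exprMn sq2.
    rewrite RintegralZl//; last first.
      by apply: integrable_trunc_sqr => //; [exact: xi_measurable|exact: xi_square].
    rewrite mulrCA -[X in X <= _]mulrA ler_wpM2l ?invr_ge0//.
    have : \int[P]_w trunc_sqr `|(Num.sqrt n%:R)^-1 * c n k| (xi n k w) <=
        e / (12 * (B ^+ 2 + 1)).
      apply: ha0 => //; apply: le_trans h4.
      by rewrite normrM ger0_norm ?invr_ge0 ?sqrtr_ge0// ler_wpM2l// invr_ge0 sqrtr_ge0.
    have : 0 <= \int[P]_w trunc_sqr `|(Num.sqrt n%:R)^-1 * c n k| (xi n k w).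
      by apply: Rintegral_ge0 => w _; exact: trunc_sqr_ge0.
    move: (\int[P]_w _) => y y0 ye.
    apply: le_trans (_ : B ^+ 2 * (3 * (e / (12 * (B ^+ 2 + 1)))) <= _).
      by apply: ler_pM; rewrite ?sqr_ge0 ?mulr_ge0// ler_wpM2l.
    have B1 : 0 < B ^+ 2 + 1 by rewrite ltr_wpDl ?sqr_ge0.
    rewrite [leLHS](_ : _ = (B ^+ 2 * e) / 4 / (B ^+ 2 + 1)); last first.
      by field; rewrite gt_eqF.
    rewrite ler_pdivrMr// -subr_ge0.
    rewrite (_ : _ - _ = e / 4); last by ring.
    exact: ltW.
  have k2 : s n k ^+ 2 <= n%:R^-1 * (e / 4).
    apply: le_trans (_ : n%:R^-1 * (n%:R^-1 * (B ^+ 2 * C) ^+ 2) <= _).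
      rewrite /s exprMn expr2 -mulrA ler_wpM2l ?invr_ge0// ler_wpM2l ?invr_ge0//.
      have cv0 : 0 <= c n k ^+ 2 * v (obs_time n k.+1).
        by apply: mulr_ge0 => //; exact: sqr_ge0.
      have cvB : c n k ^+ 2 * v (obs_time n k.+1) <= B ^+ 2 * C.
        by apply: ler_pM => //; exact: sqr_ge0.
      by rewrite ler_pXn2r ?nnegrE// (le_trans cv0).
    by rewrite ler_wpM2l ?invr_ge0// ltW.
  by apply: le_trans (lerD k1 k2) _; rewrite -mulrDr ler_wpM2l ?invr_ge0//; lra.
rewrite (_ : p - r = (p - q) - (r - q)); last by ring.
rewrite (splitr e); apply: le_trans (ler_normB _ _) _.
by apply: lerD => //; exact: ltW.
Unshelve. all: end_near. Qed.

End noise_array.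

(** * Least squares with triangular noise *)

Section continuity_within_products.
Context {X Y Z : topologicalType}.
Variables (A : set X) (B : set Y) (F : X * Y -> Z).
Hypothesis cF : {within A `*` B, continuous F}.

Lemma within_cvg x y : A x -> B y ->
  F p @[p --> within (A `*` B) (nbhs (x, y))] --> F (x, y).
Proof. by move=> Ax By; move/subspace_continuousP : cF; apply. Qed.

Lemma within_cvg_swap x y : A x -> B y ->
  F (p.2, p.1) @[p --> within (B `*` A) (nbhs (y, x))] --> F (x, y).
Proof.
move=> Ax By; apply: cvg_comp (within_cvg Ax By) => W [[V1 V2] /= [nV1 nV2] VW].
exists (V2, V1) => //= -[b a] /= [V2b V1a] [Bb Aa].
by apply: (VW (a, b)).
Qed.

Lemma within_continuousl y : B y -> {within A, continuous (fun x => F (x, y))}.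
Proof.
move=> By; apply/subspace_continuousP => x Ax.
apply: cvg_comp (within_cvg Ax By) => W [[V1 V2] /= [nV1 nV2] VW].
apply: filterS nV1 => a V1a Aa; apply: (VW (a, y)) => //.
by split => //; exact: nbhs_singleton.
Qed.

Lemma within_continuousr x : A x -> {within B, continuous (fun y => F (x, y))}.
Proof.
move=> Ax; apply/subspace_continuousP => y By.
apply: cvg_comp (within_cvg Ax By) => W [[V1 V2] /= [nV1 nV2] VW].
apply: filterS nV2 => b V2b Bb; apply: (VW (x, b)) => //.
by split => //; exact: nbhs_singleton.
Qed.

End continuity_within_products.

Section unit_interval.
Context {R : realType}.
Local Notation mu := (@lebesgue_measure R).

Lemma sqr_le_norm (x y : R) : `|x| <= y -> x ^+ 2 <= y ^+ 2.
Proof.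
move=> xy; rewrite -real_normK ?num_real// ler_pXn2r ?nnegrE//.
exact: le_trans xy.
Qed.

Lemma within_bounded (V : normedModType R) (g : R -> V) :
  {within `[0, 1], continuous g} ->
  exists2 B : R, 0 <= B & forall t, 0 <= t <= 1 -> `|g t| <= B.
Proof.
move=> cg; have cn : {within `[0, 1], continuous (fun t => `|g t|)}.
  by move=> t; apply: cvg_norm; exact: cg.
have [c _ gc] := EVT_max (@ler01 R) cn.
by exists `|g c| => // t t01; apply: gc; rewrite in_itv.
Qed.

Lemma riemann_sum_ord (f : R -> R) : {within `[0, 1], continuous f} ->
  n%:R^-1 * (\sum_(k < n) f (obs_time n k.+1)) @[n --> \oo] -->
  \int[mu]_(t in `[0, 1]) f t.
Proof.
move=> /riemann_sum; under eq_fun do rewrite big_add1 big_mkord.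
exact.
Qed.

Lemma integral_sqr_gt0 (f : R -> R) : {within `[0, 1], continuous f} ->
  ~ {ae mu, forall t, t \in `[0, 1] -> f t = 0} ->
  0 < \int[mu]_(t in `[0, 1]) (f t ^+ 2).
Proof.
move=> cf; have cf2 : {within `[0, 1], continuous (fun t => f t ^+ 2)}.
  by move=> t; apply: cvgM; exact: cf.
have i2 : mu.-integrable `[0, 1] (EFin \o (fun t => f t ^+ 2)).
  by apply: continuous_compact_integrable => //; exact: segment_compact.
apply: contra_notP => /negP; rewrite -leNgt => I0.
have {I0} I0 : \int[mu]_(t in `[0, 1]) (f t ^+ 2) = 0.
  apply/eqP; rewrite eq_le I0/=; apply: Rintegral_ge0 => t _; exact: sqr_ge0.
pose F := EFin \o (fun t => f t ^+ 2).
have : (\int[mu]_(t in `[0%R, 1%R]) `|F t| = 0)%E.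
  transitivity (\int[mu]_(t in `[0%R, 1%R]) F t)%E.
    by apply: eq_integral => t _; rewrite /F/= ger0_norm ?sqr_ge0.
  have := congr1 EFin I0; rewrite /Rintegral fineK//.
  exact: integrable_fin_num.
move/ae_eq_integral_abs => /(_ _ (measurable_int _ i2)) [//|N [mN N0 sN]].
exists N; split => // t /= Ht; apply: sN => /= H; apply: Ht => t01.
have := H t01 => /= /eqP; rewrite eqe => /eqP/eqP.
by rewrite sqrf_eq0 => /eqP.
Qed.

End unit_interval.

Section gram_limits.
Context {R : realType} {m : nat}.
Local Notation vec := 'cV[R]_m.
Variables (w : nat -> nat -> R) (G : nat -> nat -> vec) (S : 'M[R]_m).
Hypothesis S_lim : forall i j,
  n%:R^-1 * (\sum_(k < n) w n k * (G n k *m (G n k)^T) i j)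
    @[n --> \oo] --> S i j.

Lemma gram_dot u :
  n%:R^-1 * (\sum_(k < n) w n k * dot (G n k) u ^+ 2) @[n --> \oo] -->
  dot u (S *m u).
Proof.
have -> : (fun n => n%:R^-1 * (\sum_(k < n) w n k * dot (G n k) u ^+ 2)) =
    (fun n => \sum_i u i 0 * \sum_j (n%:R^-1 *
      (\sum_(k < n) w n k * (G n k *m (G n k)^T) i j)) * u j 0).
  apply/funext => n.
  pose S' : 'M[R]_m := n%:R^-1 *: \sum_(k < n) w n k *: (G n k *m (G n k)^T).
  transitivity (dot u (S' *m u)).
    rewrite -scalemxAl dotZr mulmx_suml dot_sumr; congr (_ * _).
    by apply: eq_bigr => k _; rewrite -scalemxAl dotZr dot_outer.
  rewrite dotE; apply: eq_bigr => i _; congr (_ * _).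
  rewrite mxE; apply: eq_bigr => j _; congr (_ * _).
  rewrite /S' [LHS]mxE; congr (_ * _); rewrite summxE.
  by apply: eq_bigr => k _; rewrite [LHS]mxE.
rewrite dotE; apply: cvg_sumr => i _; apply: cvgM; first exact: cvg_cst.
rewrite mxE; apply: cvg_sumr => j _; apply: cvgM; last exact: cvg_cst.
exact: S_lim.
Qed.

(** Symmetry and nonnegativity pass to the limit from weighted Gram matrices, so they are not proved
    on the integrals that define the information matrices. *)
Lemma gram_psd : (forall n k, (k < n)%N -> 0 <= w n k) -> psd S.
Proof.
move=> w0; split.
  apply/matrixP => i j; rewrite mxE.
  have h1 := @S_lim i j; have h2 := @S_lim j i.
  rewrite -(cvg_lim (@norm_hausdorff _ R) h1) -(cvg_lim (@norm_hausdorff _ R) h2).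
  congr (lim _); apply/funext => X; congr ((_ @ \oo) X); apply/funext => n.
  congr (_ * _); apply: eq_bigr => k _; congr (_ * _).
  by rewrite !mxE; apply: eq_bigr => l _; rewrite !mxE mulrC.
move=> u; have h := @gram_dot u.
rewrite -(cvg_lim (@norm_hausdorff _ R) h); apply: limr_ge.
  by apply/cvg_ex; exists (dot u (S *m u)).
near=> n; rewrite mulr_ge0 ?invr_ge0//; apply: sumr_ge0 => k _.
by rewrite mulr_ge0 ?sqr_ge0// w0.
Unshelve. all: end_near. Qed.

End gram_limits.

Section probability_bounds.
Context {d : measure_display} {T : measurableType d} {R : realType}.
Variable P : probability T R.

Lemma whp_le_proba (E F : nat -> set T) (b e : R) : 0 < e ->
  (forall n, measurable (E n)) -> (forall n, measurable (F n)) ->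
  (forall n, (P (F n) <= b%:E)%E) ->
  whp P [set p | E p.1 p.2 -> F p.1 p.2] ->
  \forall n \near \oo, (P (E n) <= (b + e)%:E)%E.
Proof.
move=> e0 mE mF Fb hEF.
have EF : whp P [set p | ~ (E p.1 `\` F p.1) p.2].
  by apply: whpS hEF => p /= h [/h].
near=> n.
have h : (P (E n `\` F n) <= e%:E)%E.
  near: n; apply: whp_proba EF => // n; exact: measurableD.
apply: le_trans (_ : P (F n `|` (E n `\` F n)) <= _)%E.
  apply: le_measure; rewrite ?inE//.
    by apply: measurableU => //; exact: measurableD.
  by move=> x Ex; have [Fx|Fx] := pselect (F n x); [left|right].
apply: le_trans (measureU2 P (mF n) (measurableD (mE n) (mF n))) _.
by rewrite EFinD; apply: leeD => //; exact: Fb.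
Unshelve. all: end_near. Qed.

Lemma cos_lipschitz (x y : R) : `|cos x - cos y| <= `|x - y|.
Proof.
wlog xy : x y / y <= x => [h|].
  by have [/h//|/ltW/h] := leP y x; rewrite distrC [leRHS]distrC.
have [c _ ->] := @MVT_segment R cos (fun z => - sin z) y x xy
  (fun x _ => is_derive_cos x) (continuous_subspaceT (@continuous_cos R)).
rewrite normrM normrN ler_piMl// ler_norml.
by rewrite sin_geN1 sin_le1.
Qed.

Lemma Rintegral_cos_close (A B : T -> R) (e : R) : 0 <= e ->
  measurable_fun setT A -> measurable_fun setT B ->
  `|\int[P]_w cos (A w) - \int[P]_w cos (B w)| <=
    e + 2 * fine (P [set w | (e <= `|A w - B w|)%R]).
Proof.
move=> e0 mA mB; rewrite -[2]mulr1; apply: Rintegral_close_off => //.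
- exact: measurableT_comp (@measurable_cos R) mA.
- exact: measurableT_comp (@measurable_cos R) mB.
- by apply: measurable_ge_set; apply: measurableT_comp => //; exact: measurable_funB.
- by move=> w; exact: normr_cos_le1.
- by move=> w; exact: normr_cos_le1.
- move=> w /= /negP; rewrite -ltNge => /ltW; apply: le_trans.
  exact: cos_lipschitz.
Qed.

End probability_bounds.

Section contrast_excess.
Context {T : Type} {R : realType} {m : nat}.
Variables (xi : nat -> nat -> T -> R) (f : R -> 'cV[R]_m -> R).
Variable thetas : 'cV[R]_m.

Definition signal_gap n k theta : R :=
  f (obs_time n k.+1) theta - f (obs_time n k.+1) thetas.

(* [n (M_n theta - M_n thetas)] in the paper's notation. *)
Definition contrast_excess n theta w : R :=
  \sum_(k < n) (signal_gap n k theta ^+ 2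
    - 2 * (xi n k w * signal_gap n k theta)).

Lemma contrast_excess_thetas n w : contrast_excess n thetas w = 0.
Proof.
by apply: big1 => k _; rewrite /signal_gap subrr mulr0 expr0n/= mulr0 subrr.
Qed.

End contrast_excess.

Section regression.
Context {d : measure_display} {T : measurableType d} {R : realType} {m : nat}.
Local Notation vec := 'cV[R]_m.
Local Notation mm := (m%:R : R).
Local Notation mu := (@lebesgue_measure R).
Variables (P : probability T R) (xi : nat -> nat -> T -> R) (v : R -> R).
Variables (C : R) (Theta U : set vec) (thetas : vec) (f : R -> vec -> R).
Variable thetabar : nat -> T -> vec.
Hypothesis N : noise_array P xi v C.
Hypothesis Theta_compact : compact Theta.
Hypothesis thetas_Theta : Theta thetas.
Hypothesis f_continuous :
  {within `[0, 1] `*` Theta, continuous (fun p : R * vec => f p.1 p.2)}.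
Hypothesis identifiability : forall theta, Theta theta ->
  {ae mu, forall t : R, t \in `[0, 1] -> f t theta = f t thetas} ->
  theta = thetas.
Hypothesis thetabar_measurable : forall n,
  measurable_fun setT (thetabar n : T -> borelCV R m).
Hypothesis thetabar_Theta : forall n w, (0 < n)%N -> Theta (thetabar n w).
Local Notation excess := (contrast_excess xi f thetas).
Hypothesis thetabar_min : forall n w theta, (0 < n)%N -> Theta theta ->
  excess n (thetabar n w) w <= excess n theta w.
Hypothesis U_nbhs : open_nbhs thetas U.
Hypothesis U_Theta : U `<=` Theta.
Hypothesis f_diff : forall t theta, t \in `[0, 1] -> U theta ->
  differentiable (f t) theta.
Hypothesis f_diff2 : forall t theta, t \in `[0, 1] -> U theta ->
  differentiable (gradient (f t)) theta.
Hypothesis gradient_continuous : {within U `*` `[0, 1], continuous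
  (fun p : vec * R => gradient (f p.2) p.1)}.
Hypothesis hessian_continuous : {within U `*` `[0, 1], continuous
  (fun p : vec * R => hessian (f p.2) p.1)}.

Let C0 := noise_bound_ge0 N.

(** If the estimator were in [W], its signal would be within eta of the signal at [theta0]; the
    squared gap between the signals at [theta0] and [thetas] would then dominate the noise terms and
    make the excess positive, against minimality. *)
Lemma separation theta0 : Theta theta0 -> theta0 <> thetas ->
  exists2 W, nbhs theta0 W &
    whp P [set p | ~ W (thetabar p.1 p.2)].
Proof.
move=> th0 th0s; pose D t := f t theta0 - f t thetas.
have cD : {within `[0, 1], continuous D}.
  move=> t; apply: cvgB.
    exact: (within_continuousl f_continuous th0).
  exact: (within_continuousl f_continuous thetas_Theta).
have [B B0 DB] := within_bounded cD.
have cD2 : {within `[0, 1], continuous (fun t => D t ^+ 2)}.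
  by move=> t; apply: cvgM; exact: cD.
have I0 : 0 < \int[mu]_(t in `[0, 1]) (D t ^+ 2).
  apply: integral_sqr_gt0 => // aeD; apply: th0s; apply: identifiability => //.
  have [M [mM M0 sM]] := aeD; exists M; split => // t Ht; apply: sM => H.
  by apply: Ht => t01; apply/eqP; rewrite -subr_eq0; apply/eqP; exact: H.
have := riemann_sum_ord cD2.
move: (\int[mu]_(t in `[0, 1]) _) I0 => I I0 limD.
(* The average excess is at least I/4 from the squared gap, less I/16 from the noise at [theta0] and
   less eta (1 + 2 (C + 2)) <= I/16 from the distance to [theta0]. *)
pose eta : R := Num.min 1 (I / (16 * (1 + 2 * (C + 2)))).
have K0 : 0 < 1 + 2 * (C + 2) by rewrite ltr_wpDr ?mulr_ge0// addr_ge0.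
have eta0 : 0 < eta by rewrite lt_min ltr01/= divr_gt0// mulr_gt0.
have eta1 : eta <= 1 by rewrite ge_min lexx.
have etaI : eta * (1 + 2 * (C + 2)) <= I / 16.
  have : eta <= I / (16 * (1 + 2 * (C + 2))) by rewrite ge_min lexx orbT.
  by rewrite invfM mulrA ler_pdivlMr.
have := @uniform_on_compact R vec R R^o Theta `[0, 1] (fun th t => f t th)
   theta0 eta (@segment_compact _ _ _) eta0 th0.
move=> /(_ (fun t t01 => within_cvg_swap f_continuous t01 th0)) hW.
eexists; first exact: hW.
have I32 : 0 < I / 32 by rewrite divr_gt0.
have I2 : I / 2 < I by rewrite ltr_pdivrMr// ltr_pMr// ltr1n.
have h1 := lln_weighted N I32 (c := fun n k => D (obs_time n k.+1)) (B := B) _.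
have {}h1 := h1 (fun n k kn => DB _ (obs_time_in R kn)).
have h2 := lln_abs N.
have /(whp_eventually P) h3 : \forall n \near \oo,
    I / 2 < n%:R^-1 * (\sum_(k < n) D (obs_time n k.+1) ^+ 2).
  exact: (cvgr_gt I limD _ I2).
have h4 := whp_eventually P (nbhs_infty_gt 0).
apply: whpS (whpI h1 (whpI h2 (whpI h3 h4))) => -[n w] /=.
move=> [k1 [k2 [k3 n0]]] Wn.
have nR0 : 0 < n%:R^-1 :> R by rewrite invr_gt0 ltr0n.
have := thetabar_min w n0 thetas_Theta; rewrite contrast_excess_thetas.
set th := thetabar n w in Wn *.
have Thn : Theta th by exact: thetabar_Theta.
have close k : (k < n)%N -> `|f (obs_time n k.+1) th - f (obs_time n k.+1) theta0| < eta.
  by move=> kn; apply: Wn => //; exact: (obs_time_in R).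
apply/negP; rewrite -ltNge.
rewrite -(pmulr_rgt0 _ nR0).
have : n%:R^-1 * \sum_(k < n) (D (obs_time n k.+1) ^+ 2 / 2 - eta ^+ 2
     - 2 * (D (obs_time n k.+1) * xi n k w) - 2 * (eta * `|xi n k w|)) <=
     n%:R^-1 * excess n th w.
  rewrite ler_wpM2l ?(ltW nR0)// /contrast_excess; apply: ler_sum => k _.
  have := close k (ltn_ord k); rewrite /signal_gap /D.
  set x := xi n k w; set a := f _ th; set b := f _ theta0; set c := f _ thetas.
  move=> ab.
  have : (a - b) ^+ 2 <= eta ^+ 2.
    by apply: sqr_le_norm; exact: ltW.
  have : x * (a - b) <= eta * `|x|.
    apply: le_trans (ler_norm _) _; rewrite normrM mulrC ler_wpM2r//.
    exact: ltW.
  (* This square encodes (x + y)^2 >= x^2 / 2 - y^2 with x = b - c and y = a - b. *)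
  have := sqr_ge0 ((b - c) + 2 * (a - b)).
  move: (eta ^+ 2) (eta * _) => y z; nra.
apply: lt_le_trans.
have nR : n%:R != 0 :> R by rewrite pnatr_eq0 -lt0n.
rewrite !sumrB -mulr_suml -!mulr_sumr sumr_const card_ord.
rewrite -[eta *+ n]mulr_natl.
move: k1 k2 k3.
move: (\sum_(k < n) D (obs_time n k.+1) ^+ 2) => s1.
move: (\sum_(k < n) D (obs_time n k.+1) * xi n k w) => s2.
move: (\sum_(k < n) `|xi n k w|) => s3 k1 k2 k3.
rewrite (_ : n%:R^-1 * _ = (n%:R^-1 * s1) / 2 - eta ^+ 2 - 2 * (n%:R^-1 * s2) -
   2 * (eta * (n%:R^-1 * s3))); last by field.
have {}k2 : eta * (n%:R^-1 * s3) <= eta * (C + 2) by rewrite ler_pM2l.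
have e2 : eta ^+ 2 <= eta by rewrite expr2 ler_piMr// ltW.
move/ltr_normlP : k1 => [_].
move: etaI k2 k3 I0; rewrite mulrDr mulr1.
move: (n%:R^-1 * s1) (n%:R^-1 * s2) (eta * (n%:R^-1 * s3)) => u1 u2 u3.
rewrite [eta * (2 * _)]mulrCA; clearbody eta; move: (eta * (C + 2)) (eta ^+ 2) e2 => *; lra.
Qed.

(** Compactness is used through cluster points: the sets that the estimator lies in with high
    probability, whenever it is in [K], form a filter. If consistency failed, the filter would be
    proper and cluster in [K], which [separation] forbids. *)
Lemma consistency (r : R) : 0 < r ->
  whp P [set p | `|thetabar p.1 p.2 - thetas| < r].
Proof.
move=> r0; pose K := Theta `&` [set th : vec | r <= `|th - thetas|].
have cK : compact K.
  apply: compact_closedI => //.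
  rewrite (_ : [set th : vec | _] = ~` ball thetas r).
    by apply: open_closedC; exact: ball_open.
  apply/seteqP; split => x /=; rewrite -ball_normE /ball_/= distrC leNgt.
    by move/negP.
  by move=> /negP.
pose F (W : set vec) := whp P [set p | K (thetabar p.1 p.2) -> W (thetabar p.1 p.2)].
have FF : Filter F.
  split.
  - by apply: whpS (whp_eventually P (nbhs_infty_gt 0)) => p _ k.
  - by move=> W W' h h'; apply: whpS (whpI h h') => p [hp hp'] /= k; split; auto.
  - by move=> W W' WW' h; apply: whpS h => p /= h k; apply/WW'/h.
have FK : F K by apply: whpS (whp_eventually P (nbhs_infty_gt 0)) => p _ k.
apply: contrapT => notr.
have PF : ProperFilter F.
  (* The empty set belonging to [F] means precisely that the estimator avoids [K] with high
     probability. *)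
  split => // F0; apply: notr.
  apply: whpS (whpI F0 (whp_eventually P (nbhs_infty_gt 0))) => -[n w] /= [k n0].
  rewrite ltNge; apply/negP => rth; apply: k; split => //.
  exact: thetabar_Theta.
have [th [[Th rth] clth]] := cK F PF FK.
have [|W nW hW] := separation Th.
  by move=> ths; move: rth; rewrite ths /= subrr normr0 leNgt r0.
have FW : F (~` W) by apply: whpS hW => p /=.
by have [x []] := clth _ _ FW nW.
Qed.

Let grad t := gradient (f t) thetas.
Let hess t := hessian (f t) thetas.
Let U_thetas : U thetas := U_nbhs.2.

Lemma gradient_within : {within `[0, 1], continuous (fun t => gradient (f t) thetas)}.
Proof. exact: (within_continuousr gradient_continuous U_thetas). Qed.

Lemma hessian_within : {within `[0, 1], continuous (fun t => hessian (f t) thetas)}.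
Proof. exact: (within_continuousr hessian_continuous U_thetas). Qed.

Lemma hessian_uniform (eta : R) : 0 < eta -> exists2 r, 0 < r &
  forall h : vec, `|h| < r -> U (thetas + h) /\
    forall t, t \in `[0, 1] -> `|hessian (f t) (thetas + h) - hess t| < eta.
Proof.
move=> eta0.
have := @uniform_on_compact R vec R 'M[R]_m U `[0, 1]
  (fun th t => hessian (f t) th) thetas eta (@segment_compact _ _ _) eta0 U_thetas.
move=> /(_ (fun t t01 => within_cvg hessian_continuous U_thetas t01)) hU.
have nU : nbhs thetas U by exact: open_nbhs_nbhs.
have /nbhs_ballP[r /= r0 rU] : nbhs thetas (U `&` [set th | U th ->
    forall t, `[0, 1]%classic t -> `|hessian (f t) th - hess t| < eta]).
  exact: filterI.
exists r => // h hr.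
have [|Uh hh] := rU (thetas + h).
  by rewrite -ball_normE /ball_/= opprD addrA subrr sub0r normrN.
by split => // t t01; exact: (hh Uh).
Qed.

Lemma signal_expansion (eta r : R) (h : vec) (t : R) :
  (forall h : vec, `|h| < r -> U (thetas + h) /\
    forall t, t \in `[0, 1] -> `|hessian (f t) (thetas + h) - hess t| < eta) ->
  `|h| < r -> t \in `[0, 1] ->
  `|f t (thetas + h) - f t thetas - dot (grad t) h - dot h (hess t *m h) / 2| <=
  mm ^+ 2 * (eta * `|h| ^+ 2).
Proof.
move=> hr h_r t01.
have ah (a : R) : 0 <= a <= 1 -> `|a *: h| < r.
  move=> /andP[a0 a1]; apply: le_lt_trans h_r.
  by rewrite normrZ ger0_norm// ler_piMl.
apply: taylor2 => a /ah /hr [Uh hh].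
- exact: f_diff.
- exact: f_diff2.
- by apply: ltW; exact: hh.
Qed.

Let G n k : vec := gradient (f (obs_time n k.+1)) thetas.

Variables J Gam : 'M[R]_m.
Hypothesis J_unit : J \in unitmx.
Hypothesis J_lim : forall i j,
  n%:R^-1 * (\sum_(k < n) (G n k *m (G n k)^T) i j) @[n --> \oo] --> J i j.
Hypothesis Gam_lim : forall i j,
  n%:R^-1 * (\sum_(k < n) v (obs_time n k.+1) * (G n k *m (G n k)^T) i j)
    @[n --> \oo] --> Gam i j.

Definition score_sum n w : vec :=
  \sum_(k < n) xi n k w *: gradient (f (obs_time n k.+1)) thetas.

(** The exceptional set is chosen before [h], so the expansion may be evaluated at the random
    increment of the estimator. All randomness enters through sums that do not involve [h]: the
    absolute errors and the error-weighted Hessians. *)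
Lemma excess_expansion (rho : R) : 0 < rho -> exists2 r, 0 < r &
  whp P [set p | forall h : vec, `|h| < r -> U (thetas + h) /\
    `|excess p.1 (thetas + h) p.2
      - (p.1%:R * dot h (J *m h) - 2 * dot h (score_sum p.1 p.2))| <=
    rho * (p.1%:R * `|h| ^+ 2)].
Proof.
move=> rho0; have rho4 : 0 < rho / 4 by rewrite divr_gt0.
have [BG BG0 GB] := within_bounded gradient_within.
have [BH BH0 HB] := within_bounded hessian_within.
have m0 : 0 <= mm by exact: ler0n.
have m2 : 0 <= mm ^+ 2 by exact: sqr_ge0.
pose K2 := mm ^+ 2 * (BH + 1).
have K20 : 0 <= K2 by rewrite mulr_ge0// addr_ge0.
have KK : 0 <= K2 * (K2 + 2 * (mm * BG)) by rewrite !(mulr_ge0, addr_ge0).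
have KC : 0 <= 2 * mm ^+ 2 * (C + 2) by rewrite !mulr_ge0// addr_ge0.
(* Four shares of rho / 4: oscillation of the Hessian against the noise (eta), the two matrix limits
   (eta'), and the terms cubic in h (r0). *)
have [eta [eta0 eta1 etaK]] := small_factor KC rho4.
have [eta' [eta'0 eta'1 etaK']] := small_factor m2 rho4.
have [r0 [r00 r01 r0K]] := small_factor KK rho4.
have [r' r'0 hr'] := hessian_uniform eta0.
exists (Num.min r0 r'); first by rewrite lt_min r00.
have h1 := lln_abs N.
have {}h2 := whp_forall2 (fun i j => lln_weighted N eta'0
  (c := fun n k => hess (obs_time n k.+1) i j) (B := BH)
  (fun n k kn => le_trans (mx_entry_le_norm _ i j) (HB _ (obs_time_in R kn)))).
have h3' i j : \forall n \near \oo, `|J i j - n%:R^-1 *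
    (\sum_(k < n) (grad (obs_time n k.+1) *m (grad (obs_time n k.+1))^T) i j)| < eta'.
  by move/cvgrPdist_lt : (@J_lim i j); apply.
have h3 := whp_forall2 (fun i j => whp_eventually P (h3' i j)).
have h4 := whp_eventually P (nbhs_infty_gt 0).
apply: whpS (whpI h1 (whpI h2 (whpI h3 h4))) => -[n w] /= [k1 [k2 [k3 n0]]] h.
rewrite lt_min => /andP[hr0 hr]; split; first exact: (hr' h hr).1.
have nR0 : 0 < n%:R :> R by rewrite ltr0n.
have nR : n%:R != 0 :> R by rewrite gt_eqF.
pose t k : R := obs_time n k.+1.
pose M1 := \sum_(k < n) grad (t k) *m (grad (t k))^T - n%:R *: J.
pose M2 := \sum_(k < n) xi n k w *: hess (t k).
have M1n : `|M1| <= n%:R * eta'.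
  apply: mx_norm_le => [|i j]; first by rewrite mulr_ge0 ?ltW.
  have := k3 i j; rewrite /M1 !mxE summxE distrC => /ltW.
  rewrite -(ler_pM2l nR0) -{1}(ger0_norm (ltW nR0)) -normrM mulrBr.
  by rewrite mulrA mulfV// mul1r.
have M2n : `|M2| <= n%:R * eta'.
  apply: mx_norm_le => [|i j]; first by rewrite mulr_ge0 ?ltW.
  have := k2 i j => /ltW.
  rewrite -(ler_pM2l nR0) -{1}(ger0_norm (ltW nR0)) -normrM.
  rewrite mulrA mulfV// mul1r /M2 summxE; congr (`|_| <= _).
  by apply: eq_bigr => k _; rewrite [RHS]mxE mulrC.
pose D k : R := signal_gap f thetas n k (thetas + h).
pose g k : R := dot (grad (t k)) h.
pose q k : R := dot h (hess (t k) *m h).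
(* The term xi q is of the same order as the main one: a small h does not help, only the law of
   large numbers for [M2] does. It is therefore added to the sum and subtracted as a whole. *)
have -> : excess n (thetas + h) w
      - (n%:R * dot h (J *m h) - 2 * dot h (score_sum n w)) =
    \sum_(k < n) ((D k ^+ 2 - 2 * (xi n k w * D k))
      - (g k ^+ 2 - 2 * (xi n k w * g k)) + xi n k w * q k)
    + dot h (M1 *m h) - dot h (M2 *m h).
  rewrite mulmxBl dotBr mulmx_suml dot_sumr -scalemxAl dotZr.
  rewrite /M2 mulmx_suml dot_sumr /score_sum dot_sumr.
  rewrite !big_split/= !sumrN !big_split/= !sumrN -!mulr_sumr.
  under [X in _ + (X - _) - _]eq_bigr do rewrite dot_outer.
  under [X in _ - (_ - 2 * X)]eq_bigr do rewrite dotZr dotC.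
  under [X in _ = _ - X]eq_bigr do rewrite -scalemxAl dotZr.
  rewrite /contrast_excess sumrB -mulr_sumr -/D /g /q /t /grad.
  ring.
have bterm k : (k < n)%N -> `|(D k ^+ 2 - 2 * (xi n k w * D k))
      - (g k ^+ 2 - 2 * (xi n k w * g k)) + xi n k w * q k| <=
    rho / 4 * `|h| ^+ 2 + 2 * mm ^+ 2 * eta * `|h| ^+ 2 * `|xi n k w|.
  move=> kn.
  have RB : `|D k - g k - q k / 2| <= mm ^+ 2 * (eta * `|h| ^+ 2).
    exact: signal_expansion hr' hr (obs_time_in R kn).
  have gB : `|g k| <= mm * BG * `|h|.
    apply: le_trans (ler_dot _ _) _; rewrite -mulrA ler_wpM2l// ler_wpM2r//.
    exact: GB (obs_time_in R kn).
  have qB : `|q k| <= mm ^+ 2 * BH * `|h| ^+ 2.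
    apply: le_trans (ler_qform _ _) _; rewrite -mulrA ler_wpM2l//.
    by rewrite ler_wpM2r ?sqr_ge0//; exact: HB (obs_time_in R kn).
  move: (D k) (g k) (q k) RB gB qB => D' g' q' RB gB qB.
  have h1' : `|h| <= 1 by apply: le_trans r01; exact: ltW.
  have DgB : `|D' - g'| <= K2 * `|h| ^+ 2.
    rewrite (_ : D' - g' = (D' - g' - q' / 2) + q' / 2); last by ring.
    apply: le_trans (ler_normD _ _) _.
    rewrite /K2 mulrDr mulr1 mulrDl addrC; apply: lerD.
      apply: le_trans qB; rewrite normrM ler_piMr// ger0_norm ?invr_ge0//.
      by rewrite invf_le1 ?ler1n.
    apply: le_trans RB _; rewrite ler_wpM2l// ler_piMl ?sqr_ge0//.
  (* The difference of squares is of order |h|^3, and the noise now multiplies nothing but the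
     Taylor remainder. *)
  rewrite (_ : _ + xi n k w * q' = (D' - g') * (D' - g' + 2 * g')
     - 2 * xi n k w * (D' - g' - q' / 2)); last by field.
  apply: le_trans (ler_normB _ _) _; rewrite !normrM (@ger0_norm _ 2)//.
  apply: lerD; last first.
    rewrite [leRHS](_ : _ = 2 * `|xi n k w| * (mm ^+ 2 * (eta * `|h| ^+ 2))).
      by rewrite ler_wpM2l// mulr_ge0.
    by ring.
  apply: le_trans (_ : K2 * `|h| ^+ 2 * ((K2 + 2 * (mm * BG)) * `|h|) <= _).
    apply: ler_pM => //; rewrite [leRHS]mulrDl.
    apply: le_trans (ler_normD _ _) _.
    apply: lerD.
      apply: le_trans DgB _; rewrite ler_wpM2l// expr2 ler_piMl//.
    by rewrite normrM ger0_norm// -mulrA ler_wpM2l.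
  rewrite [leLHS](_ : _ = K2 * (K2 + 2 * (mm * BG)) * `|h| * `|h| ^+ 2); last by ring.
  rewrite ler_wpM2r ?sqr_ge0//; apply: le_trans r0K.
  by rewrite ler_wpM2l// ltW.
have xB : \sum_(k < n) `|xi n k w| <= n%:R * (C + 2).
  by rewrite -ler_pdivrMl.
have q1 := ler_qform M1 h; have q2 := ler_qform M2 h.
move: (fun k : 'I_n => bterm k (ltn_ord k)) => {}bterm.
set s := \sum_(k < n) _.
have : `|s| <= \sum_(k < n) (rho / 4 * `|h| ^+ 2 +
    2 * mm ^+ 2 * eta * `|h| ^+ 2 * `|xi n k w|).
  by apply: le_trans (ler_norm_sum _ _ _) _; apply: ler_sum => k _; exact: bterm.
rewrite big_split/= sumr_const card_ord -mulr_sumr.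
rewrite -[(rho / 4 * _) *+ n]mulr_natl; move: s => s sB.
have e2 : 0 <= `|h| ^+ 2 by exact: sqr_ge0.
have q1' : `|dot h (M1 *m h)| <= rho / 4 * (n%:R * `|h| ^+ 2).
  apply: le_trans q1 _.
  apply: le_trans (_ : mm ^+ 2 * (n%:R * eta' * `|h| ^+ 2) <= _).
    by rewrite ler_wpM2l// ler_wpM2r.
  rewrite [leLHS](_ : _ = (mm ^+ 2 * eta') * (n%:R * `|h| ^+ 2)); last by ring.
  by rewrite ler_wpM2r// mulr_ge0.
have q2' : `|dot h (M2 *m h)| <= rho / 4 * (n%:R * `|h| ^+ 2).
  apply: le_trans q2 _.
  apply: le_trans (_ : mm ^+ 2 * (n%:R * eta' * `|h| ^+ 2) <= _).
    by rewrite ler_wpM2l// ler_wpM2r.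
  rewrite [leLHS](_ : _ = (mm ^+ 2 * eta') * (n%:R * `|h| ^+ 2)); last by ring.
  by rewrite ler_wpM2r// mulr_ge0.
have sB' : `|s| <= rho / 2 * (n%:R * `|h| ^+ 2).
  apply: le_trans sB _.
  apply: le_trans (_ : n%:R * (rho / 4 * `|h| ^+ 2) +
    2 * mm ^+ 2 * eta * `|h| ^+ 2 * (n%:R * (C + 2)) <= _).
    by rewrite lerD2l ler_wpM2l// !mulr_ge0// ltW.
  rewrite [leLHS](_ : _ = (rho / 4 + 2 * mm ^+ 2 * (C + 2) * eta) * (n%:R * `|h| ^+ 2)).
    rewrite ler_wpM2r ?mulr_ge0//; move: etaK; move: (2 * _ * _ * eta) => y; lra.
  by ring.
apply: le_trans (ler_normB _ _) _; apply: le_trans (lerD (ler_normD _ _) (lexx _)) _.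
move: q1' q2' sB'; move: (`|dot _ _|) (`|dot _ _|) (`|s|) (n%:R * _ : R) => *; lra.
Qed.

(** * From the quadratic expansion to the limit law of the estimator *)

Definition scaled_score n w : vec :=
  (Num.sqrt n%:R)^-1 *: score_sum n w.

Definition scaled_error n w : vec :=
  Num.sqrt n%:R *: (thetabar n w - thetas).

Let psd_J : psd J.
Proof.
apply: (@gram_psd _ _ (fun _ _ => 1) G) => // i j.
by under eq_fun do under eq_bigr do rewrite mul1r; exact: J_lim.
Qed.

Let psd_Gam : psd Gam.
Proof.
apply: (@gram_psd _ _ (fun n k => v (obs_time n k.+1)) G Gam Gam_lim) => n k /(obs_time_in R); rewrite in_itv/=.
by move=> /(noise_v_le N) /andP[].
Qed.

Let invJ_sym : (invmx J)^T = invmx J.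
Proof. by rewrite trmx_inv psd_J.1. Qed.

(** The squared sup norm is dominated by the sum of squared coordinates, whose mean is computed
    coordinate by coordinate and bounded uniformly in n. *)
Lemma score_second_moment : exists (K : R) (Y : nat -> T -> R),
  [/\ 0 <= K, forall n, P.-integrable setT (EFin \o Y n),
    forall n w, 0 <= Y n w, forall n, \int[P]_w Y n w <= K &
    forall n w, `|scaled_score n w| ^+ 2 <= Y n w].
Proof.
have [B B0 GB] := within_bounded gradient_within.
have GBk i n k : (k < n)%N -> `|G n k i 0| <= B.
  move=> kn; apply: le_trans (mx_entry_le_norm _ _ _) _.
  exact: GB (obs_time_in R kn).
pose Z i n w := scaled_score n w i 0.
have ZE i n w : Z i n w ^+ 2 =
    n%:R^-1 * (\sum_(k < n) G n k i 0 * xi n k w) ^+ 2.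
  rewrite /Z /scaled_score mxE exprMn exprVn sqr_sqrtr// summxE.
  by congr (_ * _ ^+ 2); apply: eq_bigr => k _; rewrite mxE mulrC.
have h i n := @weighted_sum_moment _ _ _ _ _ _ _ N n (fun k => G n k i 0) B (GBk i n).
have iZ i n : P.-integrable setT (EFin \o (fun w => Z i n w ^+ 2)).
  under [F in EFin \o F]eq_fun do rewrite ZE.
  by apply: integrableZr; exact: (h i n).1.
have K0 : 0 <= B ^+ 2 * C by rewrite mulr_ge0 ?sqr_ge0.
exists (mm * (B ^+ 2 * C)), (fun n w => \sum_(i < m) Z i n w ^+ 2); split.
- by rewrite mulr_ge0.
- by move=> n; apply: integrable_sumr => i _.
- by move=> n w; apply: sumr_ge0 => i _; exact: sqr_ge0.
- move=> n; rewrite Rintegral_sum// mulr_natl (_ : _ *+ m = \sum_(i < m) B ^+ 2 * C).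
    apply: ler_sum => i _; under eq_Rintegral do rewrite ZE.
    rewrite RintegralZl//; last exact: (h i n).1.
    case: n {GBk ZE iZ} h => [|n] h; first by rewrite invr0 mul0r.
    by rewrite ler_pdivrMl ?ltr0n//; exact: (h i n.+1).2.
  by rewrite sumr_const card_ord.
- move=> n w; have Y0 : 0 <= \sum_(i < m) Z i n w ^+ 2.
    by apply: sumr_ge0 => i _; exact: sqr_ge0.
  rewrite -(sqr_sqrtr Y0) ler_pXn2r ?nnegrE ?sqrtr_ge0//.
  apply: mx_norm_le => [|i j]; first exact: sqrtr_ge0.
  rewrite ord1 -sqrtr_sqr ler_wsqrtr// (bigD1 i)//= lerDl.
  by apply: sumr_ge0 => l _; exact: sqr_ge0.
Qed.

Lemma measurable_scaled_score n :
  measurable_fun setT (scaled_score n : T -> borelCV R m).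
Proof.
apply/measurable_coordP => i.
rewrite (_ : (fun w => _) = (fun w => (Num.sqrt n%:R)^-1 *
    (\sum_(k < n) xi n k w * G n k i 0))).
  apply: measurable_funM => //; apply: measurable_sum => k.
  by apply: measurable_funM => //; exact: (noise_measurable N).
apply/funext => w; rewrite mxE summxE; congr (_ * _).
by apply: eq_bigr => k _; rewrite [LHS]mxE.
Qed.

Lemma measurable_linear_cV (A : 'M[R]_m) (X : T -> vec) :
  measurable_fun setT (X : T -> borelCV R m) ->
  measurable_fun setT ((fun w => A *m X w) : T -> borelCV R m).
Proof.
move=> mX; apply/measurable_coordP => i.
under eq_fun do rewrite mxE; apply: measurable_sum => j.
by apply: measurable_funM => //; exact: (measurable_coordP X).1.
Qed.

Lemma measurable_affine_cV (a b : R) (X Y : T -> vec) :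
  measurable_fun setT (X : T -> borelCV R m) ->
  measurable_fun setT (Y : T -> borelCV R m) ->
  measurable_fun setT ((fun w => a *: X w + b *: Y w) : T -> borelCV R m).
Proof.
move=> mX mY; apply/measurable_coordP => i.
under eq_fun do rewrite !mxE; apply: measurable_funD.
  by apply: measurable_funM => //; exact: (measurable_coordP X).1.
by apply: measurable_funM => //; exact: (measurable_coordP Y).1.
Qed.

Lemma measurable_scaled_error n :
  measurable_fun setT (scaled_error n : T -> borelCV R m).
Proof.
rewrite (_ : scaled_error n = (fun w => Num.sqrt n%:R *: thetabar n w +
    (- Num.sqrt n%:R) *: thetas)).
  exact: measurable_affine_cV.
by apply/funext => w; rewrite /scaled_error scalerBr scaleNr.
Qed.

Lemma score_tight (e : R) : 0 < e -> exists2 L, 0 < L &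
  forall n, (P [set w | (L <= `|scaled_score n w|)%R] <= e%:E)%E.
Proof.
move=> e0; have [K [Y [K0 iY Y0 EY sY]]] := score_second_moment.
pose L := Num.sqrt ((K + 1) / e).
have L2 : L ^+ 2 = (K + 1) / e.
  by rewrite sqr_sqrtr// divr_ge0 ?addr_ge0// ltW.
have L0 : 0 < L by rewrite sqrtr_gt0 divr_gt0// ltr_wpDl.
have L20 : 0 < L ^+ 2 by rewrite exprn_gt0.
exists L => // n.
apply: le_trans (_ : P [set w | (L ^+ 2 <= Y n w)%R] <= _)%E.
  apply: le_measure; rewrite ?inE.
  - apply: measurable_ge_set.
    exact: (measurableT_comp measurable_norm_cV (measurable_scaled_score n)).
  - by apply: measurable_ge_set; exact: measurable_integrable.
  - move=> w /= Lw; apply: le_trans (sY n w).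
    by rewrite ler_pXn2r ?nnegrE ?(ltW L0).
apply: le_trans (markov_real L20 (iY n) (Y0 n)) _.
rewrite lee_fin ler_pdivrMr// L2 mulrC divfK ?gt_eqF//.
by apply: le_trans (EY n) _; rewrite lerDl.
Qed.

Let A2 : R := mm * `|invmx J|.

Let A2_ge0 : 0 <= A2. Proof. by rewrite mulr_ge0. Qed.

(** The vector is J^-1 S_n / sqrt n. Its smallness places the competitor that minimizes the
    quadratic part inside the ball where [excess_expansion] holds, hence inside [Theta]. *)
Lemma score_small (r : R) : 0 < r ->
  whp P [set p | `|p.1%:R^-1 *: (invmx J *m score_sum p.1 p.2)| < r].
Proof.
move=> r0; have [K [Y [K0 iY Y0 EY sY]]] := score_second_moment.
have A1 : 0 < A2 + 1 by rewrite ltr_wpDl.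
have e0 : 0 < (r / (A2 + 1)) ^+ 2 by rewrite exprn_gt0// divr_gt0.
have h1 := whp_markov (X := fun n w => n%:R^-1 * Y n w)
  (b := fun n => n%:R^-1 * K) e0
  (fun n w => mulr_ge0 _ (Y0 n w)) (fun n => integrableZr _ (iY n)) _
  (cvg_natinv_mul K).
have {}h1 : whp P [set p | p.1%:R^-1 * Y p.1 p.2 < (r / (A2 + 1)) ^+ 2].
  apply: h1 => n; first by rewrite invr_ge0.
  by rewrite RintegralZl// ler_wpM2l// invr_ge0.
apply: whpS (whpI h1 (whp_eventually P (nbhs_infty_gt 0))) => -[n w] /= [k1 n0].
have nR0 : 0 < n%:R :> R by rewrite ltr0n.
have sE : n%:R^-1 *: (invmx J *m score_sum n w) =
    (Num.sqrt n%:R)^-1 *: (invmx J *m scaled_score n w).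
  rewrite /scaled_score -scalemxAr scalerA -invfM -expr2 sqr_sqrtr//.
rewrite sE normrZ ger0_norm ?invr_ge0 ?sqrtr_ge0//.
have h2 : (Num.sqrt n%:R)^-1 * `|scaled_score n w| < r / (A2 + 1).
  have rA : 0 <= r / (A2 + 1) by rewrite ltW// divr_gt0.
  rewrite -(ltr_pXn2r (_ : 0 < 2)%N) ?nnegrE ?mulr_ge0 ?invr_ge0 ?sqrtr_ge0 ?(ltW r0) ?(ltW A1)//.
  apply: le_lt_trans k1; rewrite exprMn exprVn sqr_sqrtr//.
  by rewrite ler_wpM2l ?invr_ge0.
apply: le_lt_trans (_ : A2 * (r / (A2 + 1)) < r).
  apply: le_trans (_ : (Num.sqrt n%:R)^-1 * (A2 * `|scaled_score n w|) <= _).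
    by rewrite ler_wpM2l ?invr_ge0 ?sqrtr_ge0//; exact: ler_mulmx_norm.
  by rewrite mulrCA ler_wpM2l// ltW.
by rewrite mulrA ltr_pdivrMr// mulrDr mulr1 mulrC ltrDl.
Qed.

(** Minimality is used against two competitors: [thetas], whose excess is 0, gives the first
    inequality, and [thetas + t0 / sqrt n] gives the second. *)
Lemma quadratic_bound (rho : R) : 0 < rho ->
  whp P [set p |
    let t := scaled_error p.1 p.2 in
    let S := scaled_score p.1 p.2 in
    let t0 := invmx J *m S in
    let Q (t : vec) := dot t (J *m t) - 2 * dot t S in
    Q t <= rho * `|t| ^+ 2 /\
    Q t <= Q t0 + rho * (`|t| ^+ 2 + `|t0| ^+ 2)].
Proof.
move=> rho0.
have [r r0 h1] := excess_expansion rho0.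
have h2 := consistency r0.
have h3 := score_small r0.
have h4 := whp_eventually P (nbhs_infty_gt 0).
apply: whpS (whpI h1 (whpI h2 (whpI h3 h4))) => -[n w] /= [k1 [k2 [k3 n0]]].
set t := scaled_error n w; set S := scaled_score n w.
set t0 := invmx J *m S.
have nR0 : 0 < n%:R :> R by rewrite ltr0n.
pose sn : R := Num.sqrt n%:R.
have sn0 : 0 < sn by rewrite sqrtr_gt0.
have sn2 : sn * sn = n%:R by rewrite -expr2 sqr_sqrtr// ltW.
(* Substituting t = sqrt n h absorbs the factor n of the quadratic part and turns [score_sum] into
   the normalized score. *)
have rescale (h : vec) : `|excess n (thetas + h) w -
    (dot (sn *: h) (J *m (sn *: h)) - 2 * dot (sn *: h) S)| <=
    rho * `|sn *: h| ^+ 2 <-> `|excess n (thetas + h) w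
      - (n%:R * dot h (J *m h) - 2 * dot h (score_sum n w))| <=
    rho * (n%:R * `|h| ^+ 2).
  rewrite /S /scaled_score -/sn -scalemxAr !dotZl !dotZr.
  rewrite [sn * (sn^-1 * _)]mulrA mulfV ?gt_eqF// mul1r [sn * (sn * _)]mulrA sn2.
  by rewrite normrZ exprMn (ger0_norm (ltW sn0)) expr2 sn2.
have tE : t = sn *: (thetabar n w - thetas) by [].
have t0E : t0 = sn *: (n%:R^-1 *: (invmx J *m score_sum n w)).
  rewrite /t0 /S /scaled_score -scalemxAr scalerA -/sn; congr (_ *: _).
  by rewrite -sn2 invfM mulrA mulfV ?mul1r// gt_eqF.
have /rescale := (k1 _ k2).2; rewrite -tE [thetas + _]addrC subrK => e1.
have [U0 /rescale] := k1 _ k3; rewrite -t0E => e2.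
have m1 := thetabar_min w n0 thetas_Theta; rewrite contrast_excess_thetas in m1.
have m2 := thetabar_min w n0 (U_Theta U0).
move: e1 e2 => /ler_normlP[e1 e1'] /ler_normlP[e2 e2'].
move: m1 m2 e1 e1' e2 e2'.
move: (contrast_excess _ _ _ _ _ _) (contrast_excess _ _ _ _ _ _) => x y.
rewrite mulrDr.
move: (dot t _) (dot t S) (dot t0 _) (dot t0 S) (rho * _) (rho * _) => *.
split; lra.
Qed.

Let gap n w : vec := scaled_error n w - invmx J *m scaled_score n w.

Lemma measurable_gap n : measurable_fun setT (gap n : T -> borelCV R m).
Proof.
rewrite (_ : gap n = (fun w => 1 *: scaled_error n w +
    (-1) *: (invmx J *m scaled_score n w))).
  apply: measurable_affine_cV; first exact: measurable_scaled_error.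
  by apply: measurable_linear_cV; exact: measurable_scaled_score.
by apply/funext => w; rewrite scale1r scaleN1r.
Qed.

Let measurable_norm_ge (X : T -> vec) (a : R) :
  measurable_fun setT (X : T -> borelCV R m) ->
  measurable [set w | a <= `|X w|].
Proof.
by move=> mX; apply: measurable_ge_set; exact: (measurableT_comp measurable_norm_cV mX).
Qed.

(** On the event |S_n| < L, both the scaled error and J^-1 S_n are bounded by multiples of L, and
    [quadratic_argmin] makes their squared distance at most c rho K L^2. *)
Lemma error_linearization (e e' : R) : 0 < e -> 0 < e' ->
  \forall n \near \oo, (P [set w | (e <= `|gap n w|)%R] <= e'%:E)%E.
Proof.
move=> e0 e'0; have e'2 : 0 < e' / 2 by rewrite divr_gt0.
have [L L0 SL] := score_tight e'2.
have [c c0 coer] := psd_unit_coercive psd_J J_unit.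
pose A1 : R := 4 * c * mm.
pose K := A1 ^+ 2 + A2 ^+ 2.
have K0 : 0 <= K by rewrite addr_ge0 ?sqr_ge0.
have e20 : 0 < e ^+ 2 by rewrite exprn_gt0.
have cKL : 0 <= c * K * L ^+ 2 / e ^+ 2.
  by rewrite divr_ge0 ?(ltW e20)// mulr_ge0 ?sqr_ge0// mulr_ge0.
(* One choice of rho meets both demands: c rho <= 1/2 for the a priori bound, and c rho K L^2 < e^2
   for the conclusion. *)
have K1 : 0 <= 2 * c + 2 * (c * K * L ^+ 2 / e ^+ 2) by rewrite addr_ge0// mulr_ge0.
have [rho [rho0 _ rhoK]] := small_factor K1 ltr01.
rewrite (splitr e').
apply: (@whp_le_proba _ _ _ P (fun n => [set w | e <= `|gap n w|])
  (fun n => [set w | L <= `|scaled_score n w|])) => //.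
- by move=> n; apply: measurable_norm_ge; exact: measurable_gap.
- by move=> n; apply: measurable_norm_ge; exact: measurable_scaled_score.
apply: whpS (quadratic_bound rho0) => -[n w] /= [q1 q2] egap.
rewrite leNgt; apply/negP => SLn.
have c_rho : c * rho <= 1 / 2.
  move: rhoK; rewrite mulrDl -mulrA.
  have : 0 <= 2 * (c * K * L ^+ 2 / e ^+ 2) * rho.
    by rewrite mulr_ge0 ?(ltW rho0)// mulr_ge0.
  by move: (c * rho) (_ * rho) => *; lra.
have cK_rho : c * rho * K * L ^+ 2 < e ^+ 2.
  have : 0 <= 2 * c * rho by rewrite mulr_ge0 ?(ltW rho0)// mulr_ge0.
  move: rhoK; rewrite mulrDl.
  rewrite (_ : 2 * (c * K * L ^+ 2 / e ^+ 2) * rho =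
    2 * (c * rho * K * L ^+ 2) / e ^+ 2); last by ring.
  move=> h1 h2; have : 2 * (c * rho * K * L ^+ 2) / e ^+ 2 <= 1.
    by move: h1 h2; move: (2 * c * rho) (_ / _) => *; lra.
  rewrite ler_pdivrMr// mul1r; move: (c * rho * K * L ^+ 2) (e ^+ 2) e20 => *; lra.
have [b1 b2] := quadratic_argmin psd_J.1 J_unit coer c0 (ltW rho0) c_rho q1 q2.
have b3 := ler_mulmx_norm (invmx J) (scaled_score n w).
move: b1 b2 b3 egap SLn; rewrite /gap -/A2 -/A1.
move: (scaled_error n w - _) => g.
move: (`|scaled_error n w|) (`|invmx J *m _|) (`|scaled_score n w|)
  (normr_ge0 (scaled_error n w)) (normr_ge0 (invmx J *m scaled_score n w))
  (normr_ge0 (scaled_score n w)) => t t0 s t_0 t0_0 s_0 b1 b2 b3 eg sL.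
have s2 : s ^+ 2 <= L ^+ 2 by rewrite ler_pXn2r ?nnegrE ?(ltW L0)// ltW.
have t2 : t ^+ 2 <= A1 ^+ 2 * s ^+ 2.
  by rewrite -exprMn; apply: sqr_le_norm; rewrite ger0_norm.
have t02 : t0 ^+ 2 <= A2 ^+ 2 * s ^+ 2.
  by rewrite -exprMn; apply: sqr_le_norm; rewrite ger0_norm.
have : e ^+ 2 < e ^+ 2; last by rewrite ltxx.
apply: le_lt_trans cK_rho.
apply: le_trans (_ : `|g| ^+ 2 <= _).
  by rewrite ler_pXn2r ?nnegrE ?(ltW e0).
apply: le_trans b2 _; rewrite -[leRHS]mulrA ler_wpM2l ?mulr_ge0 ?(ltW rho0)//.
apply: le_trans (lerD t2 t02) _; rewrite -mulrDl -/K.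
by rewrite ler_wpM2l.
Qed.

Let V : 'M[R]_m := invmx J *m Gam *m invmx J.

Let dotV u : dot u (V *m u) = dot (invmx J *m u) (Gam *m (invmx J *m u)).
Proof. by rewrite /V -!mulmxA (sym_dot _ _ invJ_sym) dotC. Qed.

Lemma sandwich_psd : psd V.
Proof.
split; first by rewrite /V !trmx_mul invJ_sym psd_Gam.1 mulmxA.
by move=> u; rewrite dotV; exact: psd_Gam.2.
Qed.

(** Since the inverse of J is symmetric, the projection on [u] is a weighted error sum with weights
    G^T J^-1 u, bounded uniformly in n. *)
Lemma score_char_fun x u :
  \int[P]_w cos (x + dot u (invmx J *m scaled_score n w)) @[n --> \oo] -->
  expR (- (dot u (V *m u) / 2)) * cos x.
Proof.
pose a := invmx J *m u.
have [B B0 GB] := within_bounded gradient_within.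
have aB n k : (k < n)%N -> `|dot (G n k) a| <= mm * (B * `|a|).
  move=> kn; apply: le_trans (ler_dot _ _) _; rewrite ler_wpM2l// ler_wpM2r//.
  exact: GB (obs_time_in R kn).
have L : n%:R^-1 * (\sum_(k < n) dot (G n k) a ^+ 2 * v (obs_time n k.+1))
    @[n --> \oo] --> dot u (V *m u).
  rewrite dotV; under eq_fun do under eq_bigr do rewrite mulrC.
  exact: (@gram_dot _ _ (fun n k => v (obs_time n k.+1)) G Gam Gam_lim a).
have := @char_fun_weighted _ _ _ _ _ _ _ N (fun n k => dot (G n k) a) _ _ x aB L.
rewrite (_ : (fun n => _) = (fun n =>
  \int[P]_w cos (x + dot u (invmx J *m scaled_score n w)))); first exact.
apply/funext => n; apply: eq_Rintegral => w _; congr (cos (_ + _)).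
rewrite sym_dot// dotC -/a /scaled_score dotZr dot_sumr; congr (_ * _).
by apply: eq_bigr => k _; rewrite dotZr mulrC dotC.
Qed.

(** Slutsky's argument on cosines: they are 1-Lipschitz, and the two arguments are close with high
    probability. The error splits as e/2 + e/4 + 2 (e/8). *)
Lemma error_char_fun x u :
  \int[P]_w cos (x + dot u (scaled_error n w)) @[n --> \oo] -->
  expR (- (dot u (V *m u) / 2)) * cos x.
Proof.
have lim := @score_char_fun x u.
apply/cvgrPdist_le => /= e e0.
have e2 : 0 < e / 2 by rewrite divr_gt0.
have e4 : 0 < e / 4 by rewrite divr_gt0.
have e8 : 0 < e / 8 by rewrite divr_gt0.
(* A Lipschitz constant of the projection; the + 1 keeps the division valid for [u = 0]. *)
pose k := mm * `|u| + 1.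
have k0 : 0 < k by rewrite ltr_wpDl// mulr_ge0.
have eta0 : 0 < e / 4 / k by rewrite divr_gt0.
have mlin (X : nat -> T -> vec) n :
    measurable_fun setT (X n : T -> borelCV R m) ->
    measurable_fun setT (fun w => x + dot u (X n w)).
  move=> mX; apply: measurable_funD => //.
  exact: (measurableT_comp (measurable_dot u) mX).
have mA n := mlin _ _ (measurable_scaled_error n).
have mB n : measurable_fun setT (fun w => x + dot u (invmx J *m scaled_score n w)).
  apply: (mlin (fun n w => invmx J *m scaled_score n w)).
  by apply: measurable_linear_cV; exact: measurable_scaled_score.
near=> n.
have h1 : `|expR (- (dot u (V *m u) / 2)) * cos x -
   \int[P]_w cos (x + dot u (invmx J *m scaled_score n w))| <= e / 2.
  by near: n; move/cvgrPdist_le : lim; apply.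
have h2 : (P [set w | (e / 4 / k <= `|gap n w|)%R] <= (e / 8)%:E)%E.
  by near: n; exact: error_linearization.
have h3 := Rintegral_cos_close P (ltW e4) (mA n) (mB n).
set D := [set w | _] in h3.
have h4 : fine (P D) <= e / 8.
  rewrite -lee_fin fineK ?fin_num_measure//; last first.
    apply: measurable_ge_set; apply: measurableT_comp => //.
    exact: measurable_funB.
  apply: le_trans h2; apply: le_measure; rewrite ?inE.
  - apply: measurable_ge_set; apply: measurableT_comp => //.
    exact: measurable_funB.
  - by apply: measurable_norm_ge; exact: measurable_gap.
  - move=> w; rewrite /D /= opprD addrACA subrr add0r -dotBr => h.
    rewrite ler_pdivrMr// [leRHS]mulrC; apply: le_trans h _.
    apply: le_trans (ler_dot _ _) _; rewrite mulrA ler_wpM2r//.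
    by rewrite /k lerDl.
move: h1 h3 h4.
move: (expR _ * _) (\int[P]_w _) (\int[P]_w _) (fine _) => p q r y h1 h3 h4.
rewrite (_ : p - q = (p - r) - (q - r)); last by ring.
apply: le_trans (ler_normB _ _) _; move: h1 h3.
by move: (`|p - r|) (`|q - r|) => *; lra.
Unshelve. all: end_near. Qed.

Lemma error_tight e : 0 < e -> exists2 L, 0 < L &
  \forall n \near \oo, (P [set w | (L <= `|scaled_error n w|)%R] <= e%:E)%E.
Proof.
move=> e0; have e2 : 0 < e / 2 by rewrite divr_gt0.
have [L0 L00 SL] := score_tight e2.
(* The scaled error can reach this size only if the gap reaches 1 or the score reaches [L0]. *)
exists (1 + (A2 + 1) * L0).
  by rewrite addr_gt0// mulr_gt0// ltr_wpDl.
have h := error_linearization ltr01 e2.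
near=> n.
have h1 : (P [set w | (1 <= `|gap n w|)%R] <= (e / 2)%:E)%E by near: n; exact: h.
have m1 : measurable [set w | 1 <= `|gap n w|].
  by apply: measurable_norm_ge; exact: measurable_gap.
have m2 : measurable [set w | L0 <= `|scaled_score n w|].
  by apply: measurable_norm_ge; exact: measurable_scaled_score.
apply: le_trans (_ : P ([set w | (1 <= `|gap n w|)%R] `|`
    [set w | (L0 <= `|scaled_score n w|)%R]) <= _)%E.
  apply: le_measure; rewrite ?inE.
  - by apply: measurable_norm_ge; exact: measurable_scaled_error.
  - exact: measurableU.
  - move=> w /= Lw; apply: contrapT => /not_orP[/negP + /negP].
    rewrite -!ltNge => g1 s1; move: Lw; apply/negP; rewrite -ltNge.
    rewrite (_ : scaled_error n w = gap n w + invmx J *m scaled_score n w); last first.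
      by rewrite /gap subrK.
    apply: le_lt_trans (ler_normD _ _) _; apply: ltr_leD => //.
    apply: le_trans (ler_mulmx_norm _ _) _; rewrite -/A2.
    by apply: ler_pM => //; [rewrite lerDl|exact: ltW].
apply: le_trans (measureU2 P m1 m2) _.
by rewrite (splitr e) EFinD; apply: leeD => //; exact: SL.
Unshelve. all: end_near. Qed.

(** Factoring the covariance supplies the limit law explicitly, singular covariances included. *)
Theorem error_asymptotic_normality : exists2 mu : probability (borelCV R m) R,
  is_multinormal mu 0 V & cvg_in_distribution P scaled_error mu.
Proof.
have [s sV] := psd_factor sandwich_psd.
exists (gaussian_law s); first exact: gaussian_law_multinormal.
apply: weak_convergence.
- exact: measurable_scaled_error.
- by move=> c u; rewrite gaussian_law_cos -sV; exact: error_char_fun.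
- exact: error_tight.
Qed.

Theorem error_cvg_in_probability : cvg_in_probability P
  (fun n w => scaled_error n w - invmx J *m scaled_score n w) 0.
Proof.
move=> e e0; under eq_fun do under eq_set do rewrite subr0.
apply/fine_cvgP; split.
  near=> n; apply: fin_num_measure.
  by apply: measurable_norm_ge; exact: measurable_gap.
apply/cvgrPdist_le => /= a a0; near=> n.
rewrite sub0r normrN ger0_norm ?fine_ge0//.
rewrite -lee_fin fineK; last first.
  apply: fin_num_measure.
  by apply: measurable_norm_ge; exact: measurable_gap.
by near: n; exact: error_linearization.
Unshelve. all: end_near. Qed.

End regression.

(** * The noise of the model *)

Section trunc_sqr_bounds.
Context {R : realType}.
Implicit Types a x y : R.

(** If |y| <= |x| then |x + y| <= 2 |x|, and doubling the argument costs 4 in the square and at most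
    2 in the minimum. *)
Lemma trunc_sqrD a x y : 0 <= a ->
  trunc_sqr a (x + y) <= 8 * (trunc_sqr a x + trunc_sqr a y).
Proof.
move=> a0.
wlog xy : x y / `|y| <= `|x| => [h|].
  have [/ltW/h|/h//] := ltP `|x| `|y|.
  by rewrite [y + x]addrC [X in 8 * X]addrC.
apply: le_trans (_ : 8 * trunc_sqr a x <= _); last first.
  by rewrite ler_wpM2l// lerDl trunc_sqr_ge0.
have xyn : `|x + y| <= 2 * `|x|.
  by apply: le_trans (ler_normD _ _) _; move: xy; move: (`|y|) (`|x|) => *; lra.
rewrite /trunc_sqr (_ : 8 * _ = (2 * `|x|) ^+ 2 * (2 * Num.min 1 (a * `|x|))); last first.
  by rewrite exprMn real_normK ?num_real//; ring.
apply: ler_pM; rewrite ?sqr_ge0//.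
- by rewrite le_min ler01 mulr_ge0.
- exact: sqr_le_norm.
- rewrite minr_pMr// mulr1 le_min !ge_min; apply/andP; split.
    by rewrite ler1n.
  by apply/orP; right; rewrite mulrCA ler_wpM2l.
Qed.

(** Cutting at x^2 = M separates a uniformly integrable tail from a part of order [a]. *)
Lemma trunc_sqr_tail a x (M : R) : 0 <= a -> 0 <= M ->
  trunc_sqr a x <= x ^+ 2 * (M < x ^+ 2)%R%:R + a * Num.sqrt M * x ^+ 2.
Proof.
move=> a0 M0; have [xM|xM] := ltP M (x ^+ 2).
  rewrite mulr1; apply: le_trans (trunc_sqr_le_sqr _ _) _.
  by rewrite lerDl mulr_ge0 ?sqr_ge0// mulr_ge0 ?sqrtr_ge0.
rewrite mulr0 add0r mulrC /trunc_sqr ler_wpM2l ?sqr_ge0// ge_min.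
apply/orP; right; rewrite ler_wpM2l// -sqrtr_sqr ler_wsqrtr//.
Qed.

End trunc_sqr_bounds.

Section model_noise.
Context {R : realType} {d m : nat}.
Variables (Psi : 'cV[R]_d -> R -> R) (S : 'cV[R]_m -> R -> 'cV[R]_d).
Context {dT : measure_display} {T : measurableType dT} {P : probability T R}.
Variables (eps : nat -> {RV P >-> borelCV R d}) (V : nat -> {RV P >-> R}).
Variables (sigma : R) (thetas : 'cV[R]_m).
Hypothesis Psi_measurable : forall t, t \in `[0, 1] ->
  measurable_fun [set: borelCV R d] (fun x : borelCV R d => Psi x t).
Hypothesis V_iid : iid V.
Hypothesis V_integrable : forall k, P.-integrable [set: T] (EFin \o V k).
Hypothesis V_centered : forall k, 'E_P[V k]%E = 0%E.
Hypothesis V_variance : forall k, variance P (V k) = (sigma ^+ 2)%:E.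
Hypothesis V_eps_independent : independent_sequences V eps.
Hypothesis eps_iid : iid eps.

Local Notation X k t := (noisy_signal Psi S eps k t thetas).
Local Notation s t := (signal Psi S t thetas).

Hypothesis unbiased_integrable : forall t, t \in `[0, 1] ->
  P.-integrable [set: T] (EFin \o X 1%N t).
Hypothesis unbiased : forall t, t \in `[0, 1] -> 'E_P[X 1%N t]%E = (s t)%:E.
Hypothesis square_finite : forall t, t \in `[0, 1] ->
  ('E_P[(fun w => X 1%N t w ^+ 2)%R] < +oo)%E.
Hypothesis square_continuous : {within `[0, 1], continuous (fun t : R =>
  fine 'E_P[(fun w => X 1%N t w ^+ 2)%R]%E)}.
Hypothesis square_uniformly_integrable :
  ereal_sup [set 'E_P[(fun w => (X 1%N t w) ^+ 2 *
      \1_[set w' | M < X 1%N t w' ^+ 2] w)%R]%E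
    | t in `[0, 1]] @[M --> +oo%R] --> 0%E.
Hypothesis s_continuous : {within `[0, 1], continuous (fun t => s t)}.

Let V_measurable k : measurable_fun setT (V k : T -> R).
Proof. exact: measurable_funPT. Qed.

Let eps_measurable k : measurable_fun setT (eps k : T -> borelCV R d).
Proof. exact: measurable_funPT. Qed.

(** The same [h] serves every index k; this is what lets identical distribution of the trajectory
    noise carry the moment hypotheses from index 1 to all k. *)
Lemma noisy_signal_kernel t : t \in `[0, 1] ->
  exists2 h : borelCV R d -> R, measurable_fun setT h &
    forall k, X k t = h \o eps k.
Proof.
move=> t01; exists (fun x => Psi (S thetas t + x) t) => //.
apply: (measurableT_comp (Psi_measurable t01)).
apply/measurable_coordP => i; under eq_fun do rewrite mxE.
by apply: measurable_funD => //; exact: (measurable_coordP _).1.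
Qed.

Let X_measurable k t : t \in `[0, 1] -> measurable_fun setT (X k t).
Proof.
by move=> /noisy_signal_kernel[h mh ->]; exact: (measurableT_comp mh).
Qed.

Let X_transfer k t (F : R -> R) : t \in `[0, 1] -> measurable_fun setT F ->
  P.-integrable setT (EFin \o (fun w => F (X 1%N t w))) ->
  P.-integrable setT (EFin \o (fun w => F (X k t w))) /\
  \int[P]_w F (X k t w) = \int[P]_w F (X 1%N t w).
Proof.
move=> t01 mF; have [h mh hE] := noisy_signal_kernel t01.
rewrite !hE => i1.
have mFh : measurable_fun setT (F \o h) by exact: measurableT_comp.
have [|i2 E2] := @eq_Rintegral_distribution _ _ _ P _ _ _ _ P (eps 1%N) (eps k)
  (F \o h) (eps_measurable 1%N) (eps_measurable k) mFh _ i1.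
  by move=> A mA; exact: eps_iid.2.
by split.
Qed.

Let V_transfer k (F : R -> R) : measurable_fun setT F ->
  P.-integrable setT (EFin \o (fun w => F (V 1%N w))) ->
  P.-integrable setT (EFin \o (fun w => F (V k w))) /\
  \int[P]_w F (V k w) = \int[P]_w F (V 1%N w).
Proof.
move=> mF i1.
have [|i2 E2] := @eq_Rintegral_distribution _ _ _ P _ _ _ _ P (V 1%N) (V k)
  F (V_measurable 1%N) (V_measurable k) mF _ i1.
  by move=> A mA; exact: V_iid.2.
by split.
Qed.

Let square_integrable (Z : T -> R) : measurable_fun setT Z ->
  ('E_P[(fun w => Z w ^+ 2)%R] < +oo)%E ->
  P.-integrable setT (EFin \o (fun w => Z w ^+ 2)).
Proof.
move=> mZ; rewrite unlock => Zoo; apply/integrableP; split.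
  by apply/measurable_EFinP; exact: measurable_funX.
by under eq_integral do rewrite /= ger0_norm ?sqr_ge0//.
Qed.

Let expectationE (Z : T -> R) : P.-integrable setT (EFin \o Z) ->
  'E_P[Z]%E = (\int[P]_w Z w)%:E.
Proof. by move=> iZ; rewrite unlock integral_EFinE. Qed.

Let X2_1 t : t \in `[0, 1] ->
  P.-integrable setT (EFin \o (fun w => X 1%N t w ^+ 2)).
Proof.
by move=> t01; apply: square_integrable; [exact: X_measurable|exact: square_finite].
Qed.

Let sqr_measurable : measurable_fun setT (fun x : R => x ^+ 2).
Proof. exact: measurable_funX. Qed.

Let X2 k t : t \in `[0, 1] ->
  P.-integrable setT (EFin \o (fun w => X k t w ^+ 2)).
Proof.
by move=> t01; exact: (X_transfer k t01 sqr_measurable (X2_1 t01)).1.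
Qed.

Let X_integrable k t : t \in `[0, 1] -> P.-integrable setT (EFin \o X k t).
Proof.
by move=> t01; apply: integrable_square; [exact: X_measurable|exact: X2].
Qed.

Let X_mean k t : t \in `[0, 1] -> \int[P]_w X k t w = s t.
Proof.
move=> t01; have := (X_transfer k t01 (@measurable_id _ _ setT) (unbiased_integrable t01)).2.
move=> -> ; apply: EFin_inj; rewrite -expectationE; first exact: unbiased.
exact: unbiased_integrable.
Qed.

Let V_mean k : \int[P]_w V k w = 0.
Proof. by apply: EFin_inj; rewrite -expectationE. Qed.

Let V2 k : P.-integrable setT (EFin \o (fun w => V k w ^+ 2)) /\
  \int[P]_w (V k w ^+ 2) = sigma ^+ 2.
Proof.
have := V_variance k; rewrite /variance covariance.unlock V_centered.
rewrite (_ : (_ * _)%R = (fun w => V k w ^+ 2)) => [EV|]; last first.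
  by apply/funext => w /=; rewrite /GRing.mul/= subr0 expr2.
have iV : P.-integrable setT (EFin \o (fun w => V k w ^+ 2)).
  by apply: square_integrable; [exact: V_measurable|rewrite EV ltry].
by split => //; apply: EFin_inj; rewrite -expectationE.
Qed.

Let XV_independent k t : t \in `[0, 1] -> independent_funs P (X k t) (V k).
Proof.
move=> t01 A B mA mB; have [h mh ->] := noisy_signal_kernel t01.
rewrite setIC muleC; apply: V_eps_independent; apply: sub_sigma_algebra.
  by exists k => //; exists B => //; rewrite setTI.
exists k => //; exists (h @^-1` A); last by rewrite setTI.
by rewrite -[W in measurable W]setTI; exact: mh.
Qed.

(** The error of the observation as a regression on the true signal: centred, independent over k,
    with a variance depending on t. *)
Definition model_noise k t w : R := X k t w - s t + V k w.

Local Notation Z := model_noise.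

Let X_centered_square k t : t \in `[0, 1] ->
  P.-integrable setT (EFin \o (fun w => (X k t w - s t) ^+ 2)).
Proof.
move=> t01.
apply: (dominated_integrable _ (integrableDr (integrableZr 2 (X2 k t01))
    (integrable_cstr P (2 * s t ^+ 2)))).
  by apply: measurable_funX; apply: measurable_funB => //; exact: X_measurable.
move=> w; rewrite ger0_norm ?sqr_ge0// (le_trans _ (ler_norm _))//.
by have := sqr_ge0 (X k t w + s t); move: (X k t w) (s t) => x y; nra.
Qed.

Let Z_measurable k t : t \in `[0, 1] -> measurable_fun setT (Z k t).
Proof.
move=> t01; apply: measurable_funD => //; apply: measurable_funB => //.
exact: X_measurable.
Qed.

Let Z_square k t : t \in `[0, 1] ->
  P.-integrable setT (EFin \o (fun w => Z k t w ^+ 2)).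
Proof.
move=> t01.
apply: (dominated_integrable _ (integrableDr
  (integrableZr 2 (X_centered_square k t01)) (integrableZr 2 (V2 k).1))).
  by apply: measurable_funX; exact: Z_measurable.
move=> w; rewrite ger0_norm ?sqr_ge0// (le_trans _ (ler_norm _))// /Z.
by have := sqr_ge0 (X k t w - s t - V k w); move: (X k t w - s t) (V k w : R) => x y; nra.
Qed.

Let Z_mean k t : t \in `[0, 1] -> \int[P]_w Z k t w = 0.
Proof.
move=> t01; have iX := X_integrable k t01.
have ic := integrable_cstr P (- s t).
rewrite /Z !RintegralD//; last by exact: integrableDr.
by rewrite X_mean// Rintegral_cstP V_mean subrr addr0.
Qed.

Definition noise_var t : R :=
  fine 'E_P[(fun w => (X 1%N t w - s t) ^+ 2)%R]%E + sigma ^+ 2.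

Let Z_variance k t : t \in `[0, 1] -> \int[P]_w (Z k t w ^+ 2) = noise_var t.
Proof.
move=> t01; rewrite /noise_var expectationE//=; last exact: X_centered_square.
have mF : measurable_fun setT (fun x : R => (x - s t) ^+ 2).
  by apply: measurable_funX; exact: measurable_funB.
have -> : (fun w => Z k t w ^+ 2) = (fun w =>
    (X k t w - s t) ^+ 2 + (2 * ((X k t w - s t) * V k w) + V k w ^+ 2)).
  by apply/funext => w; rewrite /Z; ring.
have iX := X_centered_square k t01; have [iV EV] := V2 k.
have mX : measurable_fun setT (fun w => X k t w - s t).
  by apply: measurable_funB => //; exact: X_measurable.
have iXV := integrable_mul mX (V_measurable k) iX iV.
have i2XV := integrableZr 2 iXV.
rewrite !RintegralD//; last exact: integrableDr.
rewrite RintegralZl// EV.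
rewrite (Rintegral_independentM (f := fun w => X k t w - s t))//.
- by rewrite V_mean !mulr0 add0r (X_transfer k t01 mF (X_centered_square _ t01)).2.
- by apply: integrableDr; [exact: X_integrable|exact: integrable_cstr].
- have mB : measurable_fun setT (fun x : R => x - s t) by exact: measurable_funB.
  exact: (independent_funs_comp mB (@measurable_id _ _ setT) (XV_independent k t01)).
Qed.

Let square_mean t := fine 'E_P[(fun w => X 1%N t w ^+ 2)%R]%E.

Let square_meanE t : t \in `[0, 1] ->
  square_mean t = \int[P]_w (X 1%N t w ^+ 2).
Proof. by move=> t01; rewrite /square_mean expectationE//; exact: X2. Qed.

Let centered_meanE t : t \in `[0, 1] ->
  fine 'E_P[(fun w => (X 1%N t w - s t) ^+ 2)%R]%E = square_mean t - s t ^+ 2.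
Proof.
move=> t01; rewrite square_meanE// expectationE//=; last exact: X_centered_square.
rewrite (_ : (fun w => (X 1%N t w - s t) ^+ 2) =
    (fun w => X 1%N t w ^+ 2 + (- (2 * s t) * X 1%N t w + s t ^+ 2))); last first.
  by apply/funext => w; ring.
have iX := X_integrable 1%N t01; have iX2 := X2 1%N t01.
have iXc := integrableZr (- (2 * s t)) iX; have ic := integrable_cstr P (s t ^+ 2).
rewrite !RintegralD//; last exact: integrableDr.
by rewrite RintegralZl// X_mean// Rintegral_cstP; ring.
Qed.

(** By unbiasedness the centred moment is the raw second moment minus the squared signal, and both
    are continuous by hypothesis. *)
Lemma centered_mean_continuous : {within `[0, 1], continuous (fun t : R =>
  fine 'E_P[(fun w => (X 1%N t w - s t) ^+ 2)%R]%E)}.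
Proof.
apply: (@subspace_eq_continuous _ _ _ (fun t => square_mean t - s t * s t)).
  move=> t; rewrite inE/= => t01; rewrite -expr2.
  exact: (esym (centered_meanE t01)).
move=> t; apply: cvgB; first exact: square_continuous.
by apply: cvgM; exact: s_continuous.
Qed.

Lemma noise_var_bounded : exists C, forall t, 0 <= t <= 1 -> 0 <= noise_var t <= C.
Proof.
have [B B0 hB] := within_bounded centered_mean_continuous.
exists (B + sigma ^+ 2) => t t01; rewrite /noise_var lerD2r; apply/andP; split.
  apply: addr_ge0; last exact: sqr_ge0.
  apply: fine_ge0; rewrite unlock; apply: integral_ge0 => w _.
  by rewrite lee_fin sqr_ge0.
exact: le_trans (ler_norm _) (hB t t01).
Qed.

(** The convergence gives a nonnegative level at which the supremum is both finite and below [e];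
    finiteness allows its real value to bound the tail at every t. *)
Let tail_bound (e : R) : 0 < e -> exists2 M, 0 <= M &
  forall t, t \in `[0, 1] -> \int[P]_w (X 1%N t w ^+ 2 *
    \1_[set w' | M < X 1%N t w' ^+ 2] w) <= e /\
    P.-integrable setT (EFin \o (fun w => X 1%N t w ^+ 2 *
    \1_[set w' | M < X 1%N t w' ^+ 2] w)).
Proof.
move=> e0; have /fine_cvgP[fin lim] := square_uniformly_integrable.
move/cvgrPdist_lt : lim => /(_ e e0) lim.
have pos : \forall M \near +oo, (0 : R) <= M by exact: nbhs_pinfty_ge.
have [M [[finM limM] M0]] := filter_ex (filterI (filterI fin lim) pos).
exists M => // t t01; set F := (fun w => _ * _).
have mF : measurable_fun setT F.
  apply: measurable_funM; first by apply: measurable_funX; exact: X_measurable.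
  apply: measurable_indic.
  rewrite (_ : [set w' | _] = (fun w => X 1%N t w ^+ 2) @^-1` [set` `]M, +oo[]).
    rewrite -[W in measurable W]setTI.
    by apply: (measurable_funX _ (X_measurable 1%N t01)).
  by apply/seteqP; split=> w /=; rewrite in_itv/= andbT.
have iF : P.-integrable setT (EFin \o F).
  apply: (dominated_integrable mF (X2 1%N t01)) => w.
  rewrite normrM ler_piMr// ger0_norm ?indicE//.
  by case: (_ \in _).
split => //; rewrite -lee_fin -expectationE//.
move: limM; rewrite /= sub0r normrN => /ltW limM.
rewrite (le_trans _ (_ : (fine (ereal_sup [set 'E_P[(fun w => (X 1%N t w) ^+ 2 *
      \1_[set w' | M < X 1%N t w' ^+ 2] w)%R]%E
    | t in `[0, 1]]))%:E <= _)%E)//; last first.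
  by rewrite lee_fin; apply: le_trans limM; exact: ler_norm.
rewrite fineK//; apply: ereal_sup_ubound; exists t => //.
Qed.

Lemma model_noise_uniform (e : R) : 0 < e -> exists2 a0 : R, 0 < a0 &
  forall a k t, 0 <= a -> a <= a0 -> t \in `[0, 1] ->
    \int[P]_w trunc_sqr a (Z k t w) <= e.
Proof.
(* Applying [trunc_sqrD] twice gives weights 64, 64 and 8. The tail and the measurement noise cost
   (64 + 8) e / 144 = e / 2; the terms of order [a] share the other half. *)
move=> e0; have e1 : 0 < e / 144 by rewrite divr_gt0.
have e2 : 0 < e / 2 by rewrite divr_gt0.
have [M M0 hM] := tail_bound e1.
have [B1 B10 sB] := within_bounded s_continuous.
have [B2 B20 qB] := within_bounded square_continuous.
have [a1 a10 ha1] := trunc_sqr_small e1 (V_measurable 1%N) (V2 1%N).1.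
have K0 : 0 <= 64 * (Num.sqrt M * B2 + B1 ^+ 3).
  by rewrite mulr_ge0// addr_ge0 ?mulr_ge0 ?sqrtr_ge0 ?exprn_ge0.
have [a2 [a20 _ a2K]] := small_factor K0 e2.
exists (Num.min a1 a2) => [|a k t a0]; first by rewrite lt_min a10.
rewrite le_min => /andP[aa1 aa2] t01.
have mtr := @measurable_trunc_sqr R a.
have itX1 := integrable_trunc_sqr a0 (X_measurable 1%N t01) (X2 1%N t01).
have [itX EX] := X_transfer k t01 mtr itX1.
have itV1 := integrable_trunc_sqr a0 (V_measurable 1%N) (V2 1%N).1.
have [itV EV] := V_transfer k mtr itV1.
have itZ := integrable_trunc_sqr a0 (Z_measurable k t01) (Z_square k t01).
have ic := integrable_cstr P (trunc_sqr a (- s t)).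
have iXs := integrableZr 8 (integrableDr itX ic).
have iall := integrableZr 8 (integrableDr iXs itV).
apply: le_trans (_ : \int[P]_w (8 * (8 * (trunc_sqr a (X k t w) +
    trunc_sqr a (- s t)) + trunc_sqr a (V k w))) <= _).
  apply: le_Rintegral => // w _; apply: le_trans (trunc_sqrD _ _ a0) _.
  by rewrite ler_wpM2l// lerD2r trunc_sqrD.
rewrite RintegralZl//; last exact: integrableDr.
rewrite RintegralD// RintegralZl//; last exact: integrableDr.
rewrite RintegralD// Rintegral_cstP EX EV.
have hV := ha1 a a0 aa1.
have hs : trunc_sqr a (- s t) <= a * B1 ^+ 3.
  rewrite /trunc_sqr sqrrN normrN.
  apply: le_trans (_ : s t ^+ 2 * (a * `|s t|) <= _).
    by rewrite ler_wpM2l ?sqr_ge0// ge_min lexx orbT.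
  rewrite mulrCA ler_wpM2l// [B1 ^+ 3]exprSr; apply: ler_pM; rewrite ?sqr_ge0//.
    by apply: sqr_le_norm; exact: sB.
  exact: sB.
have hX : \int[P]_w trunc_sqr a (X 1%N t w) <= e / 144 + a * Num.sqrt M * B2.
  have [hM1 hM2] := hM t t01.
  have iq := integrableZr (a * Num.sqrt M) (X2 1%N t01).
  apply: le_trans (_ : \int[P]_w (X 1%N t w ^+ 2 *
    \1_[set w' | M < X 1%N t w' ^+ 2] w + a * Num.sqrt M * X 1%N t w ^+ 2) <= _).
    apply: le_Rintegral => //; first exact: integrableDr.
    move=> w _; apply: le_trans (trunc_sqr_tail _ a0 M0) _.
    rewrite indicE lerD2r ler_wpM2l ?sqr_ge0//.
    by rewrite mem_setE.
  rewrite RintegralD//; apply: lerD => //; rewrite RintegralZl//; last exact: X2.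
  rewrite ler_wpM2l ?mulr_ge0 ?sqrtr_ge0// -square_meanE//.
  exact: le_trans (ler_norm _) (qB _ t01).
have h4 : a * (64 * (Num.sqrt M * B2 + B1 ^+ 3)) <= e / 2.
  by apply: le_trans a2K; rewrite mulrC ler_wpM2l.
move: h4 hX hs hV; rewrite !mulrDr [a * (64 * (_ * _))]mulrCA [a * (64 * _)]mulrCA.
rewrite [a * (_ * B2)]mulrA.
move: (a * Num.sqrt M * B2) (a * B1 ^+ 3) (trunc_sqr _ _) => x y z.
move: (\int[P]_w _) (\int[P]_w _) => p q *; lra.
Qed.

Lemma model_noise_history k t (J : {fset nat}) : t \in `[0, 1] -> k \in J ->
  measurable_fun [set: history eps V J] (Z k t).
Proof.
move=> t01 kJ; have [h mh hE] := noisy_signal_kernel t01.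
rewrite /Z hE; apply: measurable_funD; last first.
  exact: (@history_measurableY _ _ _ _ _ _ _ P eps V J k idfun kJ
    (@measurable_id _ _ setT)).
by apply: measurable_funB => //; exact: history_measurableX.
Qed.

(** Shifted by one: entry 0 of a row is the observation with index 1. *)
Definition noise n k w : R := Z k.+1 (obs_time n k.+1) w.

Lemma noise_arrayP : exists C, noise_array P noise noise_var C.
Proof.
have [C vC] := noise_var_bounded; exists C.
split => //.
- by move=> n k /(obs_time_in R) kn; exact: Z_measurable.
- by move=> n k /(obs_time_in R) kn; exact: Z_square.
- by move=> n k /(obs_time_in R) kn; exact: Z_mean.
- by move=> n k /(obs_time_in R) kn; exact: Z_variance.
- move=> n f mf k kn.
  (* Because of the shift, entries below k use the model indices 1, ..., k, and entry k uses k +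
     1. *)
  apply: (history_independent (J := [fset x in iota 1 k]%fset) (K := [fset k.+1]%fset)
    eps_iid.1 V_iid.1 V_eps_independent).
  + by rewrite fdisjointX1 !inE mem_iota add1n ltnn andbF.
  + apply: measurable_sum => i; apply: measurableT_comp (mf i) _.
    apply: model_noise_history; first by apply: obs_time_in; exact: ltn_trans kn.
    by rewrite !inE mem_iota add1n /= ltnS ltn_ord.
  + apply: measurableT_comp (mf k) _.
    by apply: model_noise_history; [exact: obs_time_in|rewrite inE].
- move=> e /model_noise_uniform[a0 a00 ha0]; exists a0 => // a n k a_ge aa /(obs_time_in R) kn.
  exact: ha0.
Qed.

End model_noise.

Theorem theorem2 (R : realType) (d m : nat)
  (dT : measure_display) (T : measurableType dT) (P : probability T R)
  (Theta : set 'cV[R]_m) (S : 'cV[R]_m -> R -> 'cV[R]_d)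
  (Psi : 'cV[R]_d -> R -> R)
  (eps : nat -> {RV P >-> borelCV R d}) (V : nat -> {RV P >-> R})
  (g : R -> R) (sigma : R) (thetas : 'cV[R]_m) (U : set 'cV[R]_m)
  (thetabar : nat -> {RV P >-> borelCV R m})
  (Theta_compact : compact Theta)
  (thetas_Theta : Theta thetas)
  (Psi_measurable : forall t, t \in `[0, 1] ->
    measurable_fun [set: borelCV R d] (fun x : borelCV R d => Psi x t))
  (V_iid : iid V)
  (V_density : forall k, has_density (V k) g)
  (V_integrable : forall k, P.-integrable [set: T] (EFin \o V k))
  (V_centered : forall k, 'E_P[V k]%E = 0%E)
  (V_variance : forall k, variance P (V k) = (sigma ^+ 2)%:E)
  (V_eps_independent : independent_sequences V eps)
  (eps_iid : iid eps)
  (identifiability : forall theta, Theta theta ->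
    {ae lebesgue_measure, forall t : R, t \in `[0, 1] ->
      signal Psi S t theta = signal Psi S t thetas} ->
    theta = thetas)
  (unbiased_integrable : forall t theta, t \in `[0, 1] -> Theta theta ->
    P.-integrable [set: T] (EFin \o noisy_signal Psi S eps 1 t theta))
  (unbiased : forall t theta, t \in `[0, 1] -> Theta theta ->
    'E_P[noisy_signal Psi S eps 1 t theta]%E = (signal Psi S t theta)%:E)
  (square_finite : forall t, t \in `[0, 1] ->
    ('E_P[(fun w => noisy_signal Psi S eps 1 t thetas w ^+ 2)%R] < +oo)%E)
  (square_continuous : {within `[0, 1], continuous (fun t : R =>
    fine 'E_P[(fun w => noisy_signal Psi S eps 1 t thetas w ^+ 2)%R]%E)})
  (square_uniformly_integrable :
    ereal_sup [set 'E_P[(fun w =>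
        (noisy_signal Psi S eps 1 t thetas w) ^+ 2 *
        \1_[set w' | M < noisy_signal Psi S eps 1 t thetas w' ^+ 2] w)%R]%E
      | t in `[0, 1]] @[M --> +oo%R] --> 0%E)
  (signal_continuous : {within `[0, 1] `*` Theta,
    continuous (fun p : R * 'cV[R]_m => signal Psi S p.1 p.2)})
  (U_nbhs : open_nbhs thetas U)
  (U_Theta : U `<=` Theta)
  (signal_diff : forall t theta, t \in `[0, 1] -> U theta ->
    differentiable (signal Psi S t) theta)
  (signal_diff2 : forall t theta, t \in `[0, 1] -> U theta ->
    differentiable (gradient (signal Psi S t)) theta)
  (gradient_continuous : {within U `*` `[0, 1], continuous
    (fun p : 'cV[R]_m * R => gradient (signal Psi S p.2) p.1)})
  (hessian_continuous : {within U `*` `[0, 1], continuous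
    (fun p : 'cV[R]_m * R => hessian (signal Psi S p.2) p.1)})
  (info_R_nonsingular : info_R Psi S thetas \in unitmx)
  (thetabar_Theta : forall n w, (0 < n)%N -> Theta (thetabar n w))
  (thetabar_min : forall n w theta, (0 < n)%N -> Theta theta ->
    contrast Psi S eps V thetas n (thetabar n w) w <=
    contrast Psi S eps V thetas n theta w) :
  cvg_in_probability P (fun n w =>
    Num.sqrt n%:R *: ((thetabar n w : 'cV[R]_m) - thetas)
    - invmx (info_R Psi S thetas) *m score Psi S eps V thetas n w) 0
  /\
  exists2 mu : probability (borelCV R m) R,
    is_multinormal mu 0 (asymptotic_covariance Psi S eps thetas sigma thetas) &
    cvg_in_distribution P (fun n w =>
      Num.sqrt n%:R *: ((thetabar n w : 'cV[R]_m) - thetas)) mu.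
Proof.
have s_continuous : {within `[0, 1], continuous (fun t => signal Psi S t thetas)}.
  exact: (within_continuousl signal_continuous thetas_Theta).
have X_integrable (t : R) (t01 : t \in `[0, 1]) :=
  unbiased_integrable t thetas t01 thetas_Theta.
have X_mean (t : R) (t01 : t \in `[0, 1]) := unbiased t thetas t01 thetas_Theta.
have [C N] : exists C, noise_array P (noise Psi S eps V thetas)
    (noise_var Psi S eps sigma thetas) C.
  exact: noise_arrayP.
have cG := gradient_within U_nbhs gradient_continuous.
have cGG i j : {within `[0, 1], continuous (fun t : R =>
    (gradient (signal Psi S t) thetas *m (gradient (signal Psi S t) thetas)^T) i j)}.
  have -> : (fun t : R => (gradient (signal Psi S t) thetas *m
      (gradient (signal Psi S t) thetas)^T) i j) = (fun t : R =>
      gradient (signal Psi S t) thetas i 0 * gradient (signal Psi S t) thetas j 0).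
    by apply/funext => t; rewrite [LHS]mxE big_ord1; congr (_ * _); rewrite [LHS]mxE.
  have cc l : {within `[0, 1], continuous (fun t : R =>
      gradient (signal Psi S t) thetas l 0)}.
    move=> t; apply: (cvg_comp _ (fun M : 'cV[R]_m => M l 0) (cG t)).
    exact: coord_continuous.
  by move=> t; apply: cvgM; exact: cc.
have J_lim i j : n%:R^-1 * (\sum_(k < n)
    (gradient (signal Psi S (obs_time n k.+1)) thetas *m
     (gradient (signal Psi S (obs_time n k.+1)) thetas)^T) i j) @[n --> \oo] -->
    info_R Psi S thetas i j.
  by rewrite mxE; exact: riemann_sum_ord (cGG i j).
(* The variance function splits: its trajectory part integrates to [info_Psi], its constant part
   sigma^2 to a multiple of [info_R]. *)
have Gam_lim i j : n%:R^-1 * (\sum_(k < n)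
    noise_var Psi S eps sigma thetas (obs_time n k.+1) *
    (gradient (signal Psi S (obs_time n k.+1)) thetas *m
     (gradient (signal Psi S (obs_time n k.+1)) thetas)^T) i j) @[n --> \oo] -->
    (info_Psi Psi S eps thetas thetas + sigma ^+ 2 *: info_R Psi S thetas) i j.
  rewrite mxE [X in _ + X]mxE.
  under eq_fun do under eq_bigr do rewrite mulrDl.
  under eq_fun do rewrite big_split mulrDr -mulr_sumr mulrCA.
  apply: cvgD; last by apply: cvgM; [exact: cvg_cst|exact: J_lim].
  rewrite mxE; apply: riemann_sum_ord => t.
  apply: cvgM; last exact: cGG.
  exact: centered_mean_continuous.
have thetabar_measurable n : measurable_fun setT (thetabar n : T -> borelCV R m).
  exact: measurable_funPT.
(* The contrast differs from 1/n times the excess by the mean squared error, which does not depend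
   on theta, so the minimizers are the same. *)
have excess_min n w theta : (0 < n)%N -> Theta theta ->
    contrast_excess (noise Psi S eps V thetas) (signal Psi S) thetas n (thetabar n w) w <=
    contrast_excess (noise Psi S eps V thetas) (signal Psi S) thetas n theta w.
  move=> n0 th; have := thetabar_min n w theta n0 th.
  have contrastE th' : contrast Psi S eps V thetas n th' w =
      n%:R^-1 * (\sum_(k < n) noise Psi S eps V thetas n k w ^+ 2 +
        contrast_excess (noise Psi S eps V thetas) (signal Psi S) thetas n th' w).
    rewrite /contrast big_add1 big_mkord -big_split/=; congr (_ * _).
    apply: eq_bigr => k _.
    rewrite /observation /trajectory /noise /model_noise /noisy_signal /signal_gap.
    ring.
  by rewrite !contrastE ler_pM2l ?invr_gt0 ?ltr0n// lerD2l.
have scoreE : score Psi S eps V thetas =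
    scaled_score (noise Psi S eps V thetas) thetas (signal Psi S).
  apply/funext => n; apply/funext => w; rewrite /score /scaled_score /score_sum.
  by rewrite big_add1 big_mkord.
split.
  rewrite scoreE.
  exact: (error_cvg_in_probability N Theta_compact thetas_Theta signal_continuous
    identifiability thetabar_measurable thetabar_Theta excess_min U_nbhs U_Theta
    signal_diff signal_diff2 gradient_continuous hessian_continuous
    info_R_nonsingular J_lim).
exact: (error_asymptotic_normality N Theta_compact thetas_Theta signal_continuous
    identifiability thetabar_measurable thetabar_Theta excess_min U_nbhs U_Theta
    signal_diff signal_diff2 gradient_continuous hessian_continuous
    info_R_nonsingular J_lim Gam_lim).
Qed.
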